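(* Let $D$ be a bounded strictly pseudoconvex domain in $\mathbb C^n$ with smooth ($C^\infty$) boundary for which $\inf_{z,w\in D}|k_D(z,w)|>0$, where $k_D$ is the Bergman kernel of $D$. Then for every $\Omega$ in a sufficiently small $C^\infty$ neighbourhood of $D$, the corona theorem (i.e. the Corona Property) holds for $H^\infty(\Omega)$ if and only if the Convex Poisson Property holds for $A^2(\Omega)$.
   Context: ''For every $\Omega$ in a sufficiently small $C^\infty$ neighbourhood of $D$'' means: there exist $j\in\mathbb N$ and $\varepsilon>0$ such that the conclusion holds for every domain $\Omega=\Phi(D)$, where $\Phi:\overline D\to\overline\Omega\subset\mathbb C^n$ is a $C^\infty$ diffeomorphism with $\|\Phi-\mathrm{id}\|_{C^j(\overline D)}<\varepsilon$. $H^\infty(\Omega)$ is the algebra of bounded holomorphic functions on $\Omega$. $A^2(\Omega)$ is the Bergman space of holomorphic $f$ with $\|f\|^2=\int_\Omega|f|^2d\mu<\infty$, $\mu$ normalized Lebesgue measure on $\Omega$; $k_a$ is its reproducing kernel at $a\in\Omega$ and $\widetilde{k_a}=k_a/\sqrt{k_a(a)}$. For $M\ge1$, $\mathbf a=(a_1,\dots,a_M)\in\Omega^M$ and $\theta=(\theta_0,\dots,\theta_M)\in[0,1]^{M+1}$ with $\sum_m\theta_m=1$, put $$\|h\|_{\mathbf a,\theta}^2=\int_\Omega|h|^2\Big(\theta_0+\sum_{m=1}^M\theta_m|\widetilde{k_{a_m}}|^2\Big)d\mu .$$ Corona data: $N\ge1$, $c>0$, and $\varphi_1,\dots,\varphi_N\in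 H^\infty(\Omega)$ with $1\ge\max_\ell|\varphi_\ell(z)|^2\ge c^2>0$ for all $z\in\Omega$. Corona Property for $H^\infty(\Omega)$: for all corona data there are $C>0$ and $f_1,\dots,f_N\in H^\infty(\Omega)$ with $\max_\ell|f_\ell(z)|^2\le C^2$ and $\sum_\ell\varphi_\ell(z)f_\ell(z)=1$ for all $z\in\Omega$. Convex Poisson Property for $A^2(\Omega)$: for all corona data there is $C>0$ such that for all $M\ge1$, all $\mathbf a=(a_1,\dots,a_M)\in\Omega^M$ and all $\theta=(\theta_0,\dots,\theta_M)\in[0,1]^{M+1}$ with $\sum_{m=0}^M\theta_m=1$ there are $f_1,\dots,f_N\in A^2(\Omega)$ with $\sum_\ell\|f_\ell\|_{\mathbf a,\theta}^2\le C^2$ and $\sum_\ell\varphi_\ell f_\ell=1$ on $\Omega$. *)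

(* Defs.v *)
From HB Require Import structures.
From mathcomp Require Import all_boot all_order all_algebra.
From mathcomp Require Import complex.
From mathcomp Require Import all_classical all_reals all_analysis.

Set Implicit Arguments.
Unset Strict Implicit.
Unset Printing Implicit Defensive.

Import Order.TTheory GRing.Theory Num.Theory.
Import numFieldNormedType.Exports.

Local Open Scope classical_set_scope.
Local Open Scope ring_scope.
Local Open Scope complex_scope.

(* The structures that numFieldNormedType.Exports puts on an abstract         *)
(* numFieldType; with them C^n is 'rV[R[i]]_n with the sup norm.              *)
HB.instance Definition _ (R : realType) := NormedModule.copy R[i] R[i]^o.

Section LebesgueTuple.
Context {R : realType}.
Local Notation T := (measurableTypeR R).

Definition cons_pair m (p : T * m.-tuple T) : m.+1.-tuple T :=
  [tuple of p.1 :: p.2].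

Lemma measurable_cons_pair m :
  measurable_fun [set: T * m.-tuple T] (@cons_pair m).
Proof. exact: measurable_cons. Qed.

Section Step.
Variables (m : nat) (mu : {sigma_finite_measure set (m.-tuple T) -> \bar R}).

Definition lebesgue_cons : set (m.+1.-tuple T) -> \bar R :=
  pushforward (lebesgue_measure \x mu)%E (@cons_pair m).

(* The measure instance of pushforward takes the measurability proof as an    *)
(* argument, so it is not inferred.                                           *)
Let lebesgue_cons_measure : {measure set (m.+1.-tuple T) -> \bar R} :=
  measure_function_pushforward__canonical__measure_function_Measure
    (lebesgue_measure \x mu)%E (@measurable_cons_pair m).

HB.instance Definition _ := Measure.copy lebesgue_cons lebesgue_cons_measure.

Lemma lebesgue_cons_sigma_finite : sigma_finite setT lebesgue_cons.
Proof.
have /sigma_finiteP[F [FT ndF Foo]] := sigma_finiteT (@lebesgue_measure R).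
have /sigma_finiteP[G [GT ndG Goo]] := sigma_finiteT mu.
pose g (t : m.+1.-tuple T) : T * m.-tuple T := (tnth t ord0, [tuple of behead t]).
have mg : measurable_fun [set: m.+1.-tuple T] g.
  apply/measurable_fun_pair; first exact: measurable_tnth.
  exact: measurable_behead.
have gK p : g (cons_pair p) = p.
  by case: p => x t; congr pair; apply/val_inj.
exists (fun i => g @^-1` (F i `*` G i)).
  apply/esym/seteqP; split=> // t _.
  have : setT (g t).1 by []; have : setT (g t).2 by [].
  rewrite {1}FT {1}GT => -[k _ Gk] [i _ Fi].
  exists (maxn i k) => //; split.
    by move: Fi; exact/subsetPset/ndF/leq_maxl.
  by move: Gk; exact/subsetPset/ndG/leq_maxr.
move=> i; have [mF ?] := Foo i; have [mG ?] := Goo i; split.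
  by rewrite -[X in measurable X]setTI; apply: mg => //; exact: measurableX.
rewrite /lebesgue_cons /pushforward -comp_preimage.
rewrite (_ : g \o _ = id) /=; last by apply/funext => p; exact: gK.
by rewrite preimage_id product_measure1E// lte_mul_pinfty// ge0_fin_numE.
Qed.

HB.instance Definition _ := Measure_isSigmaFinite.Build _ _ _ lebesgue_cons
  lebesgue_cons_sigma_finite.

End Step.

Fixpoint lebesgue_tuple m : {sigma_finite_measure set (m.-tuple T) -> \bar R} :=
  match m with
  | 0 => \d_([tuple] : 0.-tuple T)
  | m'.+1 => lebesgue_cons (lebesgue_tuple m')
  end.

End LebesgueTuple.

Section Smoothness.
Context {R : realType} {m : nat} {W : normedModType R}.

Definition unit_vec (i : 'I_m) : 'rV[R]_m := delta_mx 0 i.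

Definition iter_partial (s : seq 'I_m) (F : 'rV[R]_m -> W) : 'rV[R]_m -> W :=
  foldr (fun i G => 'D_(unit_vec i) G) F s.

Definition smooth_on (U : set 'rV[R]_m) (F : 'rV[R]_m -> W) : Prop :=
  forall (s : seq 'I_m) x, U x ->
    {for x, continuous (iter_partial s F)} /\
    forall i, derivable (iter_partial s F) x (unit_vec i).

(* The C^j(A) norm of a function smooth near A.  For A the closure of an open *)
(* set, it only depends on the restriction of F to A.                         *)
Definition Cnorm (j : nat) (A : set 'rV[R]_m) (F : 'rV[R]_m -> W) : \bar R :=
  ereal_sup [set y | exists (s : seq 'I_m) x,
    [/\ (size s <= j)%N, A x & y = `|iter_partial s F x|%:E]].

End Smoothness.

Section ComplexSpace.
Context {R : realType} {n : nat}.
Local Notation Cn := 'rV[R[i]]_n.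
Local Notation R2n := 'rV[R]_(n + n).
Local Notation normc := ComplexField.Normc.normc.

(* R^2n is identified with C^n through z_j = x_j + i x_(n+j). *)
Definition to_complex (x : R2n) : Cn :=
  \row_j (x 0 (lshift n j) +i* x 0 (rshift n j)).

Definition to_real (z : Cn) : R2n :=
  row_mx (\row_j complex.Re (z 0 j)) (\row_j complex.Im (z 0 j)).

Definition realify (F : Cn -> Cn) : R2n -> R2n := to_real \o F \o to_complex.

(* Functions on a subset of C^n are represented by total functions, whose     *)
(* values outside that subset are irrelevant.                                 *)

Definition domain (D : set Cn) : Prop := [/\ open D, connected D & D !=set0].

Definition boundary (D : set Cn) : set Cn := closure D `\` interior D.

Definition smooth_near (A : set Cn) (F : Cn -> Cn) : Prop :=
  exists U : set Cn,
    [/\ open U, A `<=` U & smooth_on (to_complex @^-1` U) (realify F)].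

Definition smooth_diffeo (A B : set Cn) (Phi : Cn -> Cn) : Prop :=
  smooth_near A Phi /\ exists Psi : Cn -> Cn,
    [/\ smooth_near B Psi,
        forall z, A z -> B (Phi z) /\ Psi (Phi z) = z &
        forall w, B w -> A (Psi w) /\ Phi (Psi w) = w].

Definition close_domain (j : nat) (eps : R) (D Omega : set Cn) : Prop :=
  exists Phi : Cn -> Cn,
    [/\ smooth_diffeo (closure D) (closure Omega) Phi, Phi @` D = Omega &
        (Cnorm j (to_complex @^-1` closure D) (fun x => (realify Phi x - x)%R)
           < eps%:E)%E].

Definition real_partial (i : 'I_(n + n)) (g : Cn -> R[i]) (z : Cn) : R[i] :=
  'D_(unit_vec i) (fun x => complex.Re (g (to_complex x))) (to_real z) +i*
  'D_(unit_vec i) (fun x => complex.Im (g (to_complex x))) (to_real z).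

Definition d_z (j : 'I_n) (g : Cn -> R[i]) (z : Cn) : R[i] :=
  (real_partial (lshift n j) g z - 'i%C * real_partial (rshift n j) g z) / 2.

Definition d_zbar (j : 'I_n) (g : Cn -> R[i]) (z : Cn) : R[i] :=
  (real_partial (lshift n j) g z + 'i%C * real_partial (rshift n j) g z) / 2.

Definition levi_form (rho : Cn -> R) (p w : Cn) : R[i] :=
  \sum_(j < n) \sum_(k < n)
    d_z j (d_zbar k (fun z => (rho z)%:C)) p * w 0 j * (w 0 k)^*.

Definition smooth_defining_function (D U : set Cn) (rho : Cn -> R) : Prop :=
  [/\ open U /\ boundary D `<=` U,
      smooth_on (to_complex @^-1` U) (rho \o to_complex),
      forall z, U z -> (D z <-> rho z < 0) &
      forall p, boundary D p -> exists i : 'I_(n + n),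
        'D_(unit_vec i) (rho \o to_complex) (to_real p) != 0].

(* D has C^oo boundary and is strictly (Levi) pseudoconvex: the Levi form of  *)
(* a defining function is positive definite on complex tangent spaces.  The   *)
(* order of R[i] makes 0 < x include that x is real.                          *)
Definition smooth_strictly_pseudoconvex (D : set Cn) : Prop :=
  exists (U : set Cn) (rho : Cn -> R), smooth_defining_function D U rho /\
    forall p w : Cn, boundary D p -> w != 0 ->
      \sum_(j < n) d_z j (fun z => (rho z)%:C) p * w 0 j = 0 ->
      0 < levi_form rho p w.

Definition holomorphic_on (Omega : set Cn) (f : Cn -> R[i]) : Prop :=
  forall z, Omega z -> differentiable f z.

Definition point_of_tuple (t : (n + n).-tuple (measurableTypeR R)) : Cn :=
  to_complex (\row_i tnth t i).

Definition volume (A : set Cn) : \bar R :=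
  lebesgue_tuple (n + n) (point_of_tuple @^-1` A).

(* The measure on Omega is Lebesgue measure normalized to have mass 1. *)
Definition mean_int (Omega : set Cn) (g : Cn -> R) : \bar R :=
  (((fine (volume Omega))^-1)%:E *
   \int[lebesgue_tuple (n + n)]_(t in point_of_tuple @^-1` Omega)
     (g (point_of_tuple t))%:E)%E.

Definition complex_mean_int (Omega : set Cn) (g : Cn -> R[i]) : R[i] :=
  fine (mean_int Omega (fun z => complex.Re (g z))) +i*
  fine (mean_int Omega (fun z => complex.Im (g z))).

Definition Hinfty (Omega : set Cn) (f : Cn -> R[i]) : Prop :=
  holomorphic_on Omega f /\
  exists B : R, forall z, Omega z -> normc (f z) <= B.

Definition A2 (Omega : set Cn) (f : Cn -> R[i]) : Prop :=
  holomorphic_on Omega f /\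
  (mean_int Omega (fun z => (normc (f z) ^+ 2)%R) < +oo)%E.

Definition reproducing_at (Omega : set Cn) (a : Cn) (k : Cn -> R[i]) : Prop :=
  A2 Omega k /\ forall f, A2 Omega f ->
    f a = complex_mean_int Omega (fun z => f z * (k z)^*).

(* bergman_kernel Omega a z is k_a(z) = k(z, a); for a in Omega, its values   *)
(* on Omega are uniquely determined.                                          *)
Definition bergman_kernel (Omega : set Cn) (a : Cn) : Cn -> R[i] :=
  xget (fun=> 0) [set k | reproducing_at Omega a k].

Definition normalized_kernel (Omega : set Cn) (a z : Cn) : R[i] :=
  bergman_kernel Omega a z / sqrtC (bergman_kernel Omega a a).

Definition weighted_norm2 (Omega : set Cn) (M : nat) (a : 'I_M -> Cn)
    (theta : 'I_M.+1 -> R) (h : Cn -> R[i]) : \bar R :=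
  mean_int Omega (fun z => normc (h z) ^+ 2 *
    (theta ord0 +
     \sum_(m < M) theta (lift ord0 m) *
       normc (normalized_kernel Omega (a m) z) ^+ 2)).

(* Maxima are over nonnegative reals, so 0 is a neutral starting value. *)
Definition corona_data (Omega : set Cn) (N : nat) (c : R)
    (phi : 'I_N -> Cn -> R[i]) : Prop :=
  [/\ (0 < N)%N, 0 < c, forall l, Hinfty Omega (phi l) &
      forall z, Omega z ->
        c ^+ 2 <= \big[Num.max/0]_(l < N) normc (phi l z) ^+ 2 <= 1].

Definition corona_property (Omega : set Cn) : Prop :=
  forall (N : nat) (c : R) (phi : 'I_N -> Cn -> R[i]),
    corona_data Omega c phi ->
    exists (C : R) (f : 'I_N -> Cn -> R[i]),
      [/\ 0 < C, forall l, Hinfty Omega (f l) &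
          forall z, Omega z ->
            \big[Num.max/0]_(l < N) normc (f l z) ^+ 2 <= C ^+ 2 /\
            \sum_(l < N) phi l z * f l z = 1].

Definition convex_poisson_property (Omega : set Cn) : Prop :=
  forall (N : nat) (c : R) (phi : 'I_N -> Cn -> R[i]),
    corona_data Omega c phi ->
    exists2 C : R, 0 < C &
      forall (M : nat) (a : 'I_M -> Cn) (theta : 'I_M.+1 -> R),
        (0 < M)%N -> (forall m, Omega (a m)) ->
        (forall m, 0 <= theta m <= 1) -> \sum_m theta m = 1 ->
        exists f : 'I_N -> Cn -> R[i],
          [/\ forall l, A2 Omega (f l),
              (\sum_(l < N) weighted_norm2 Omega a theta (f l)
                 <= (C ^+ 2)%:E)%E &
              forall z, Omega z -> \sum_(l < N) phi l z * f l z = 1].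

End ComplexSpace.

(* Main.v *)
(* Proof idea.  With j = 0 and eps = 1 every admissible Omega is bounded, and the equivalence holds on
   every bounded domain.  A bounded solution is a solution for all weights with the same bound, since
   each |k~_a|^2 has mean 1.  Conversely, fix a_1, ..., a_M.  The set of vectors dominating
   (sum_l ||f_l||^2, sum_l || f_l k~_(a_m) ||^2)_m, for f a solution, is convex, so the Convex Poisson
   Property and a finite minimax argument give one solution for which all these norms are at most
   C^2 + 1.  Reproducing f k_a at a gives |f(a)|^2 <= || f k~_a ||^2, hence f is bounded by C + 1 at
   all a_m simultaneously.  Along a dense sequence of points these constraints define decreasing convex
   sets of solutions; the elements of almost minimal norm are Cauchy by the parallelogram identity
   and converge to a bounded solution.  The Cauchy estimates behind local boundedness of point
   evaluation and holomorphy of limits rest on Goursat's theorem on rectangles and a submean inequality on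
   squares, iterated over the coordinates. *)
From HB Require Import structures.
Require Import Defs.
From mathcomp Require Import all_boot all_order all_algebra.
From mathcomp Require Import complex.
From mathcomp Require Import all_classical all_reals all_analysis.
From mathcomp Require Import measurable_realfun.
From mathcomp Require Import ring lra.

Set Implicit Arguments.
Unset Strict Implicit.
Unset Printing Implicit Defensive.

Import Order.TTheory GRing.Theory Num.Theory.
Import numFieldNormedType.Exports.

Local Open Scope classical_set_scope.
Local Open Scope ring_scope.
Local Open Scope complex_scope.

(** The solutions given by the Convex Poisson Property depend on the weights, and no closedness of
    the set of their norm vectors is available. The minimax step therefore concedes a margin, here
    1, and [C^2 + 1 <= (C + 1)^2] explains the bound [C + 1]. Its weights are strictly positive,
    because a finite weighted norm then controls each of its terms. Convexity takes the place of
    weak compactness in the passage to all of Omega: the least norms on decreasing convex sets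
    increase to a finite limit, so almost minimal elements of late sets are close to each other. The
    same limit, for the convex set of functions with value 1 at [a], is an extremal function, of
    which the Bergman kernel is a multiple. Squares replace discs throughout. If the form [P dz] is
    invariant under the quarter turn, the four sides of a square contribute equally; this plays the
    role of rotation averages. A function is combined with its three quarter turns, with
    coefficients 1 to recover its value at the centre, and with suitable powers of [i] to recover
    its derivative. *)

Local Notation normc := ComplexField.Normc.normc.

(** * Goursat's theorem on rectangles *)

Section Goursat.
Context {R : realType}.
Implicit Types (u v U V : R -> R -> R).

(* v + i u is complex differentiable at x + i y; equivalently, the derivative of
   the 1-form u dx + v dy = Im ((v + i u) dz) is symmetric there. *)
Definition closed_at u v x y := exists a b c : R, forall e, 0 < e ->
  exists2 d, 0 < d & forall h k, `|h| <= d -> `|k| <= d ->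
    `|u (x + h) (y + k) - u x y - a * h - b * k| <= e * (`|h| + `|k|) /\
    `|v (x + h) (y + k) - v x y - b * h - c * k| <= e * (`|h| + `|k|).

(* The integral of u dx + v dy along the boundary of a rectangle, where U ^~ y is a
   primitive of u ^~ y and V x is a primitive of v x. *)
Definition rect_int U V x1 x2 y1 y2 :=
  (U x2 y1 - U x1 y1) + (V x2 y2 - V x2 y1)
  - (U x2 y2 - U x1 y2) - (V x1 y2 - V x1 y1).

Lemma mvt_bound (f df : R -> R) (a b c m : R) : a <= b ->
  (forall x, a <= x <= b -> is_derive x 1 f (df x)) ->
  (forall x, a <= x <= b -> `|df x - c| <= m) ->
  `|f b - f a - c * (b - a)| <= m * (b - a).
Proof.
move=> ab fd dfm.
have [x xab ->] : exists2 x, x \in `[a, b] & f b - f a = df x * (b - a).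
  apply: MVT_segment => //.
    by move=> x; rewrite in_itv /= => /andP[? ?]; apply: fd; rewrite !ltW.
  apply: derivable_within_continuous => x; rewrite in_itv /= => xab.
  exact: (@ex_derive _ _ _ _ _ _ _ (fd x xab)).
rewrite -mulrBl normrM [`|b - a|]ger0_norm ?subr_ge0//.
by apply: ler_wpM2r; rewrite ?subr_ge0//; apply: dfm; move: xab; rewrite in_itv.
Qed.

(** Opposite sides are compared: the linear approximation predicts [- b (x2 - x1) (y2 - y1)] for the
    horizontal pair and the opposite value for the vertical pair, since [b] is both the [y]-slope of
    [u] and the [x]-slope of [v]. Only the errors survive. *)
Lemma rect_int_local u v U V (x y x1 x2 y1 y2 e d a b c : R) :
  (forall h k, `|h| <= d -> `|k| <= d ->
    `|u (x + h) (y + k) - u x y - a * h - b * k| <= e * (`|h| + `|k|) /\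
    `|v (x + h) (y + k) - v x y - b * h - c * k| <= e * (`|h| + `|k|)) ->
  x1 <= x <= x2 -> y1 <= y <= y2 -> x2 - x1 <= d -> y2 - y1 <= d -> 0 <= e ->
  (forall s t : R, x1 <= s <= x2 -> y1 <= t <= y2 -> is_derive s 1 (U^~ t) (u s t)) ->
  (forall s t : R, x1 <= s <= x2 -> y1 <= t <= y2 -> is_derive t 1 (V s) (v s t)) ->
  `|rect_int U V x1 x2 y1 y2| <= 2 * e * ((x2 - x1) + (y2 - y1)) ^+ 2.
Proof.
move=> H xI yI wd hd e0 dU dV.
have uv s t : x1 <= s <= x2 -> y1 <= t <= y2 ->
    `|u s t - u x y - a * (s - x) - b * (t - y)| <= e * ((x2 - x1) + (y2 - y1)) /\
    `|v s t - v x y - b * (s - x) - c * (t - y)| <= e * ((x2 - x1) + (y2 - y1)).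
  move=> sI tI.
  have hs : `|s - x| <= x2 - x1 by rewrite ler_norml; lra.
  have ht : `|t - y| <= y2 - y1 by rewrite ler_norml; lra.
  have [] := H (s - x) (t - y) (le_trans hs wd) (le_trans ht hd).
  rewrite [x + _]addrC subrK [y + _]addrC subrK => h1 h2.
  have E : e * (`|s - x| + `|t - y|) <= e * ((x2 - x1) + (y2 - y1)).
    by rewrite ler_wpM2l// lerD.
  by split; [apply: le_trans h1 _ | apply: le_trans h2 _].
have itv_l (p q : R) : p <= q -> p <= p <= q by move=> ->; rewrite lexx.
have itv_r (p q : R) : p <= q -> p <= q <= q by move=> ->; rewrite lexx.
have y12 : y1 <= y2 by lra.
have x12 : x1 <= x2 by lra.
set K := e * _ in uv.
have A := @mvt_bound (fun s => U s y1 - U s y2) (fun s => u s y1 - u s y2)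
  x1 x2 (- b * (y2 - y1)) (2 * K) x12.
have {}A : `|(U x2 y1 - U x2 y2) - (U x1 y1 - U x1 y2) - (- b * (y2 - y1)) * (x2 - x1)|
    <= 2 * K * (x2 - x1).
  apply: A => [s sI|s sI].
    by apply: is_deriveB; apply: dU => //; rewrite lexx ?y12.
  have [+ _] := uv s y1 sI (itv_l _ _ y12).
  have [+ _] := uv s y2 sI (itv_r _ _ y12).
  by rewrite !ler_norml; lra.
have B := @mvt_bound (fun s => V x2 s - V x1 s) (fun s => v x2 s - v x1 s)
  y1 y2 (b * (x2 - x1)) (2 * K) y12.
have {}B : `|(V x2 y2 - V x1 y2) - (V x2 y1 - V x1 y1) - (b * (x2 - x1)) * (y2 - y1)|
    <= 2 * K * (y2 - y1).
  apply: B => [s sI|s sI].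
    by apply: is_deriveB; apply: dV => //; rewrite lexx ?x12.
  have [_ +] := uv x2 s (itv_r _ _ x12) sI.
  have [_ +] := uv x1 s (itv_l _ _ x12) sI.
  by rewrite !ler_norml; lra.
have -> : 2 * e * (x2 - x1 + (y2 - y1)) ^+ 2 =
    2 * K * (x2 - x1) + 2 * K * (y2 - y1) by rewrite /K; ring.
apply: le_trans (lerD A B); apply: le_trans (ler_normD _ _).
by rewrite le_eqVlt; apply/orP; left; apply/eqP; congr `| _ |; rewrite /rect_int; ring.
Qed.

(** Quadrisection: a rectangle whose integral is at least [c0] times the square of its
    half-perimeter has a quarter with the same property, and the nested quarters shrink to a point
    at which [rect_int_local], for the error [c0 / 4], allows only half of that. *)
Lemma goursat u v U V (x1 x2 y1 y2 : R) : x1 <= x2 -> y1 <= y2 ->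
  (forall x y : R, x1 <= x <= x2 -> y1 <= y <= y2 -> closed_at u v x y) ->
  (forall x y : R, x1 <= x <= x2 -> y1 <= y <= y2 -> is_derive x 1 (U^~ y) (u x y)) ->
  (forall x y : R, x1 <= x <= x2 -> y1 <= y <= y2 -> is_derive y 1 (V x) (v x y)) ->
  rect_int U V x1 x2 y1 y2 = 0.
Proof.
move=> x12 y12 uv dU dV; apply/eqP; apply: contraT => J0.
set w := x2 - x1; set h := y2 - y1.
have w0 : 0 <= w by rewrite subr_ge0.
have h0 : 0 <= h by rewrite subr_ge0.
(* A rectangle reduced to a point has zero integral, so the quotient [c0] below is meaningful. *)
have wh0 : 0 < w + h.
  rewrite lt_neqAle addr_ge0// andbT eq_sym; apply: contra J0 => /eqP wh.
  have {}wh : w = 0 /\ h = 0 by split; lra.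
  have [/eqP + /eqP] := wh; rewrite !subr_eq0 => /eqP -> /eqP ->.
  by rewrite /rect_int; apply/eqP; ring.
set c0 := `|rect_int U V x1 x2 y1 y2| / (w + h) ^+ 2.
have c00 : 0 < c0 by rewrite divr_gt0 ?normr_gt0 ?exprn_gt0.
pose q k : R := 2^-1 ^+ k.
have q0 k : 0 < q k by rewrite exprn_gt0// invr_gt0.
have qS k : q k = q k.+1 * 2 by rewrite /q exprSr mulfVK.
(* [p] is the lower left corner; the sides are those of the given rectangle scaled by [2^-k]. *)
pose bad (p : R * R) k := c0 * ((w + h) * q k) ^+ 2 <=
  `|rect_int U V p.1 (p.1 + w * q k) p.2 (p.2 + h * q k)|.
have step (kp : nat * (R * R)) : exists p' : R * R, bad kp.2 kp.1 ->
    [/\ kp.2.1 <= p'.1, p'.1 + w * q kp.1.+1 <= kp.2.1 + w * q kp.1,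
        kp.2.2 <= p'.2, p'.2 + h * q kp.1.+1 <= kp.2.2 + h * q kp.1 & bad p' kp.1.+1].
  case: kp => k [x y] /=; apply/not_existsP => H.
  have wq : 0 <= w * q k.+1 by rewrite mulr_ge0// ltW.
  have hq : 0 <= h * q k.+1 by rewrite mulr_ge0// ltW.
  have G x' y' : x' = x \/ x' = x + w * q k.+1 -> y' = y \/ y' = y + h * q k.+1 ->
      ~~ bad (x', y') k.+1 /\ bad (x, y) k.
    move=> hx hy; have /not_implyP[B nB] := H (x', y'); split=> //.
    apply/negP => B'; apply: nB; rewrite /= (qS k); split=> //.
    + by case: hx => ->; lra.
    + by case: hx => ->; lra.
    + by case: hy => ->; lra.
    + by case: hy => ->; lra.
  have half z l : z + l * q k.+1 + l * q k.+1 = z + l * q k by rewrite (qS k); ring.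
  have [B1 B] := G x y (or_introl erefl) (or_introl erefl).
  have [B2 _] := G (x + w * q k.+1) y (or_intror erefl) (or_introl erefl).
  have [B3 _] := G x (y + h * q k.+1) (or_introl erefl) (or_intror erefl).
  have [B4 _] := G (x + w * q k.+1) (y + h * q k.+1) (or_intror erefl) (or_intror erefl).
  move: B1 B2 B3 B4; rewrite /bad /= -!ltNge !half.
  move=> B1 B2 B3 B4; move: B; rewrite /bad /= leNgt => /negP; apply.
  set J1 := rect_int _ _ _ _ _ _ in B1; set J2 := rect_int _ _ _ _ _ _ in B2.
  set J3 := rect_int _ _ _ _ _ _ in B3; set J4 := rect_int _ _ _ _ _ _ in B4.
  have -> : rect_int U V x (x + w * q k) y (y + h * q k) = J1 + J2 + J3 + J4.
    by rewrite /J1 /J2 /J3 /J4 /rect_int; ring.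
  have -> : c0 * ((w + h) * q k) ^+ 2 = c0 * ((w + h) * q k.+1) ^+ 2 +
     c0 * ((w + h) * q k.+1) ^+ 2 + c0 * ((w + h) * q k.+1) ^+ 2 +
     c0 * ((w + h) * q k.+1) ^+ 2 by rewrite (qS k); ring.
  apply: le_lt_trans (ler_normD _ _) _; apply: ltrD => //.
  apply: le_lt_trans (ler_normD _ _) _; apply: ltrD => //.
  by apply: le_lt_trans (ler_normD _ _) _; apply: ltrD.
have {step}[nxt nxtP] := choice step.
pose s := fix s k := if k is k'.+1 then nxt (k', s k') else (x1, y1).
have sbad k : bad (s k) k.
  elim: k => [|k IH]; last by have [] := nxtP (k, s k) IH.
  rewrite /bad /= /q expr0 !mulr1 /w /h !subrKC.
  by rewrite /c0 /w /h mulfVK// expf_neq0// gt_eqF.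
have sP k := nxtP (k, s k) (sbad k).
pose X k := (s k).1; pose Y k := (s k).2.
have lim (Z : nat -> R) (l : R) : 0 <= l -> (forall k, Z k <= Z k.+1) ->
    (forall k, Z k.+1 + l * q k.+1 <= Z k + l * q k) ->
    exists z, forall k, Z k <= z <= Z k + l * q k.
  move=> l0 Zm Zd.
  have Zle m n : Z m <= Z n + l * q n.
    have /nondecreasing_seqP up := Zm.
    have /nonincreasing_seqP down : forall k, Z k + l * q k >= Z k.+1 + l * q k.+1 by [].
    have [mn|nm] := leqP m n.
      by apply: le_trans (up _ _ mn) _; rewrite lerDl mulr_ge0// ltW.
    apply: le_trans (down _ _ (ltnW nm)); rewrite lerDl mulr_ge0// ltW//.
  exists (sup (range Z)) => k; apply/andP; split.
    apply: ub_le_sup; last by exists k.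
    by exists (Z 0%N + l * q 0%N) => _ [m _ <-].
  by apply: ge_sup => [|_ [m _ <-]//]; exists (Z 0%N), 0%N.
have [x xP] : exists x, forall k, X k <= x <= X k + w * q k.
  by apply: lim => // k; have [] := sP k.
have [y yP] : exists x, forall k, Y k <= x <= Y k + h * q k.
  by apply: lim => // k; have [] := sP k.
have XQ k : x1 <= X k /\ X k + w * q k <= x2.
  elim: k => [|k [IH1 IH2]]; first by rewrite /X /= /q expr0 mulr1 /w; split; lra.
  have [? ? _ _ _] := sP k; split; first exact: le_trans IH1 _.
  exact: le_trans IH2.
have YQ k : y1 <= Y k /\ Y k + h * q k <= y2.
  elim: k => [|k [IH1 IH2]]; first by rewrite /Y /= /q expr0 mulr1 /h; split; lra.
  have [_ _ ? ? _] := sP k; split; first exact: le_trans IH1 _.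
  exact: le_trans IH2.
have xI : x1 <= x <= x2 by have := xP 0%N; have := XQ 0%N; lra.
have yI : y1 <= y <= y2 by have := yP 0%N; have := YQ 0%N; lra.
have [a [b [c H]]] := uv x y xI yI.
have [d d0 {}H] := H (c0 / 4) (divr_gt0 c00 (ltr0n _ 4)).
have [k kd] : exists k, (w + h) * q k < d.
  have /cvgrPdist_lt/(_ _ (divr_gt0 d0 wh0)) : q @ \oo --> 0.
    apply: cvg_expr; rewrite ger0_norm ?invr_ge0// invf_lt1//; lra.
  case=> k _ /(_ k (leqnn k)); rewrite /= sub0r normrN gtr0_norm// ltr_pdivlMr//.
  by exists k; rewrite mulrC.
have wk : 0 <= w * q k by rewrite mulr_ge0// ltW.
have hk : 0 <= h * q k by rewrite mulr_ge0// ltW.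
have := @rect_int_local u v U V x y (X k) (X k + w * q k) (Y k) (Y k + h * q k)
  (c0 / 4) d a b c H (xP k) (yP k).
have [? ?] := XQ k; have [? ?] := YQ k.
have e0 : 0 <= c0 / 4 by lra.
have wd : X k + w * q k - X k <= d by lra.
have hd : Y k + h * q k - Y k <= d by lra.
move=> /(_ wd hd e0).
have Su : forall s0 t, X k <= s0 <= X k + w * q k -> Y k <= t <= Y k + h * q k ->
    is_derive s0 1 (U^~ t) (u s0 t) by move=> s0 t ? ?; apply: dU; lra.
have Sv : forall s0 t, X k <= s0 <= X k + w * q k -> Y k <= t <= Y k + h * q k ->
    is_derive t 1 (V s0) (v s0 t) by move=> s0 t ? ?; apply: dV; lra.
move=> /(_ Su Sv) L.
have := le_trans (sbad k) L.
have -> : X k + w * q k - X k + (Y k + h * q k - Y k) = (w + h) * q k by ring.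
rewrite ler_pM2r; last by rewrite exprn_gt0// mulr_gt0.
by move=> ?; exfalso; lra.
Qed.

End Goursat.

(** * Topology of the complex numbers *)

Section ComplexTopology.
Context {R : realType}.
Implicit Types (z w : R[i]) (x y e : R).

Lemma normcE z : `|z| = (normc z)%:C.
Proof. by []. Qed.

Lemma normc_ge0 z : 0 <= normc z.
Proof. by case: z => a b; exact: sqrtr_ge0. Qed.

Lemma normc_sq z : normc z ^+ 2 = complex.Re z ^+ 2 + complex.Im z ^+ 2.
Proof. by case: z => a b; rewrite sqr_sqrtr// addr_ge0// sqr_ge0. Qed.

Lemma normc_eq0 z : (normc z == 0) = (z == 0).
Proof.
apply/eqP/eqP => [|->]; last exact: ComplexField.Normc.normc0.
exact: ComplexField.Normc.eq0_normc.
Qed.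

Lemma normc_gt0 z : (0 < normc z) = (z != 0).
Proof. by rewrite lt_neqAle normc_ge0 andbT eq_sym normc_eq0. Qed.

Lemma normcD z w : normc (z + w) <= normc z + normc w.
Proof. exact: le_normcD. Qed.

Lemma normcB z w : normc (z - w) <= normc z + normc w.
Proof. by rewrite -[normc w]normcN normcD. Qed.

Lemma Re_normc z : `|complex.Re z| <= normc z.
Proof.
by rewrite -ler_sqr ?nnegrE ?normc_ge0// normc_sq real_normK ?num_real// lerDl sqr_ge0.
Qed.

Lemma Im_normc z : `|complex.Im z| <= normc z.
Proof.
by rewrite -ler_sqr ?nnegrE ?normc_ge0// normc_sq real_normK ?num_real// lerDr sqr_ge0.
Qed.

Lemma normc_ReIm z : normc z <= `|complex.Re z| + `|complex.Im z|.
Proof.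
rewrite -ler_sqr ?nnegrE ?normc_ge0 ?addr_ge0// normc_sq sqrrD.
by rewrite !real_normK ?num_real// -addrA lerD2l lerDr mulrn_wge0// mulr_ge0.
Qed.

Lemma normc_real x : normc x%:C = `|x|.
Proof. by rewrite /= expr0n addr0 sqrtr_sqr. Qed.

Lemma normcC z : normc (conjc z) = normc z.
Proof. by case: z => a b /=; rewrite sqrrN. Qed.

Lemma normcX z n : normc (z ^+ n) = normc z ^+ n.
Proof.
elim: n => [|n IH]; first by rewrite !expr0 normc_real normr1.
by rewrite !exprS ComplexField.Normc.normcM IH.
Qed.

Lemma conjcM_normc z : conjc z * z = (normc z ^+ 2)%:C.
Proof.
rewrite normc_sq; case: z => a b; apply/eqP.
rewrite eq_complex /=; apply/andP; split; apply/eqP; ring.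
Qed.

(** The balls of [R[i]] have radii in [R[i]]; a positive radius is real, so real radii suffice. *)
Lemma nbhs_complexP z (A : set R[i]) : nbhs z A <->
  exists2 e, 0 < e & forall w, normc (z - w) < e -> A w.
Proof.
split=> [/nbhs_ballP[e /= e0 H]|[e e0 H]].
  exists (complex.Re e) => [|w hw]; first by move: e0; rewrite ltcE => /andP[].
  apply: H; rewrite /ball /= normcE; move: e0; rewrite !ltcE /= => /andP[/eqP -> _].
  by rewrite eqxx.
apply/nbhs_ballP; exists e%:C; first by rewrite /= ltcR.
by move=> w; rewrite /ball /= normcE ltcR; exact: H.
Qed.

Lemma continuous_Re : continuous (@complex.Re R : R[i] -> R).
Proof.
move=> z A /nbhs_ballP[e /= e0 eA]; apply/nbhs_complexP; exists e => // w we.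
apply: eA; move: we; rewrite /ball /=.
by apply: le_lt_trans; rewrite -raddfB Re_normc.
Qed.

Lemma continuous_Im : continuous (@complex.Im R : R[i] -> R).
Proof.
move=> z A /nbhs_ballP[e /= e0 eA]; apply/nbhs_complexP; exists e => // w we.
apply: eA; move: we; rewrite /ball /=.
by apply: le_lt_trans; rewrite -raddfB Im_normc.
Qed.

Lemma cvg_complexP (T : Type) (F : set_system T) (FF : Filter F) (f : T -> R[i]) z :
  f @ F --> z <-> forall e, 0 < e -> \forall t \near F, normc (z - f t) < e.
Proof.
split=> [fz e e0|H A /nbhs_complexP[e e0 eA]].
  by apply: (fz [set w | normc (z - w) < e]); apply/nbhs_complexP; exists e.
by apply: filterS (H e e0) => t; apply: eA.
Qed.

Lemma continuous_complexP (T : topologicalType) (f : T -> R[i]) t :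
  {for t, continuous f} <-> {for t, continuous (fun s => complex.Re (f s))} /\
                            {for t, continuous (fun s => complex.Im (f s))}.
Proof.
split=> [ft|[fR fI]].
  by split; apply: continuous_comp => //; [exact: continuous_Re|exact: continuous_Im].
apply: (@cvg_complexP T (nbhs t) _ f (f t)).2 => e e0.
move/cvgrPdist_lt : fR => /(_ (e / 2)) fR; move/cvgrPdist_lt : fI => /(_ (e / 2)) fI.
have e20 : 0 < e / 2 by lra.
near=> s; apply: le_lt_trans (normc_ReIm _) _.
rewrite (splitr e) !raddfB; apply: ltrD; near: s; [exact: fR|exact: fI].
Unshelve. all: by end_near. Qed.

Lemma continuous_normc : continuous (@normc R : R[i] -> R).
Proof.
move=> z A /nbhs_ballP[e /= e0 eA]; apply/nbhs_complexP; exists e => // w we.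
apply: eA; move: we; rewrite /ball /=.
apply: le_lt_trans; rewrite ler_norml.
have h1 : normc z <= normc (z - w) + normc w by rewrite -{1}(subrK w z) normcD.
have h2 : normc w <= normc (z - w) + normc z.
  by rewrite -{1}(subrK z w) -(normcN (z - w)) opprB normcD.
lra.
Qed.

Lemma continuous_real_complex : continuous (fun x => x%:C : R[i]).
Proof.
by move=> x; apply/continuous_complexP; split; [exact: cvg_id|exact: cvg_cst].
Qed.

Lemma derivable_complexP (f : R[i] -> R[i]) z : derivable f z 1 ->
  exists L, forall e, 0 < e -> exists2 d, 0 < d & forall w, normc w < d ->
    normc (f (z + w) - f z - L * w) <= e * normc w.
Proof.
move=> /cvg_ex[L /= /cvg_complexP H]; exists L => e e0.
have /nbhs_complexP[d d0 {}H] := H _ e0.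
exists d => // w wd; have [->|w0] := eqVneq w 0.
  by rewrite addr0 subrr mulr0 subr0 ComplexField.Normc.normc0 mulr0.
have := H w; rewrite sub0r normcN /= => /(_ wd w0); rewrite scaler1 (addrC w).
move=> /ltW/(ler_wpM2r (normc_ge0 w)); rewrite -ComplexField.Normc.normcM.
by rewrite mulrBl /GRing.scale /= mulrAC mulVf// mul1r -normcN opprB.
Qed.

End ComplexTopology.

(** * Mean value inequalities on squares *)

Section Primitive.
Context {R : realType}.
Notation mu := (@lebesgue_measure R).

Lemma continuous_primitive (f : R -> R) (rho s : R) : 0 < s < rho ->
  (forall x : R, `|x| < rho -> {for x, continuous f}) ->
  exists F : R -> R, (forall x : R, `|x| <= s -> is_derive x 1 F (f x)) /\
    (\int[mu]_(t in `[(- s)%R, s]) (f t)%:E = (F s - F (- s))%R%:E)%E.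
Proof.
(* With [r] strictly between [s] and [rho], the endpoints of [[- s, s]] are interior to the interval
   of integration, and the primitive has two-sided derivatives there. *)
move=> /andP[s0 sr] fc; pose r := (s + rho) / 2.
have fw (a b : R) : - rho < a -> b < rho -> {within `[a, b], continuous f}.
  move=> ha hb; apply: continuous_in_subspaceT => x; rewrite inE /= in_itv /= => /andP[h1 h2].
  by apply: fc; rewrite ltr_norml; lra.
have intf : mu.-integrable `[- r, r] (EFin \o f).
  apply: continuous_compact_integrable; first exact: segment_compact.
  by apply: fw; rewrite /r; lra.
pose F y := (\int[mu]_(t in `[- r, y]) f t)%R.
have dF (x : R) : `|x| <= s -> is_derive x 1 F (f x).
  move=> xs; have xr : x < r by move: xs; rewrite ler_norml /r; lra.
  have rx : - r < x by move: xs; rewrite ler_norml /r; lra.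
  have [|dF F'] := continuous_FTC1_closed xr intf rx.
    by apply: fc; move: xs; rewrite ler_norml ltr_norml /r; lra.
  by apply: (DeriveDef dF); rewrite -derive1E.
exists F; split=> //.
have ss : - s < s by lra.
rewrite EFinB; apply: continuous_FTC2 => //.
- by apply: fw; lra.
- split.
  + move=> x; rewrite in_itv /= => xs; apply: (@ex_derive _ _ _ _ _ _ _ (dF x _)).
    by rewrite ler_norml; lra.
  + apply: cvg_at_right_filter; apply: differentiable_continuous.
    by apply/derivable1_diffP; apply: (@ex_derive _ _ _ _ _ _ _ (dF _ _)); rewrite ler_norml; lra.
  + apply: cvg_at_left_filter; apply: differentiable_continuous.
    by apply/derivable1_diffP; apply: (@ex_derive _ _ _ _ _ _ _ (dF _ _)); rewrite ler_norml; lra.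
- move=> x; rewrite in_itv /= => xs; rewrite derive1E.
  by apply: (@derive_val _ _ _ _ _ _ _ (dF x _)); rewrite ler_norml; lra.
Qed.

End Primitive.

Section SquareMean.
Context {R : realType}.
Implicit Types (H P : R[i] -> R[i]) (x y s t : R) (z w : R[i]).
Notation mu := (@lebesgue_measure R).

(** Cauchy-Riemann: if the derivative is [a +i* b], the imaginary part has gradient [(b, a)] and the
    real part has gradient [(a, - b)], so [a] is the common mixed coefficient. *)
Lemma closed_at_derivable P x y : derivable P (x +i* y) 1 ->
  closed_at (fun x y => complex.Im (P (x +i* y))) (fun x y => complex.Re (P (x +i* y))) x y.
Proof.
move=> /derivable_complexP[[a b] HL]; exists b, a, (- b) => e e0.
have [d d0 {}HL] := HL e e0; exists (d / 3) => [|h k hd kd]; first by lra.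
have hk : normc (h +i* k) <= `|h| + `|k| by exact: (normc_ReIm (h +i* k)).
have /HL : normc (h +i* k) < d by lra.
move=> /le_trans/(_ (ler_wpM2l (ltW e0) hk)) L.
have E : (x +i* y) + (h +i* k) = (x + h) +i* (y + k) by [].
split; apply: le_trans L; rewrite -E.
  apply: le_trans (Im_normc _); rewrite le_eqVlt; apply/orP; left; apply/eqP; congr `| _ |.
  by case: (P _) => p q; case: (P _) => p' q' /=; ring.
apply: le_trans (Re_normc _); rewrite le_eqVlt; apply/orP; left; apply/eqP; congr `| _ |.
by case: (P _) => p q; case: (P _) => p' q' /=; ring.
Qed.

Lemma eq_increment (f g df : R -> R) (a b : R) : a <= b ->
  (forall x : R, a <= x <= b -> is_derive x 1 f (df x)) ->
  (forall x : R, a <= x <= b -> is_derive x 1 g (df x)) -> f b - f a = g b - g a.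
Proof.
move=> ab fd gd; have := @mvt_bound R (f - g) (fun x => df x - df x) a b 0 0 ab.
rewrite mul0r subr0 normr_le0 => H; apply/eqP; rewrite -subr_eq0.
have -> : f b - f a - (g b - g a) = (f - g) b - (f - g) a.
  by rewrite /GRing.sub_fun /= !fctE; ring.
apply: H => x xab; last by rewrite subrr subr0 normr0.
by apply: is_deriveB; [exact: fd|exact: gd].
Qed.

End SquareMean.

Section SquareMean.
Context {R : realType}.
Implicit Types (H P : R[i] -> R[i]) (x y s t : R) (z w : R[i]).
Notation mu := (@lebesgue_measure R).

Lemma continuous_conjc : continuous (@conjc R).
Proof.
move=> z; apply: (@continuous_complexP R R[i] _ z).2; split.
  rewrite (_ : (fun _ => _) = @complex.Re R); first exact: continuous_Re.
  by apply/funext => -[].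
rewrite (_ : (fun _ => _) = fun w => - complex.Im w); last by apply/funext => -[].
by apply: (@continuousN R); exact: continuous_Im.
Qed.

Lemma continuous_subc (T : topologicalType) (f g : T -> R[i]) (p : T) :
  {for p, continuous f} -> {for p, continuous g} ->
  {for p, continuous (fun x : T => f x - g x)}.
Proof. by move=> cf cg; have := continuousB cf cg. Qed.

Lemma continuous_mulc (T : topologicalType) (f g : T -> R[i]) (p : T) :
  {for p, continuous f} -> {for p, continuous g} ->
  {for p, continuous (fun x : T => f x * g x)}.
Proof. by move=> cf cg; have := continuousM cf cg. Qed.

Lemma mvt_ge (f df : R -> R) (a b c : R) : a <= b ->
  (forall x : R, a <= x <= b -> is_derive x 1 f (df x)) ->
  (forall x : R, a <= x <= b -> c <= df x) -> c * (b - a) <= f b - f a.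
Proof.
move=> ab fd dfc.
have [x xab ->] : exists2 x, x \in `[a, b] & f b - f a = df x * (b - a).
  apply: MVT_segment => //.
    by move=> x; rewrite in_itv /= => /andP[? ?]; apply: fd; rewrite !ltW.
  apply: derivable_within_continuous => x; rewrite in_itv /= => xab.
  exact: (@ex_derive _ _ _ _ _ _ _ (fd x xab)).
by apply: ler_wpM2r; rewrite ?subr_ge0//; apply: dfc; move: xab; rewrite in_itv.
Qed.

(* conj (H 0) (H z - H 0) / z, truncated near 0 so that it stays continuous. *)
Let trunc_pole H eps z :=
  conjc (H 0) * (H z - H 0) * (conjc z * ((Num.max (normc z ^+ 2) (eps ^+ 2))^-1)%:C).

Let trunc_poleE H (eps : R) z : 0 < eps -> eps <= normc z ->
  trunc_pole H eps z = conjc (H 0) * (H z - H 0) * z^-1.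
Proof.
move=> e0 ez; congr (_ * _).
have n0 : 0 < normc z ^+ 2 by rewrite exprn_gt0// (lt_le_trans e0).
have z0 : z != 0 by rewrite -normc_gt0 (lt_le_trans e0).
rewrite max_l; last by rewrite ler_sqr ?nnegrE ?normc_ge0// ltW.
apply: (mulfI z0); rewrite mulfV// mulrA mulrC (mulrC z) conjcM_normc -rmorphM /=.
by rewrite mulVf// gt_eqF.
Qed.

Let trunc_pole_continuous H (eps : R) z : 0 < eps -> {for z, continuous H} ->
  {for z, continuous (trunc_pole H eps)}.
Proof.
move=> e0 Hz; apply: continuous_mulc.
  apply: continuous_mulc; first exact: cst_continuous.
  by apply: continuous_subc Hz _; exact: cst_continuous.
apply: continuous_mulc; first exact: continuous_conjc.
apply: (@continuous_comp _ _ _ (fun w => (Num.max (normc w ^+ 2) (eps ^+ 2))^-1)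
  (fun x => x%:C)); last exact: continuous_real_complex.
have cN : {for z, continuous (fun w => normc w ^+ 2)}.
  apply: (@continuous_comp _ _ _ (@normc R) (fun x : R => x ^+ 2)).
    exact: continuous_normc.
  exact: exprn_continuous.
have cM := continuous_max cN (@cst_continuous _ _ (eps ^+ 2) z).
have := @continuousV R _ _ _ _ cM; apply.
by rewrite gt_eqF// lt_max [X in _ || X]exprn_gt0// orbT.
Qed.

Let trunc_pole_derivable H (eps : R) z : 0 < eps -> eps < normc z ->
  derivable H z 1 -> derivable (trunc_pole H eps) z 1.
Proof.
move=> e0 ez dH.
have z0 : z != 0 by rewrite -normc_gt0 (lt_trans e0).
apply: (@near_eq_derivable _ _ _ (fun w => (conjc (H 0) * (H w - H 0)) * w^-1)).
  apply/nbhs_complexP; exists (normc z - eps) => [|w hw]; first by rewrite subr_gt0.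
  rewrite /= trunc_poleE//.
  have : normc z <= normc (z - w) + normc w by rewrite -{1}(subrK w z) normcD.
  by move: hw; rewrite ltrBrDr; lra.
have dV : derivable (fun w => w^-1) z 1 := derivableV z0 (@derivable_id _ _ z 1).
have dc (c : R[i]) : derivable (fun=> c) z 1 := @derivable_cst _ _ _ c z 1.
have d1 := derivableB dH (dc (H 0)).
have d2 := derivableM (dc (conjc (H 0))) d1.
have d3 := derivableM d2 dV.
exact: d3.
Qed.

(** The truncated factor transforms like [1 / z], with the factor [- i] under the quarter turn, so
    the form [trunc_pole H eps z dz] is invariant. *)
Let trunc_pole_sym H eps z : H ('i%C * z) = H z ->
  trunc_pole H eps ('i%C * z) = - 'i%C * trunc_pole H eps z.
Proof.
move=> Hz; rewrite /trunc_pole Hz ComplexField.Normc.normcM.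
have -> : normc ('i%C : R[i]) = 1 by rewrite /= expr0n expr1n add0r sqrtr1.
rewrite mul1r; set A := conjc (H 0) * _; set B := (_%:C).
have -> : conjc ('i%C * z) = - 'i%C * conjc z.
  by case: z {Hz A B} => a b; apply/eqP; rewrite eq_complex /=; apply/andP; split; apply/eqP; ring.
ring.
Qed.

(* The 1-form Im (conj (H 0) (H z - H 0) dz / z) has the same integral on the boundary
   of the square as on that of a small square around 0, where it is small because H is
   continuous at 0.  By the quarter-turn symmetry the four sides contribute equally, so
   its integral along the right side vanishes; there Re (1 / z) >= 1 / (2 s). *)
Lemma square_mean H (rho s : R) : 0 < s < rho ->
  (forall z, `|complex.Re z| < rho -> `|complex.Im z| < rho -> z != 0 ->
    derivable H z 1) ->
  {for 0, continuous H} ->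
  (forall z, `|complex.Re z| < rho -> `|complex.Im z| < rho -> H ('i%C * z) = H z) ->
  ((normc (H 0) * s)%:E <=
    \int[mu]_(t in `[(- s)%R, s]) (normc (H (s +i* t)))%:E)%E.
Proof.
move=> /andP[s0 sr] dH cH0 symH.
have cH z : `|complex.Re z| < rho -> `|complex.Im z| < rho -> {for z, continuous H}.
  move=> h1 h2; have [->//|z0] := eqVneq z 0.
  by apply: differentiable_continuous; apply/derivable1_diffP; exact: dH.
have cline (y : R) : continuous (fun x : R => x +i* y).
  by move=> x; apply/continuous_complexP; split; [exact: cvg_id|exact: cvg_cst].
have cline' (x : R) : continuous (fun y : R => x +i* y).
  by move=> y; apply/continuous_complexP; split; [exact: cvg_cst|exact: cvg_id].
have s'r : `|s| < rho by rewrite gtr0_norm.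
have [H00|H00] := eqVneq (H 0) 0.
  rewrite H00 ComplexField.Normc.normc0 mul0r.
  by apply: integral_ge0 => t _; rewrite lee_fin normc_ge0.
have [W [dW ->]] : exists W : R -> R,
    (forall t : R, `|t| <= s -> is_derive t 1 W (normc (H (s +i* t)))) /\
    (\int[mu]_(t in `[(- s)%R, s]) (normc (H (s +i* t)))%:E = (W s - W (- s))%R%:E)%E.
  apply: (@continuous_primitive R _ rho); first by rewrite s0.
  move=> t tr; apply: (@continuous_comp _ _ _ (fun y => H (s +i* y)) (@normc R)).
    by apply: (@continuous_comp _ _ _ (fun y : R => s +i* y) H); [exact: cline'|exact: cH].
  exact: continuous_normc.
rewrite lee_fin; set h := normc (H 0).
have h0 : 0 < h by rewrite normc_gt0.
(* [e] bounds the oscillation of [H] on the small square; the claim is the limit of this inequality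
   as [e] tends to 0, after multiplication by [s / h]. *)
suff key e : 0 < e -> h ^+ 2 - 2 * h * e <= h / s * (W s - W (- s)).
  apply/ler_addgt0Pr => e e0.
  have e0' : 0 < e / (2 * s) by rewrite divr_gt0// mulr_gt0.
  have := key _ e0'; rewrite -(ler_pM2l (divr_gt0 s0 h0)).
  have -> : s / h * (h ^+ 2 - 2 * h * (e / (2 * s))) = h * s - e.
    by field; rewrite !gt_eqF.
  have -> : s / h * (h / s * (W s - W (- s))) = W s - W (- s) by field; rewrite !gt_eqF.
  by rewrite lerBlDr.
move=> e0.
have [d d0 Hd] : exists2 d, 0 < d & forall w, normc w < d -> normc (H w - H 0) < e.
  have /cvg_complexP/(_ e e0)/nbhs_complexP[d d0 Hd] := cH0.
  exists d => // w wd; rewrite -normcN opprB; apply: Hd.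
  by rewrite sub0r normcN.
(* The square of half side [eta] lies strictly inside the large one, and its points have modulus at
   most [2 * eta < d]. *)
pose eta := Num.min (d / 3) (s / 2).
have eta0 : 0 < eta by rewrite lt_min; apply/andP; split; lra.
have etad : 3 * eta <= d by have : eta <= d / 3 by [rewrite ge_min lexx]; lra.
have etas : eta < s by have : eta <= s / 2 by [rewrite ge_min lexx orbT]; lra.
(* Truncation at [eta / 2] keeps the true quotient in a neighbourhood of every point outside the
   open square of half side [eta]; inside, continuity still provides primitives. *)
pose P := trunc_pole H (eta / 2).
have eta20 : 0 < eta / 2 by lra.
have PE z : eta <= normc z -> P z = conjc (H 0) * (H z - H 0) * z^-1.
  by move=> hz; apply: trunc_poleE => //; lra.
pose u x y := complex.Im (P (x +i* y)); pose v x y := complex.Re (P (x +i* y)).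
have lts (x : R) : `|x| <= s -> `|x| < rho by move=> /le_lt_trans; exact.
have cP (x y : R) : `|x| < rho -> `|y| < rho -> {for (x +i* y), continuous P}.
  by move=> hx hy; exact: (trunc_pole_continuous eta20 (cH (x +i* y) hx hy)).
have [U dU] : exists U : R -> R -> R, forall x y : R, `|x| <= s -> `|y| <= s ->
    is_derive x 1 (U^~ y) (u x y).
  have /choice[F HF] : forall y : R, exists F : R -> R, `|y| <= s ->
      forall x : R, `|x| <= s -> is_derive x 1 F (u x y).
    move=> y; have [ys|] := boolP (`|y| <= s); last by exists (fun=> 0).
    have [|x xr|F [dF _]] := @continuous_primitive R (u^~ y) rho s; first by rewrite s0.
      apply: (@continuous_comp _ _ _ (fun x => P (x +i* y)) (@complex.Im R)).
        apply: (@continuous_comp _ _ _ (fun x : R => x +i* y) P); first exact: cline.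
        exact: cP xr (lts _ ys).
      exact: continuous_Im.
    by exists F.
  by exists (fun x y => F y x) => x y xs ys; exact: HF.
have [V dV] : exists V : R -> R -> R, forall x y : R, `|x| <= s -> `|y| <= s ->
    is_derive y 1 (V x) (v x y).
  have /choice[F HF] : forall x : R, exists F : R -> R, `|x| <= s ->
      forall y : R, `|y| <= s -> is_derive y 1 F (v x y).
    move=> x; have [xs|] := boolP (`|x| <= s); last by exists (fun=> 0).
    have [|y yr|F [dF _]] := @continuous_primitive R (v x) rho s; first by rewrite s0.
      apply: (@continuous_comp _ _ _ (fun y => P (x +i* y)) (@complex.Re R)).
        apply: (@continuous_comp _ _ _ (fun y : R => x +i* y) P); first exact: cline'.
        exact: cP (lts _ xs) yr.
      exact: continuous_Re.
    by exists F.
  by exists F => x y xs ys; exact: HF.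
have uv x y : `|x| <= s -> `|y| <= s -> eta <= `|x| \/ eta <= `|y| -> closed_at u v x y.
  move=> xs ys xy; apply: closed_at_derivable.
  have nz : eta <= normc (x +i* y).
    by case: xy => /le_trans; apply; [exact: (Re_normc (x +i* y))|exact: (Im_normc (x +i* y))].
  apply: (trunc_pole_derivable eta20); first by lra.
  by apply: dH; [exact: lts|exact: lts|rewrite -normc_gt0; lra].
have G x1 x2 y1 y2 : x1 <= x2 -> y1 <= y2 -> - s <= x1 -> x2 <= s -> - s <= y1 -> y2 <= s ->
    [\/ eta <= x1, x2 <= - eta, eta <= y1 | y2 <= - eta] -> rect_int U V x1 x2 y1 y2 = 0.
  move=> x12 y12 hx1 hx2 hy1 hy2 far.
  have xs (x : R) : x1 <= x <= x2 -> `|x| <= s.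
    by move=> /andP[h1 h2]; rewrite ler_norml (le_trans hx1)// (le_trans h2).
  have ys (y : R) : y1 <= y <= y2 -> `|y| <= s.
    by move=> /andP[h1 h2]; rewrite ler_norml (le_trans hy1)// (le_trans h2).
  apply: (goursat (u := u) (v := v)) => // x y hx hy; last 2 first.
  - by apply: dU; [exact: xs|exact: ys].
  - by apply: dV; [exact: xs|exact: ys].
  apply: uv; [exact: xs|exact: ys|rewrite !ler_normr].
  have [/andP[xl xr] /andP[yl yr]] := (hx, hy).
  case: far => far; [left|left|right|right]; apply/orP; [left|right|left|right].
  - exact: le_trans far xl.
  - by rewrite lerNr (le_trans xr).
  - exact: le_trans far yl.
  - by rewrite lerNr (le_trans yr).
pose E := V s s - V s (- s).
have ss : - s <= s by lra.
have itvs (t : R) : - s <= t <= s -> `|t| <= s by rewrite ler_norml.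
have nss : `|s| <= s by rewrite gtr0_norm.
have nNss : `|- s| <= s by rewrite normrN gtr0_norm.
(* Successive quarter turns carry the right side to the top, the left and the bottom side. *)
have P1 (t : R) : `|t| <= s -> P (- t +i* s) = - 'i%C * P (s +i* t).
  move=> ts; rewrite /P -trunc_pole_sym; last by apply: symH; [exact: lts|exact: lts].
  by congr trunc_pole; apply/eqP; rewrite eq_complex /=; apply/andP; split; apply/eqP; ring.
have P2 (t : R) : `|t| <= s -> P (- s +i* - t) = - P (s +i* t).
  move=> ts; rewrite (_ : - s +i* - t = 'i%C * (- t +i* s)); last first.
    by apply/eqP; rewrite eq_complex /=; apply/andP; split; apply/eqP; ring.
  rewrite /P trunc_pole_sym; last by apply: symH; rewrite /= ?normrN; exact: lts.
  rewrite -/P P1// mulrA mulrNN -expr2 sqr_i mulN1r//.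
have P3 (t : R) : `|t| <= s -> P (t +i* - s) = 'i%C * P (s +i* t).
  move=> ts; rewrite (_ : t +i* - s = 'i%C * (- s +i* - t)); last first.
    by apply/eqP; rewrite eq_complex /=; apply/andP; split; apply/eqP; ring.
  rewrite /P trunc_pole_sym; last by apply: symH; rewrite /= ?normrN; exact: lts.
  by rewrite -/P P2// mulrNN.
have bottom : U s (- s) - U (- s) (- s) = E.
  apply: (@eq_increment R (U^~ (- s)) (V s) (v s)) => // t /itvs ts.
    rewrite (_ : v s t = u t (- s)); first exact: dU.
    by rewrite /u P3// /v; case: (P _) => a b /=; ring.
  exact: dV.
have dVN (t : R) : - s <= t <= s -> is_derive t 1 (fun t => V s (- t)) (- v s (- t)).
  move=> /itvs ts; have := dV s (- t); rewrite normrN => /(_ nss ts) dVt.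
  have := is_derive1_comp dVt (is_deriveN (is_derive_id t 1)).
  by rewrite /GRing.scale /= mulrN1.
have EN : V s (- s) - V s (- - s) = - E by rewrite opprK /E opprB.
have top : U s s - U (- s) s = - E.
  rewrite -EN; apply: (@eq_increment R (U^~ s) (fun t => V s (- t)) (fun t => - v s (- t))) => //.
  move=> t /itvs ts; rewrite (_ : - v s (- t) = u t s); first exact: dU.
  rewrite /u -[X in X +i* s]opprK P1 ?normrN// /v.
  by case: (P _) => a b /=; ring.
have left : V (- s) s - V (- s) (- s) = - E.
  rewrite -EN; apply: (@eq_increment R (V (- s)) (fun t => V s (- t)) (fun t => - v s (- t))) => //.
  move=> t /itvs ts; rewrite (_ : - v s (- t) = v (- s) t); first exact: dV.
  by rewrite /v -[X in - s +i* X]opprK P2 ?normrN// raddfN.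
have Eeta : `|4 * E| <= 8 * h * e.
  have -> : 4 * E = rect_int U V (- eta) eta (- eta) eta.
    (* The frame between the two squares is cut into four rectangles that avoid the pole: two strips
       of full height and the pieces above and below the small square. *)
    have -> : rect_int U V (- eta) eta (- eta) eta =
        rect_int U V (- s) s (- s) s - rect_int U V (- s) (- eta) (- s) s
        - rect_int U V eta s (- s) s - rect_int U V (- eta) eta eta s
        - rect_int U V (- eta) eta (- s) (- eta) by rewrite /rect_int; ring.
    have Nse : - s <= - eta by rewrite lerN2 ltW.
    have es := ltW etas.
    have ee : - eta <= eta by rewrite ge0_cp// ltW.
    have Nses := le_trans Nse ee; have Ness := le_trans ee es.
    rewrite (G _ _ _ _ Nse ss (lexx _) Ness (lexx _) (lexx _) (Or42 _ _ _ (lexx _))).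
    rewrite (G _ _ _ _ es ss Nses (lexx _) (lexx _) (lexx _) (Or41 _ _ _ (lexx _))).
    rewrite (G _ _ _ _ ee es Nse es Nses (lexx _) (Or43 _ _ _ (lexx _))).
    rewrite (G _ _ _ _ ee Nse Nse es (lexx _) Ness (Or44 _ _ _ (lexx _))).
    by rewrite /rect_int top bottom left -/E; ring.
  have Pb x y : `|x| <= eta -> `|y| <= eta -> eta <= `|x| \/ eta <= `|y| ->
      normc (P (x +i* y)) <= h * e / eta.
    move=> hx hy xy.
    have nz : eta <= normc (x +i* y).
      by case: xy => /le_trans; apply; [exact: (Re_normc (x +i* y))|exact: (Im_normc (x +i* y))].
    rewrite PE// !ComplexField.Normc.normcM normcC ComplexField.Normc.normcV.
    apply: ler_pM; rewrite ?mulr_ge0 ?invr_ge0 ?normc_ge0//.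
      rewrite ler_wpM2l ?normc_ge0// ltW//; apply: Hd.
      by apply: le_lt_trans (normc_ReIm _) _ => /=; lra.
    by rewrite lef_pV2 ?posrE//; lra.
  have ee : - eta <= eta by lra.
  have nee : `|eta| <= eta by rewrite gtr0_norm.
  have nNee : `|- eta| <= eta by rewrite normrN gtr0_norm.
  have B (f df : R -> R) : (forall x : R, - eta <= x <= eta -> is_derive x 1 f (df x)) ->
      (forall x : R, - eta <= x <= eta -> `|df x| <= h * e / eta) ->
      `|f eta - f (- eta)| <= 2 * h * e.
    move=> dF bF; have := @mvt_bound R f df (- eta) eta 0 (h * e / eta) ee dF.
    rewrite mul0r subr0 => H1.
    apply: le_trans (H1 _) _; first by move=> x xe; rewrite subr0; exact: bF.
    rewrite opprK (_ : h * e / eta * (eta + eta) = 2 * h * e)//.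
    by field; rewrite gt_eqF.
  have ite (t : R) : - eta <= t <= eta -> `|t| <= eta by rewrite ler_norml.
  have its (t : R) : `|t| <= eta -> `|t| <= s by move=> /le_trans; apply; exact: ltW.
  have big : eta <= `|eta| by rewrite gtr0_norm.
  have bigN : eta <= `|- eta| by rewrite normrN gtr0_norm.
  have B1 : `|U eta (- eta) - U (- eta) (- eta)| <= 2 * h * e.
    apply: (B (U^~ (- eta)) (u^~ (- eta))) => t /ite te; first by apply: dU; exact: its.
    by apply: le_trans (Im_normc _) _; apply: Pb => //; right.
  have B2 : `|U eta eta - U (- eta) eta| <= 2 * h * e.
    apply: (B (U^~ eta) (u^~ eta)) => t /ite te; first by apply: dU; exact: its.
    by apply: le_trans (Im_normc _) _; apply: Pb => //; right.
  have B3 : `|V eta eta - V eta (- eta)| <= 2 * h * e.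
    apply: (B (V eta) (v eta)) => t /ite te; first by apply: dV; exact: its.
    by apply: le_trans (Re_normc _) _; apply: Pb => //; left.
  have B4 : `|V (- eta) eta - V (- eta) (- eta)| <= 2 * h * e.
    apply: (B (V (- eta)) (v (- eta))) => t /ite te; first by apply: dV; exact: its.
    by apply: le_trans (Re_normc _) _; apply: Pb => //; left.
  by move: B1 B2 B3 B4; rewrite /rect_int !ler_norml; lra.
have lower : h ^+ 2 / (2 * s) * (s - - s) <=
    (h / s * W s - V s s) - (h / s * W (- s) - V s (- s)).
  apply: (@mvt_ge (fun t => h / s * W t - V s t)
    (fun t => h / s * normc (H (s +i* t)) - v s t) (- s) s _ ss) => t /itvs ts.
    by apply: is_deriveB; [exact: (is_deriveZ (h / s) (dW t ts))|exact: dV].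
  have sz : s <= normc (s +i* t) by apply: le_trans (Re_normc (s +i* t)); rewrite gtr0_norm.
  have -> : v s t = complex.Re (conjc (H 0) * H (s +i* t) * (s +i* t)^-1) -
     complex.Re ((h ^+ 2)%:C * (s +i* t)^-1).
    rewrite /v PE; last by lra.
    by rewrite -raddfB -conjcM_normc /=; congr complex.Re; ring.
  have R1 : complex.Re (conjc (H 0) * H (s +i* t) * (s +i* t)^-1) <= h / s * normc (H (s +i* t)).
    apply: le_trans (ler_norm _) _; apply: le_trans (Re_normc _) _.
    rewrite !ComplexField.Normc.normcM normcC ComplexField.Normc.normcV -/h mulrAC.
    apply: ler_wpM2r; rewrite ?normc_ge0//; apply: ler_wpM2l; first exact: ltW.
    by rewrite lef_pV2 ?posrE//; exact: lt_le_trans sz.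
  have R2 : h ^+ 2 / (2 * s) <= complex.Re ((h ^+ 2)%:C * (s +i* t)^-1).
    rewrite /= mul0r subr0; apply: ler_wpM2l; first by rewrite sqr_ge0.
    have st0 : 0 < s ^+ 2 + t ^+ 2 by rewrite ltr_pwDl// ?exprn_gt0// sqr_ge0.
    rewrite ler_pdivlMr// mulrC ler_pdivrMr ?mulr_gt0//.
    have : t ^+ 2 <= s ^+ 2 by rewrite -(real_normK (num_real t)) ler_sqr ?nnegrE// ltW.
    by rewrite expr2; nra.
  by move: R1 R2; lra.
have -> : h / s * (W s - W (- s)) = (h / s * W s - V s s) - (h / s * W (- s) - V s (- s)) + E.
  by rewrite /E; ring.
have : h ^+ 2 / (2 * s) * (s - - s) = h ^+ 2 by field; rewrite gt_eqF.
by move: Eeta lower; rewrite ler_norml; lra.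
Qed.

End SquareMean.

(** * Area integrals over squares *)

Section Affine.
Context {R : realType}.
Notation mu := (@lebesgue_measure R).
Notation T := (measurableTypeR R).

Let pre_measurable (f : T -> T) (mf : measurable_fun [set: T] f) : {measure set T -> \bar R} :=
  measure_function_pushforward__canonical__measure_function_Measure mu mf.

(** A measure that gives half-open intervals their length is Lebesgue measure. The image of [mu]
    under [h] is one, so the integral of [f \o h] is the integral of [f] against the image
    measure. *)
Let ge0_integral_invariant (h : T -> T) (f : T -> \bar R) : measurable_fun [set: T] h ->
  (forall a b : R, a <= b -> mu (h @^-1` `]a, b]) = (b - a)%:E) ->
  measurable_fun [set: T] f -> (forall x, 0 <= f x)%E ->
  (\int[mu]_x f (h x) = \int[mu]_x f x)%E.
Proof.
move=> mh hE mf f0.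
have := ge0_integral_pushforward mh mu measurableT mf (fun y _ => f0 y).
rewrite preimage_setT => <-; apply: eq_measure_integral => A mA _.
have := @lebesgue_measure_unique R (pre_measurable mh); rewrite /= => <- //.
move=> X [[a b] _ <-] /=; rewrite /pushforward.
have [ab|ba] := leP a b.
  by rewrite hE// lebesgue_measure_itv /= lte_fin; case: ltP => // ba; rewrite (_ : b = a) ?subrr//; apply/eqP; rewrite eq_le ba ab.
by rewrite set_itv_ge -?leNgt ?bnd_simp ?ltW// preimage_set0 !measure0.
Qed.

Lemma ge0_integral_shift (f : T -> \bar R) (a : R) :
  measurable_fun [set: T] f -> (forall x, 0 <= f x)%E ->
  (\int[mu]_x f (a + x)%R = \int[mu]_x f x)%E.
Proof.
apply: ge0_integral_invariant; first exact: measurable_funD.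
move=> b c bc; rewrite (_ : _ @^-1` _ = `](b - a), (c - a)]%classic).
  rewrite lebesgue_measure_itv /= lte_fin ltrD2r; case: ltP => cb; last first.
    by rewrite (_ : b = c) ?subrr//; apply/eqP; rewrite eq_le bc.
  by rewrite -EFinB; congr EFin; ring.
by apply/seteqP; split => x /=; rewrite !in_itv /= ltrBlDl lerBrDl.
Qed.

Lemma ge0_integral_opp (f : T -> \bar R) :
  measurable_fun [set: T] f -> (forall x, 0 <= f x)%E ->
  (\int[mu]_x f (- x)%R = \int[mu]_x f x)%E.
Proof.
apply: ge0_integral_invariant; first exact: oppr_measurable.
move=> b c bc; rewrite (_ : _ @^-1` _ = `[(- c), (- b)[%classic).
  rewrite lebesgue_measure_itv /= lte_fin ltrN2; case: ltP => cb; last first.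
    by rewrite (_ : b = c) ?subrr//; apply/eqP; rewrite eq_le bc.
  by rewrite -EFinB; congr EFin; ring.
by apply/seteqP; split => x /=; rewrite !in_itv /= andbC lerNl ltrNr.
Qed.

End Affine.

Section OneVariable.
Context {R : realType}.
Implicit Types (g : R[i] -> R[i]) (x y s t : R) (z w : R[i]).
Notation mu := (@lebesgue_measure R).
Notation T := (measurableTypeR R).

Lemma ge0_integral_shiftN (f : T -> \bar R) (a : R) :
  measurable_fun [set: T] f -> (forall x, 0 <= f x)%E ->
  (\int[mu]_x f (a - x)%R = \int[mu]_x f x)%E.
Proof.
move=> mf f0; rewrite -(ge0_integral_shift a mf)//.
rewrite (ge0_integral_opp (f := fun x => f (a + x)%R))//.
by apply: measurableT_comp mf _; exact: measurable_funD.
Qed.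

Lemma derivable_mull g c z : derivable g (c * z) 1 -> derivable (fun w => g (c * w)) z 1.
Proof.
move=> /derivable1_diffP dg; apply/derivable1_diffP.
have da : differentiable (fun w : R[i] => c * w) z.
  apply/derivable1_diffP.
  exact: (derivableM (@derivable_cst _ _ _ c z 1) (@derivable_id _ _ z 1)).
exact: (differentiable_comp da dg).
Qed.

Lemma derivable_addl g c z : derivable g (c + z) 1 -> derivable (fun w => g (c + w)) z 1.
Proof.
move=> /derivable1_diffP dg; apply/derivable1_diffP.
have da : differentiable (fun w : R[i] => c + w) z.
  apply/derivable1_diffP.
  exact: (derivableD (@derivable_cst _ _ _ c z 1) (@derivable_id _ _ z 1)).
exact: (differentiable_comp da dg).
Qed.

Lemma derivable_continuous g z : derivable g z 1 -> {for z, continuous g}.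
Proof. by move=> /derivable1_diffP /differentiable_continuous. Qed.

Lemma measurable_swap_args (Phi : T * T -> \bar R) (f h : T * T -> T) :
  measurable_fun [set: T * T] Phi ->
  measurable_fun [set: T * T] f -> measurable_fun [set: T * T] h ->
  measurable_fun [set: T * T] (fun p => Phi (f p, h p)).
Proof.
move=> mP mf mh; apply: measurableT_comp mP _.
exact/measurable_fun_pair.
Qed.

Lemma ge0_integralD4 (f1 f2 f3 f4 : T -> \bar R) :
  measurable_fun [set: T] f1 -> measurable_fun [set: T] f2 ->
  measurable_fun [set: T] f3 -> measurable_fun [set: T] f4 ->
  (forall x, 0 <= f1 x)%E -> (forall x, 0 <= f2 x)%E ->
  (forall x, 0 <= f3 x)%E -> (forall x, 0 <= f4 x)%E ->
  (\int[mu]_x (f1 x + f2 x + f3 x + f4 x) =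
   \int[mu]_x f1 x + \int[mu]_x f2 x + \int[mu]_x f3 x + \int[mu]_x f4 x)%E.
Proof.
move=> m1 m2 m3 m4 f10 f20 f30 f40.
have m12 := emeasurable_funD m1 m2; have m123 := emeasurable_funD m12 m3.
have f120 x : (0 <= f1 x + f2 x)%E by rewrite adde_ge0.
have f1230 x : (0 <= f1 x + f2 x + f3 x)%E by rewrite adde_ge0.
by rewrite ge0_integralD// ge0_integralD// ge0_integralD.
Qed.

Lemma mul4e (x : \bar R) : (x + x + x + x = 4%:E * x)%E.
Proof.
case: x => [x| |].
- by rewrite -!EFinD -EFinM; congr EFin; ring.
- by rewrite mulry gtr0_sg ?mul1e.
- by rewrite mulrNy gtr0_sg ?mul1e.
Qed.

(** [square_mean] for the sum of [g] over the quarter turns about [c] bounds [4 s |g c|] by an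
    integral over one side, for each half side [s]; this is at least [2 r |g c|] for [s] in
    [[r / 2, r]], an interval of length [r / 2]. [Phi] has to agree with [|g|] only on the closed
    square, so a function cut off outside it is allowed. *)
Lemma square_submean g c (r rho : R) (Phi : T * T -> \bar R) :
  0 < r < rho ->
  (forall z, `|complex.Re z| < rho -> `|complex.Im z| < rho -> derivable g (c + z) 1) ->
  measurable_fun [set: T * T] Phi -> (forall p, 0 <= Phi p)%E ->
  (forall x y : R, `|x| <= r -> `|y| <= r ->
    Phi (complex.Re c + x, complex.Im c + y) = (normc (g (c + (x +i* y))))%:E) ->
  ((r ^+ 2 * normc (g c))%:E <= 4%:E * \int[mu]_x \int[mu]_y Phi (x, y))%E.
Proof.
move=> /andP[r0 rr] dg mPhi Phi0 PhiE.
set a := complex.Re c; set b := complex.Im c.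
(* The symmetrization of g has the quarter-turn invariance that square_mean needs. *)
pose S z := g (c + z) + g (c + 'i%C * z) + g (c + (- 1) * z) + g (c + (- 'i%C) * z).
have Sd z : `|complex.Re z| < rho -> `|complex.Im z| < rho -> derivable S z 1.
  move=> h1 h2; pose G w := g (c + w).
  have dG w : `|complex.Re w| < rho -> `|complex.Im w| < rho -> derivable G w 1.
    by move=> *; apply: derivable_addl; exact: dg.
  have d1 : derivable (fun w => G ('i%C * w)) z 1.
    apply: derivable_mull; apply: dG; case: z h1 h2 => p q /=.
      by rewrite mul0r mul1r sub0r normrN.
    by rewrite mul0r mul1r add0r.
  have d2 : derivable (fun w => G (- 1 * w)) z 1.
    by apply: derivable_mull; apply: dG; rewrite mulN1r raddfN normrN.
  have d3 : derivable (fun w => G (- 'i%C * w)) z 1.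
    apply: derivable_mull; apply: dG; case: z h1 h2 {d1 d2} => p q /=.
      by rewrite !oppr0 mul0r sub0r mulN1r opprK.
    by rewrite !oppr0 mul0r add0r mulN1r normrN.
  exact: (derivableD (derivableD (derivableD (dG z h1 h2) d1) d2) d3).
have rho0 : 0 < rho by exact: lt_trans rr.
have S0 : S 0 = 4 * g c by rewrite /S !mulr0 addr0; ring.
have Ssym z : S ('i%C * z) = S z.
  have i2 : 'i%C * 'i%C = -1 :> R[i] by rewrite -expr2 sqr_i.
  have j2 : 'i%C * ('i%C * z) = - 1 * z by rewrite mulrA i2.
  have j3 : - 1 * ('i%C * z) = - 'i%C * z by rewrite mulN1r mulNr.
  have j4 : - 'i%C * ('i%C * z) = z by rewrite mulNr mulrA i2 mulN1r opprK.
  by rewrite /S j2 j3 j4; ring.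
(* The values of [Phi] at [c] plus the four quarter turns of [p]. Translations, reflections and
   Tonelli's theorem show that each term has the integral of [Phi]. *)
pose Psi (p : T * T) := (Phi (a + p.1, b + p.2)%R + Phi (a - p.2, b + p.1)%R +
  Phi (a - p.1, b - p.2)%R + Phi (a + p.2, b - p.1)%R)%E.
have mD (e : R) (f : T * T -> T) : measurable_fun [set: T * T] f ->
    measurable_fun [set: T * T] (fun p => e + f p).
  by move=> mf; exact: measurable_funD.
have mB (e : R) (f : T * T -> T) : measurable_fun [set: T * T] f ->
    measurable_fun [set: T * T] (fun p => e - f p).
  by move=> mf; exact: measurable_funB.
have mf1 : measurable_fun [set: T * T] (fun p => p.1) by exact: measurable_fst.
have mf2 : measurable_fun [set: T * T] (fun p => p.2) by exact: measurable_snd.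
have m1 : measurable_fun [set: T * T] (fun p => Phi (a + p.1, b + p.2)%R).
  exact: (measurable_swap_args mPhi (mD _ _ mf1) (mD _ _ mf2)).
have m2 : measurable_fun [set: T * T] (fun p => Phi (a - p.2, b + p.1)%R).
  exact: (measurable_swap_args mPhi (mB _ _ mf2) (mD _ _ mf1)).
have m3 : measurable_fun [set: T * T] (fun p => Phi (a - p.1, b - p.2)%R).
  exact: (measurable_swap_args mPhi (mB _ _ mf1) (mB _ _ mf2)).
have m4 : measurable_fun [set: T * T] (fun p => Phi (a + p.2, b - p.1)%R).
  exact: (measurable_swap_args mPhi (mD _ _ mf2) (mB _ _ mf1)).
have mPsi : measurable_fun [set: T * T] Psi.
  by do 3!apply: emeasurable_funD => //.
have Psi0 p : (0 <= Psi p)%E by rewrite !adde_ge0.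
have mP1 s : measurable_fun [set: T] (fun t => Psi (s, t)) by exact: measurableT_comp.
have mDT (e : R) : measurable_fun [set: T] (fun t : T => e + t) by exact: measurable_funD.
have mBT (e : R) : measurable_fun [set: T] (fun t : T => e - t) by exact: measurable_funB.
set I := (\int[mu]_x \int[mu]_y Phi (x, y))%E.
have sec1 x : measurable_fun [set: T] (fun y => Phi (x, y)) by exact: measurableT_comp.
have sec2 y : measurable_fun [set: T] (fun x => Phi (x, y)) by exact: measurableT_comp.
have mF : measurable_fun [set: T] (fun x => \int[mu]_y Phi (x, y))%E.
  exact: (measurable_fun_fubini_tonelli_F (m2 := mu) Phi).
have mG : measurable_fun [set: T] (fun y => \int[mu]_x Phi (x, y))%E.
  exact: (measurable_fun_fubini_tonelli_G (m1 := mu) Phi).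
have F0 x : (0 <= \int[mu]_y Phi (x, y))%E by exact: integral_ge0.
have G0 y : (0 <= \int[mu]_x Phi (x, y))%E by exact: integral_ge0.
have IG : (\int[mu]_y \int[mu]_x Phi (x, y) = I)%E by rewrite -fubini_tonelli.
have IPsi : (\int[mu]_s \int[mu]_t Psi (s, t) = 4%:E * I)%E.
  have E s : (\int[mu]_t Psi (s, t) = \int[mu]_y Phi ((a + s)%R, y) +
      \int[mu]_x Phi (x, (b + s)%R) + \int[mu]_y Phi ((a - s)%R, y) + \int[mu]_x Phi (x, (b - s)%R))%E.
    have q1 : measurable_fun [set: T] (fun t => Phi (a + s, b + t)%R) by exact: (measurableT_comp (sec1 (a + s)) (mDT b)).
    have q2 : measurable_fun [set: T] (fun t => Phi (a - t, b + s)%R) by exact: (measurableT_comp (sec2 (b + s)) (mBT a)).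
    have q3 : measurable_fun [set: T] (fun t => Phi (a - s, b - t)%R) by exact: (measurableT_comp (sec1 (a - s)) (mBT b)).
    have q4 : measurable_fun [set: T] (fun t => Phi (a + t, b - s)%R) by exact: (measurableT_comp (sec2 (b - s)) (mDT a)).
    rewrite /Psi /= ge0_integralD4//.
    rewrite (ge0_integral_shift (f := fun y => Phi ((a + s)%R, y)))//.
    rewrite (ge0_integral_shiftN (f := fun y => Phi (y, (b + s)%R)))//.
    rewrite (ge0_integral_shiftN (f := fun y => Phi ((a - s)%R, y)))//.
    by rewrite (ge0_integral_shift (f := fun y => Phi (y, (b - s)%R)))//.
  under eq_integral do rewrite E.
  have n1 : measurable_fun [set: T] (fun s => \int[mu]_y Phi ((a + s)%R, y))%E.
    exact: (measurableT_comp mF (mDT a)).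
  have n2 : measurable_fun [set: T] (fun s => \int[mu]_x Phi (x, (b + s)%R))%E.
    exact: (measurableT_comp mG (mDT b)).
  have n3 : measurable_fun [set: T] (fun s => \int[mu]_y Phi ((a - s)%R, y))%E.
    exact: (measurableT_comp mF (mBT a)).
  have n4 : measurable_fun [set: T] (fun s => \int[mu]_x Phi (x, (b - s)%R))%E.
    exact: (measurableT_comp mG (mBT b)).
  rewrite ge0_integralD4//.
  have e1 : (\int[mu]_s \int[mu]_y Phi ((a + s)%R, y) = I)%E by exact: (ge0_integral_shift a mF F0).
  have e2 : (\int[mu]_s \int[mu]_x Phi (x, (b + s)%R) = I)%E.
    by rewrite -IG; exact: (ge0_integral_shift b mG G0).
  have e3 : (\int[mu]_s \int[mu]_y Phi ((a - s)%R, y) = I)%E by exact: (ge0_integral_shiftN a mF F0).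
  have e4 : (\int[mu]_s \int[mu]_x Phi (x, (b - s)%R) = I)%E.
    by rewrite -IG; exact: (ge0_integral_shiftN b mG G0).
  rewrite e1 e2 e3 e4.
  exact: mul4e.
rewrite -IPsi.
have mJ : measurable_fun [set: T] (fun s => \int[mu]_t Psi (s, t))%E.
  exact: (measurable_fun_fubini_tonelli_F (m2 := mu) Psi).
have r2 : r / 2 <= r by lra.
have key s : r / 2 <= s <= r -> ((2 * r * normc (g c))%:E <= \int[mu]_t Psi (s, t))%E.
  move=> /andP[rs sr].
  have s0 : 0 < s by lra.
  have srho : 0 < s < rho by rewrite s0/=; exact: le_lt_trans rr.
  have cS : {for 0, continuous S} by apply: derivable_continuous; apply: Sd; rewrite /= normr0.
  have := square_mean srho (fun z h1 h2 _ => Sd z h1 h2) cS (fun z _ _ => Ssym z).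
  rewrite S0 ComplexField.Normc.normcM.
  have -> : normc (4 : R[i]) = 4.
    by rewrite -[4 in LHS](rmorph_nat (real_complex R)) normc_real normr_nat.
  move=> H; apply: le_trans (_ : ((4 * normc (g c) * s)%:E <= _)%E).
    rewrite lee_fin; have := normc_ge0 (g c); nra.
  apply: le_trans H _.
  apply: (@le_trans _ _ (\int[mu]_(t in `[(- s)%R, s]) Psi (s, t))%E).
    apply: ge0_le_integral => //.
    - by move=> t _; rewrite lee_fin normc_ge0.
    - apply/measurable_EFinP; apply: subspace_continuous_measurable_fun => //.
      apply: continuous_in_subspaceT => t; rewrite inE /= in_itv /= => /andP[t1 t2].
      apply: (@continuous_comp _ _ _ (fun y => S (s +i* y)) (@normc R)); last exact: continuous_normc.
      apply: (@continuous_comp _ _ _ (fun y : R => s +i* y) S).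
        by apply/continuous_complexP; split; [exact: cvg_cst|exact: cvg_id].
      apply: derivable_continuous; apply: Sd => /=; first by rewrite gtr0_norm//; lra.
      by rewrite ltr_norml; lra.
    - exact: measurable_funS (mP1 s).
    - move=> t /=; rewrite in_itv /= => /andP[t1 t2].
      have sN : `|s| <= r by rewrite gtr0_norm.
      have tN : `|t| <= r by rewrite ler_norml; lra.
      have i1 : 'i%C * (s +i* t) = - t +i* s.
        by apply/eqP; rewrite eq_complex /=; apply/andP; split; apply/eqP; ring.
      have i2 : - 1 * (s +i* t) = - s +i* - t by rewrite mulN1r.
      have i3 : - 'i%C * (s +i* t) = t +i* - s.
        by apply/eqP; rewrite eq_complex /=; apply/andP; split; apply/eqP; ring.
      rewrite /Psi /S /= i1 i2 i3 !PhiE ?normrN// -!EFinD lee_fin.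
      by do 3!(apply: le_trans (normcD _ _) _; rewrite lerD2r).
  by apply: ge0_subset_integral => //; exact: measurable_funTS.
apply: (@le_trans _ _ (\int[mu]_(s in `[(r / 2)%R, r]) (2 * r * normc (g c))%:E)%E).
  rewrite integral_cst//= lebesgue_measure_itv /= lte_fin ifT; last by lra.
  by rewrite -EFinB -EFinM lee_fin; lra.
apply: (@le_trans _ _ (\int[mu]_(s in `[(r / 2)%R, r]) \int[mu]_t Psi (s, t))%E).
  apply: ge0_le_integral => //.
  - by move=> *; rewrite lee_fin !mulr_ge0 ?normc_ge0// ltW.
  - exact: measurable_funTS.
apply: ge0_subset_integral => //.
by move=> *; exact: integral_ge0.
Qed.

End OneVariable.

(** * Derivative bounds *)

Section DerivativeBound.
Context {R : realType}.
Implicit Types (g : R[i] -> R[i]) (x y s t : R) (z w : R[i]).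
Notation mu := (@lebesgue_measure R).

Definition has_cderiv g c L := forall e : R, 0 < e -> exists2 d : R, 0 < d &
  forall w, normc w < d -> normc (g (c + w) - g c - L * w) <= e * normc w.

Lemma normc_i : normc ('i%C : R[i]) = 1.
Proof. by rewrite /= expr0n expr1n add0r sqrtr1. Qed.

Lemma sqr_iC : 'i%C * 'i%C = -1 :> R[i].
Proof. by rewrite -expr2 sqr_i. Qed.

Lemma normc_nat n : normc (n%:R : R[i]) = n%:R.
Proof. by rewrite -(rmorph_nat (real_complex R)) normc_real normr_nat. Qed.

(** Cauchy's estimate with the derivative seen as a value: [4 L] is the value at 0 of the continuous
    extension of [T z / z], which is why [square_mean] asks only for continuity at 0. On the side of
    half length [rho / 2] one has [|T z| <= 4 B] and [|z| >= rho / 2], so [2 rho |L| <= 8 B]. *)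
Lemma cderiv_bound g c L (rho B : R) : 0 < rho ->
  (forall z, `|complex.Re z| < rho -> `|complex.Im z| < rho -> derivable g (c + z) 1) ->
  (forall z, `|complex.Re z| < rho -> `|complex.Im z| < rho -> normc (g (c + z)) <= B) ->
  has_cderiv g c L -> normc L <= 4 * B / rho.
Proof.
move=> rho0 dg gB gL.
pose G w := g (c + w).
(* T z / z is invariant under the quarter turn and tends to 4 L at 0. *)
pose T z := G z - 'i%C * G ('i%C * z) - G (- 1 * z) + 'i%C * G (- 'i%C * z).
have rotR z : `|complex.Re ('i%C * z)| = `|complex.Im z|.
  by case: z => p q /=; rewrite mul0r mul1r sub0r normrN.
have rotI z : `|complex.Im ('i%C * z)| = `|complex.Re z|.
  by case: z => p q /=; rewrite mul0r mul1r add0r.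
have dG w : `|complex.Re w| < rho -> `|complex.Im w| < rho -> derivable G w 1.
  by move=> *; apply: derivable_addl; exact: dg.
have Td z : `|complex.Re z| < rho -> `|complex.Im z| < rho -> derivable T z 1.
  move=> h1 h2.
  have d1 : derivable (fun w => G ('i%C * w)) z 1.
    by apply: derivable_mull; apply: dG; rewrite ?rotR ?rotI.
  have d2 : derivable (fun w => G (- 1 * w)) z 1.
    by apply: derivable_mull; apply: dG; rewrite mulN1r raddfN normrN.
  have d3 : derivable (fun w => G (- 'i%C * w)) z 1.
    by apply: derivable_mull; apply: dG; rewrite mulNr raddfN normrN ?rotR ?rotI.
  have dc (k : R[i]) : derivable (fun=> k) z 1 := @derivable_cst _ _ _ k z 1.
  exact: (derivableD (derivableB (derivableB (dG z h1 h2) (derivableM (dc 'i%C) d1)) d2)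
    (derivableM (dc 'i%C) d3)).
pose H z := if z == 0 then 4 * L else T z * z^-1.
have Tsym z : T ('i%C * z) = 'i%C * T z.
  have j2 : 'i%C * ('i%C * z) = - 1 * z by rewrite mulrA sqr_iC.
  have j3 : - 1 * ('i%C * z) = - 'i%C * z by rewrite mulN1r mulNr.
  have j4 : - 'i%C * ('i%C * z) = z by rewrite mulNr mulrA sqr_iC mulN1r opprK.
  rewrite /T j2 j3 j4; set I := 'i%C.
  have -> : I * (G z - I * G (I * z) - G (- 1 * z) + I * G (- I * z)) =
     I * G z - (I * I) * G (I * z) - I * G (- 1 * z) + (I * I) * G (- I * z) by ring.
  by rewrite sqr_iC; ring.
have i0 : ('i%C : R[i]) != 0 by rewrite -normc_gt0 normc_i.
have Hsym z : H ('i%C * z) = H z.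
  rewrite /H mulf_eq0 (negbTE i0) /=; case: eqP => // _.
  by rewrite Tsym invfM mulrACA mulfV// mul1r.
have dH z : `|complex.Re z| < rho -> `|complex.Im z| < rho -> z != 0 -> derivable H z 1.
  move=> h1 h2 z0; apply: (@near_eq_derivable _ _ _ (fun w => T w * w^-1)).
    apply/nbhs_complexP; exists (normc z) => [|w wz]; first by rewrite normc_gt0.
    rewrite /H; case: eqP => // w0; move: wz; rewrite w0 subr0 ltxx//.
  have dV : derivable (fun w => w^-1) z 1 := derivableV z0 (@derivable_id _ _ z 1).
  exact: (derivableM (Td z h1 h2) dV).
have H0 : H 0 = 4 * L by rewrite /H eqxx.
have cH : {for 0, continuous H}.
  apply: (@cvg_complexP R R[i] (nbhs 0) _ H (H 0)).2 => e e0.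
  have [d d0 Hd] := gL (e / 8) (divr_gt0 e0 (ltr0n _ 8)).
  apply/nbhs_complexP; exists d => // w; rewrite sub0r normcN => wd.
  rewrite /= H0 /H; case: eqP => [_|/eqP w0].
    by rewrite subrr ComplexField.Normc.normc0.
  (* The four values of [g c] in [T w] cancel, and the four linear terms add up to [4 * L * w]; only
     first-order errors remain. *)
  pose E w := G w - g c - L * w.
  have Eb k : normc k = 1 -> normc (E (k * w)) <= e / 8 * normc w.
    by move=> k1; have := Hd (k * w); rewrite !ComplexField.Normc.normcM k1 mul1r; apply.
  have n1 : normc (1 : R[i]) = 1 by rewrite (normc_nat 1).
  have -> : 4 * L - T w * w^-1 =
      - (E (1 * w) - 'i%C * E ('i%C * w) - E (- 1 * w) + 'i%C * E (- 'i%C * w)) * w^-1.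
    have -> : T w = E (1 * w) - 'i%C * E ('i%C * w) - E (- 1 * w) + 'i%C * E (- 'i%C * w) + 4 * L * w.
      rewrite /T /E mul1r; set I := 'i%C.
      have -> : 4 * L * w = 2 * L * w - 2 * (I * I) * L * w by rewrite sqr_iC; ring.
      by ring.
    by field.
  rewrite ComplexField.Normc.normcM normcN ComplexField.Normc.normcV ltr_pdivrMr ?normc_gt0//.
  have B1 := Eb 1 n1; have B2 := Eb 'i%C normc_i.
  have B3 := Eb (- 1) (etrans (normcN _) n1); have B4 := Eb (- 'i%C) (etrans (normcN _) normc_i).
  apply: le_lt_trans (normcD _ _) _; rewrite ComplexField.Normc.normcM normc_i mul1r.
  have := normcB (E (1 * w) - 'i%C * E ('i%C * w)) (E (- 1 * w)).
  have := normcB (E (1 * w)) ('i%C * E ('i%C * w)).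
  rewrite ComplexField.Normc.normcM normc_i mul1r.
  have : 0 < e * normc w by rewrite mulr_gt0// normc_gt0.
  move: B1; rewrite !mul1r; lra.
have := @square_mean R H rho (rho / 2) _ dH cH (fun z _ _ => Hsym z).
have r2 : 0 < rho / 2 < rho by lra.
move=> /(_ r2); rewrite H0 ComplexField.Normc.normcM normc_nat => ineq.
have B0 : 0 <= B.
  by apply: le_trans (normc_ge0 (g (c + 0))) (gB 0 _ _); rewrite raddf0 normr0.
have : ((4 * normc L * (rho / 2))%:E <= (8 * B)%:E)%E.
  apply: le_trans ineq _.
  apply: (@le_trans _ _ (\int[mu]_(t in `[(- (rho / 2))%R, (rho / 2)%R]) (8 * B / rho)%:E)%E); last first.
    rewrite integral_cst//= lebesgue_measure_itv /= lte_fin ifT; last by lra.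
    rewrite -EFinB -EFinM lee_fin le_eqVlt; apply/orP; left; apply/eqP.
    by field; rewrite gt_eqF.
  apply: ge0_le_integral => //.
  - by move=> t _; rewrite lee_fin normc_ge0.
  - apply/measurable_EFinP; apply: subspace_continuous_measurable_fun => //.
    apply: continuous_in_subspaceT => t; rewrite inE /= in_itv /= => /andP[t1 t2].
    apply: (@continuous_comp _ _ _ (fun y => H (rho / 2 +i* y)) (@normc R)); last exact: continuous_normc.
    apply: (@continuous_comp _ _ _ (fun y : R => rho / 2 +i* y) H).
      by apply/continuous_complexP; split; [exact: cvg_cst|exact: cvg_id].
    apply: derivable_continuous; apply: dH => /=.
    + by rewrite gtr0_norm//; lra.
    + by rewrite ltr_norml; lra.
    + by rewrite eq_complex /= negb_and gt_eqF//; lra.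
  - move=> t; rewrite /= in_itv /= => /andP[t1 t2]; rewrite lee_fin.
    set z := (rho / 2 +i* t).
    have [rz iz] : complex.Re z = rho / 2 /\ complex.Im z = t by [].
    have r20 : 0 < rho / 2 by lra.
    have zr : rho / 2 <= normc z by apply: le_trans (Re_normc z); rewrite rz gtr0_norm.
    have z0 : z != 0 by rewrite -normc_gt0; lra.
    rewrite /H (negbTE z0) ComplexField.Normc.normcM ComplexField.Normc.normcV.
    rewrite ler_pdivrMr; last by lra.
    have h1 : `|complex.Re z| < rho by rewrite rz gtr0_norm//; lra.
    have h2 : `|complex.Im z| < rho by rewrite iz ltr_norml; lra.
    have b1 := gB z h1 h2.
    have b2 : normc (g (c + 'i%C * z)) <= B by apply: gB; rewrite ?rotR ?rotI.
    have b3 : normc (g (c + - 1 * z)) <= B by apply: gB; rewrite mulN1r raddfN normrN.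
    have b4 : normc (g (c + - 'i%C * z)) <= B.
      by apply: gB; rewrite mulNr raddfN normrN ?rotR ?rotI.
    apply: (@le_trans _ _ (4 * B)); last first.
      have -> : 4 * B = 8 * B / rho * (rho / 2) by field; rewrite gt_eqF.
      by apply: ler_wpM2l => //; rewrite divr_ge0 ?mulr_ge0// ltW.
    apply: le_trans (normcD _ _) _; rewrite ComplexField.Normc.normcM normc_i mul1r.
    have := normcB (G z - 'i%C * G ('i%C * z)) (G (- 1 * z)).
    have := normcB (G z) ('i%C * G ('i%C * z)).
    rewrite ComplexField.Normc.normcM normc_i mul1r /G.
    lra.
rewrite lee_fin => ?; rewrite ler_pdivlMr//; lra.
Qed.

Lemma is_derive_increment (f : R -> R) (t L : R) :
  (forall e, 0 < e -> exists2 d : R, 0 < d & forall h, `|h| < d ->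
     `|f (t + h) - f t - L * h| <= e * `|h|) -> is_derive t 1 f L.
Proof.
move=> H.
have C : (fun h => h^-1 *: (f (h *: 1 + t) - f t)) @ 0^' --> L.
  apply/cvgrPdist_le => e e0; have [d d0 Hd] := H e e0.
  near=> h; have h0 : h != 0 by near: h; exact: nbhs_dnbhs_neq.
  have hd : `|h| < d by near: h; exact: dnbhs0_lt.
  have := Hd h hd; rewrite -(ler_pdivrMr _ _ (_ : 0 < `|h|)) ?normr_gt0//.
  rewrite -normfV -normrM distrC; apply: le_trans.
  rewrite le_eqVlt; apply/orP; left; apply/eqP; congr `| _ |.
  by rewrite /GRing.scale /= mulr1 (addrC h); field.
apply: DeriveDef; first by apply/cvg_ex; exists L.
exact: cvg_lim.
Unshelve. all: by end_near. Qed.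

(** Squares of half side [M / 2] centred on [[0, 1]] stay in the disc, as [1 + M <= 2 * M], so
    [cderiv_bound] bounds the derivative there by [8 * B / M]. The mean value theorem is applied to
    the real and imaginary parts separately, which doubles the constant. *)
Lemma complex_lipschitz g (M B : R) : 1 <= M ->
  (forall z, normc z < 2 * M -> derivable g z 1) ->
  (forall z, normc z < 2 * M -> normc (g z) <= B) ->
  normc (g 1 - g 0) <= 16 * B / M.
Proof.
move=> M1 dg gB.
have M2 : 0 < M / 2 by lra.
have near1 (x : R) z : 0 <= x <= 1 -> `|complex.Re z| < M / 2 -> `|complex.Im z| < M / 2 ->
    normc (x%:C + z) < 2 * M.
  move=> /andP[x0 x1] h1 h2; apply: le_lt_trans (normcD _ _) _.
  by have := normc_ReIm z; rewrite normc_real (ger0_norm x0); lra.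
have Dx (x : R) : exists L, 0 <= x <= 1 ->
    normc L <= 8 * B / M /\ has_cderiv g x%:C L.
  have [x01|] := boolP (0 <= x <= 1); last by exists 0.
  have /derivable_complexP[L HL] : derivable g x%:C 1.
    by apply: dg; rewrite -[x%:C]addr0; apply: near1; rewrite // raddf0 normr0.
  exists L => _; split=> //.
  have -> : 8 * B / M = 4 * B / (M / 2) by field; lra.
  apply: (cderiv_bound M2 _ _ HL) => z h1 h2; first by apply: dg; exact: near1.
  by apply: gB; exact: near1.
have /choice[D HD] := Dx.
have part (p : R[i] -> R) : {morph p : z w / z - w} -> (forall z, `|p z| <= normc z) ->
    (forall z (h : R), p (z * h%:C) = p z * h) ->
    `|p (g 1) - p (g 0)| <= 8 * B / M.
  move=> pB pN pM.
  have := @mvt_bound R (fun x => p (g x%:C)) (fun x => p (D x)) 0 1 0 (8 * B / M) ler01.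
  rewrite mul0r !subr0 mulr1; apply => x x01; have [Db Dd] := HD x x01.
    apply: is_derive_increment => e e0; have [d d0 Hd] := Dd e e0.
    exists d => // h hd; have := Hd h%:C; rewrite normc_real => /(_ hd).
    apply: le_trans; rewrite -pM -!pB rmorphD; exact: pN.
  by rewrite subr0; apply: le_trans (pN _) _.
have pR := part (@complex.Re R) (raddfB _) Re_normc.
have pI := part (@complex.Im R) (raddfB _) Im_normc.
apply: le_trans (normc_ReIm _) _; rewrite !raddfB.
have -> : 16 * B / M = 8 * B / M + 8 * B / M by field; lra.
apply: lerD; [apply: pR|apply: pI].
  by case=> a b h /=; ring.
by case=> a b h /=; ring.
Qed.

End DerivativeBound.

(** * Holomorphic functions on C^n *)

Lemma differentiable_intro (K : numFieldType) (V W : normedModType K) (f : V -> W)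
    (a : V) (L : {linear V -> W}) : continuous L ->
  (forall e : K, 0 < e ->
    \forall h \near nbhs (0 : V), `|f (h + a) - (f a + L h)| <= e * `|h|) ->
  differentiable f a.
Proof.
move=> cL H; have dL : f \o shift a = cst (f a) + L +o_ (0 : V) id.
  by apply/eqaddoP => e e0; exact: H.
have E := diff_unique cL dL.
by apply/diff_locallyP; rewrite E.
Qed.

Section SeveralVariables.
Context {R : realType} {n : nat}.
Local Notation Cn := 'rV[R[i]]_n.
Implicit Types (z w h a : Cn) (f : Cn -> R[i]).

(** The norm of [Cn] takes its values in [R[i]]; this is the same number in [R]. *)
Definition nrm z : R := complex.Re `|z|.

Lemma nrmE z : `|z| = (nrm z)%:C.
Proof. by rewrite /nrm RRe_real// normr_real. Qed.

Lemma nrm_ge0 z : 0 <= nrm z.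
Proof. by rewrite -ler0c -nrmE. Qed.

Lemma nrmZ c z : nrm (c *: z) = normc c * nrm z.
Proof. by apply: complexI; rewrite -nrmE normrZ nrmE rmorphM. Qed.

Lemma nrm0 : nrm 0 = 0.
Proof. by rewrite /nrm normr0. Qed.

Lemma nrmD z w : nrm (z + w) <= nrm z + nrm w.
Proof. by have := ler_normD z w; rewrite !nrmE -rmorphD lecR. Qed.

Lemma nrm_eq0 z : (nrm z == 0) = (z == 0).
Proof. by rewrite -(inj_eq (@complexI R)) -nrmE normr_eq0. Qed.

Lemma nrm_gt0 z : (0 < nrm z) = (z != 0).
Proof. by rewrite lt_neqAle nrm_ge0 andbT eq_sym nrm_eq0. Qed.

Lemma nrm_ltP z (e : R) : 0 < e -> reflect (forall j, normc (z 0 j) < e) (nrm z < e).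
Proof.
move=> e0; rewrite -ltcR -nrmE; have e0' : 0 < e%:C by rewrite ltcR.
have B := @mx_norm_ball R[i] 1 n.
apply: (iffP idP) => [ze j|ze].
  have : ball (0 : Cn) e%:C z by rewrite B /ball_ /= sub0r normrN.
  by case=> _ /(_ 0 j); rewrite mxE /ball /= sub0r normrN normcE ltcR.
have : ball (0 : Cn) e%:C z.
  split=> // i j; rewrite ord1 mxE /ball /= sub0r normrN normcE ltcR; exact: ze.
by rewrite B /ball_ /= sub0r normrN.
Qed.

Lemma nrm_coord z j : normc (z 0 j) <= nrm z.
Proof.
apply/ler_addgt0Pr => e e0; rewrite ltW//.
have e0' : 0 < nrm z + e by rewrite ltr_wpDl// nrm_ge0.
by have /(nrm_ltP z e0') : nrm z < nrm z + e by rewrite ltrDl.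
Qed.

Lemma nbhs_rVP a (A : set Cn) : nbhs a A <->
  exists2 e : R, 0 < e & forall w, nrm (w - a) < e -> A w.
Proof.
split=> [/nbhs_ballP[e /= e0 H]|[e e0 H]].
  exists (complex.Re e) => [|w hw]; first by move: e0; rewrite ltcE => /andP[].
  apply: H; rewrite (@mx_norm_ball R[i] 1 n) /ball_ /= distrC nrmE.
  by move: e0; rewrite !ltcE /= => /andP[/eqP -> _]; rewrite eqxx.
apply/nbhs_ballP; exists e%:C => [|w]; first by rewrite /= ltcR.
by rewrite (@mx_norm_ball R[i] 1 n) /ball_ /= distrC nrmE ltcR; exact: H.
Qed.

Definition has_diff f a (L : Cn -> R[i]) := forall e : R, 0 < e -> exists2 d : R, 0 < d &
  forall h, nrm h < d -> normc (f (a + h) - f a - L h) <= e * nrm h.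

Lemma differentiable_has_diff f a : differentiable f a ->
  exists L : {linear Cn -> R[i]}, has_diff f a L.
Proof.
move=> /diff_locallyP[_ /eqaddoP H]; exists ('d f a) => e e0.
have e0' : 0 < e%:C by rewrite ltcR.
have /nbhs_rVP[d d0 Hd] := H _ e0'.
exists d => // h hd; have := Hd h; rewrite subr0 => /(_ hd).
rewrite /= nrmE normcE -rmorphM lecR; apply: le_trans.
rewrite le_eqVlt; apply/orP; left; apply/eqP; congr normc.
by rewrite !fctE /= (addrC a) opprD addrA.
Qed.

Lemma has_diff_differentiable f a (L : {linear Cn -> R[i]}) (K : R) :
  (forall h, normc (L h) <= K * nrm h) -> has_diff f a L -> differentiable f a.
Proof.
move=> LK HL.
have cL : continuous L.
  move=> z; apply: (@cvg_complexP R Cn (nbhs z) _ L (L z)).2 => e e0.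
  have K0 : 0 < `|K| + 1 by rewrite ltr_wpDl.
  apply/nbhs_rVP; exists (e / (`|K| + 1)) => [|w hw]; first by rewrite divr_gt0.
  rewrite /= -linearB -normcN -linearN opprB; apply: le_lt_trans (LK _) _.
  have : nrm (w - z) * (`|K| + 1) < e by rewrite -ltr_pdivlMr.
  apply: le_lt_trans; rewrite mulrC ler_wpM2l ?nrm_ge0//.
  by apply: le_trans (ler_norm _) _; rewrite lerDl.
apply: (@differentiable_intro R[i] _ _ f a L cL) => e e0.
have [e1 Ee] : 0 < complex.Re e /\ e = (complex.Re e)%:C.
    move: e0; rewrite ltcE => /andP[/eqP Ie Re0]; split => //.
    by apply/eqP; rewrite eq_complex /= eqxx /= Ie.
  have [d d0 Hd] := HL _ e1.
  apply/nbhs_rVP; exists d => // h; rewrite subr0 => hd.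
  rewrite /= nrmE normcE Ee -rmorphM lecR; apply: le_trans (Hd h hd).
  rewrite le_eqVlt; apply/orP; left; apply/eqP; congr normc.
by rewrite (addrC a) opprD addrA.
Qed.

Lemma differentiable_line f a h c : differentiable f (a + c *: h) ->
  derivable (fun w : R[i] => f (a + w *: h)) c 1.
Proof.
move=> df; apply/derivable1_diffP.
have da : differentiable (fun w : R[i] => a + w *: h) c.
  have d1 : differentiable (fun w : R[i] => w *: h) c.
    exact: (@ex_diff _ _ _ _ _ _ _ (is_diff_scalel c h)).
  exact: (differentiableD (differentiable_cst a c) d1).
exact: (differentiable_comp da df).
Qed.

End SeveralVariables.

(** * Locally uniform limits of holomorphic functions *)

Section Weierstrass.
Context {R : realType} {n : nat}.
Local Notation Cn := 'rV[R[i]]_n.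
Implicit Types (z w h a v : Cn) (f : Cn -> R[i]) (e : R).

Definition tends (u : nat -> R[i]) (l : R[i]) := forall e, 0 < e ->
  exists N, forall k, (N <= k)%N -> normc (u k - l) <= e.

Lemma tends_le (u : nat -> R[i]) (l w : R[i]) (K : R) N : tends u l ->
  (forall k, (N <= k)%N -> normc (u k - w) <= K) -> normc (l - w) <= K.
Proof.
move=> ul uK; apply/ler_addgt0Pr => e /ul[N' HN'].
have h1 := HN' _ (leq_maxr N N'); have h2 := uK _ (leq_maxl N N').
have -> : l - w = (u (maxn N N') - w) - (u (maxn N N') - l) by ring.
by apply: le_trans (normcB _ _) _; apply: lerD.
Qed.

Lemma tends_unique u (l l' : R[i]) : tends u l -> tends u l' -> l = l'.
Proof.
move=> ul ul'; apply/eqP; rewrite -subr_eq0 -normc_eq0 eq_le normc_ge0 andbT.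
apply/ler_addgt0Pr => e /ul'[N HN]; rewrite add0r.
exact: tends_le ul HN.
Qed.

Lemma tends_linear (c : R[i]) (u v : nat -> R[i]) (l m : R[i]) : tends u l -> tends v m ->
  tends (fun k => c * u k + v k) (c * l + m).
Proof.
move=> ul vm e e0.
have c0 : 0 < normc c + 1 by rewrite ltr_wpDl// normc_ge0.
have [N HN] := ul _ (divr_gt0 e0 (mulr_gt0 (ltr0n _ 2) c0)).
have [N' HN'] := vm _ (divr_gt0 e0 (ltr0n _ 2)).
exists (maxn N N') => k; rewrite geq_max => /andP[/HN h1 /HN' h2].
have -> : c * u k + v k - (c * l + m) = c * (u k - l) + (v k - m) by ring.
apply: le_trans (normcD _ _) _; rewrite ComplexField.Normc.normcM.
rewrite (splitr e); apply: lerD h2.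
apply: (@le_trans _ _ ((normc c + 1) * (e / (2 * (normc c + 1))))).
  by apply: ler_pM; rewrite ?normc_ge0// lerDl.
by rewrite le_eqVlt; apply/orP; left; apply/eqP; field; rewrite gt_eqF.
Qed.

Lemma complex_cauchy (u : nat -> R[i]) :
  (forall e, 0 < e -> exists N, forall k l, (N <= k)%N -> (N <= l)%N ->
     normc (u k - u l) <= e) -> exists l, tends u l.
Proof.
move=> H.
have C (p : R[i] -> R) : {morph p : z w / z - w} -> (forall z : R[i], `|p z| <= normc z) ->
    exists l : R, forall e, 0 < e -> exists N, forall k, (N <= k)%N -> `|p (u k) - l| <= e.
  move=> pB pN.
  have cv : cvgn (fun k => p (u k)).
    apply/cauchy_cvgP/cauchy_exP => e e0; have [N HN] := H _ (divr_gt0 e0 (ltr0n _ 2)).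
    exists (p (u N)); exists N => // k /= Nk; rewrite /ball /= -pB.
    by apply: le_lt_trans (pN _) _; apply: le_lt_trans (HN _ _ (leqnn N) Nk) _; lra.
  exists (limn (fun k => p (u k))) => e e0.
  move/cvgrPdist_le : cv => /(_ e e0)[N _ HN].
  by exists N => k Nk; rewrite distrC; exact: HN.
have [a Ha] := C _ (raddfB (@complex.Re R)) Re_normc.
have [b Hb] := C _ (raddfB (@complex.Im R)) Im_normc.
exists (a +i* b) => e e0.
have [N HN] := Ha _ (divr_gt0 e0 (ltr0n _ 2)).
have [N' HN'] := Hb _ (divr_gt0 e0 (ltr0n _ 2)).
exists (maxn N N') => k; rewrite geq_max => /andP[/HN h1 /HN' h2].
by apply: le_trans (normc_ReIm _) _; rewrite !raddfB /= (splitr e) lerD.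
Qed.

(** On the complex line [w -> a + w h] the ball of radius [2 * r] becomes the disc of radius [2 * M]
    with [M = r / nrm h], and [complex_lipschitz] applies. *)
Lemma holo_lipschitz f a (r B : R) h : 0 < r ->
  (forall z, nrm (z - a) < 2 * r -> differentiable f z) ->
  (forall z, nrm (z - a) < 2 * r -> normc (f z) <= B) ->
  nrm h < r -> normc (f (a + h) - f a) <= 16 * B / r * nrm h.
Proof.
move=> r0 df fB hr; have [->|h0] := eqVneq h 0.
  by rewrite addr0 subrr ComplexField.Normc.normc0 nrm0 mulr0.
have h00 : 0 < nrm h by rewrite nrm_gt0.
have M1 : 1 <= r / nrm h by rewrite ler_pdivlMr// mul1r ltW.
have near (z : R[i]) : normc z < 2 * (r / nrm h) -> nrm (a + z *: h - a) < 2 * r.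
  by move=> zM; rewrite addrC addKr nrmZ -ltr_pdivlMr// -mulrA.
have := @complex_lipschitz R (fun z : R[i] => f (a + z *: h)) (r / nrm h) B M1.
rewrite scale1r scale0r addr0 (_ : 16 * B / (r / nrm h) = 16 * B / r * nrm h); last first.
  by field; rewrite !gt_eqF.
apply=> z zM; last by apply: fB; exact: near.
by apply: differentiable_line; apply: df; exact: near.
Qed.

(** A small multiple of [v] is tested, and homogeneity of [L] removes the multiple. *)
Lemma has_diff_bound f a (L : {linear Cn -> R[i]}) (r K : R) : 0 < r ->
  has_diff f a L ->
  (forall h, nrm h < r -> normc (f (a + h) - f a) <= K * nrm h) ->
  forall v, normc (L v) <= K * nrm v.
Proof.
move=> r0 fL fK v; have [->|v0] := eqVneq v 0.
  by rewrite linear0 ComplexField.Normc.normc0 nrm0 mulr0.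
have v00 : 0 < nrm v by rewrite nrm_gt0.
apply/ler_addgt0Pr => e e0.
have [d d0 Hd] := fL _ (divr_gt0 e0 v00).
pose t := Num.min (r / 2) (d / 2) / nrm v.
have m0 : 0 < Num.min (r / 2) (d / 2) by rewrite lt_min; apply/andP; split; lra.
have t0 : 0 < t by rewrite divr_gt0.
have nt : nrm (t%:C *: v) = Num.min (r / 2) (d / 2).
  by rewrite nrmZ normc_real gtr0_norm// divfK// gt_eqF.
have ntr : nrm (t%:C *: v) < r.
  have : nrm (t%:C *: v) <= r / 2 by rewrite nt ge_min lexx.
  lra.
have ntd : nrm (t%:C *: v) < d.
  have : nrm (t%:C *: v) <= d / 2 by rewrite nt ge_min lexx orbT.
  lra.
have h1 := fK _ ntr; have h2 := Hd _ ntd.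
have : normc (L (t%:C *: v)) <= (K + e / nrm v) * nrm (t%:C *: v).
  set D := f (a + _) - f a in h1 h2.
  have -> : L (t%:C *: v) = D - (D - L (t%:C *: v)) by ring.
  by apply: le_trans (normcB _ _) _; rewrite mulrDl lerD.
rewrite linearZ /= nrmZ ComplexField.Normc.normcM normc_real gtr0_norm//.
rewrite mulrCA ler_pM2l// mulrDl divfK// gt_eqF//.
Qed.

Lemma has_diffB f g a (L M : Cn -> R[i]) : has_diff f a L -> has_diff g a M ->
  has_diff (fun z => f z - g z) a (fun h => L h - M h).
Proof.
move=> fL gM e e0.
have [d d0 Hd] := fL _ (divr_gt0 e0 (ltr0n _ 2)).
have [d' d0' Hd'] := gM _ (divr_gt0 e0 (ltr0n _ 2)).
exists (Num.min d d') => [|h]; first by rewrite lt_min d0.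
rewrite lt_min => /andP[/Hd h1 /Hd' h2].
have -> : f (a + h) - g (a + h) - (f a - g a) - (L h - M h) =
  (f (a + h) - f a - L h) - (g (a + h) - g a - M h) by ring.
apply: le_trans (normcB _ _) _.
by rewrite (splitr e) mulrDl lerD.
Qed.

Lemma linear_bound (L : {linear Cn -> R[i]}) :
  exists K : R, forall v, normc (L v) <= K * nrm v.
Proof.
exists (\sum_j normc (L (delta_mx 0 j))) => v.
rewrite [in L v](row_sum_delta v) linear_sum mulr_suml.
apply: (big_ind2 (fun (x : R[i]) (y : R) => normc x <= y)).
- by rewrite ComplexField.Normc.normc0.
- by move=> x1 x2 y1 y2 h1 h2; apply: le_trans (normcD _ _) _; exact: lerD.
move=> j _; rewrite linearZ /= ComplexField.Normc.normcM mulrC.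
by apply: ler_wpM2l; [exact: normc_ge0|exact: nrm_coord].
Qed.

(** Through [holo_lipschitz], uniform smallness of [F k - F l] near [a] becomes a small Lipschitz
    constant at [a]. Hence the differentials at [a] converge, and the increments of [f - F k] are
    small relative to [nrm h]. Comparison with one late [F N] differentiates [f]. *)
Lemma weierstrass (Omega : set Cn) (F : nat -> Cn -> R[i]) f : open Omega ->
  (forall k z, Omega z -> differentiable (F k) z) ->
  (forall a, Omega a -> exists2 r : R, 0 < r & forall e, 0 < e ->
     exists N, forall k, (N <= k)%N -> forall z, nrm (z - a) < r ->
     normc (F k z - f z) <= e) ->
  forall z, Omega z -> differentiable f z.
Proof.
move=> oO dF cF a Oa.
have [r1 r10 Hr1] : exists2 r : R, 0 < r & forall w, nrm (w - a) < r -> Omega w.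
  by apply/nbhs_rVP; move: oO; rewrite openE; apply.
have [r2 r20 Hr2] := cF a Oa.
pose rho := Num.min r1 r2 / 2.
have m0 : 0 < Num.min r1 r2 by rewrite lt_min r10.
have rho0 : 0 < rho by rewrite divr_gt0.
have rho2 : 2 * rho = Num.min r1 r2 by rewrite /rho; field.
have inO w : nrm (w - a) < 2 * rho -> Omega w.
  by rewrite rho2 lt_min => /andP[+ _]; exact: Hr1.
have /choice[L HL] : forall k, exists L : {linear Cn -> R[i]}, has_diff (F k) a L.
  by move=> k; apply: differentiable_has_diff; exact: dF.
have unif e : 0 < e -> exists N, forall k l, (N <= k)%N -> (N <= l)%N ->
    forall z, nrm (z - a) < 2 * rho -> normc (F k z - F l z) <= e.
  move=> e0; have [N HN] := Hr2 _ (divr_gt0 e0 (ltr0n _ 2)).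
  exists N => k l Nk Nl z zr.
  have zr2 : nrm (z - a) < r2 by move: zr; rewrite rho2 lt_min => /andP[].
  have -> : F k z - F l z = (F k z - f z) - (F l z - f z) by ring.
  by apply: le_trans (normcB _ _) _; rewrite (splitr e) lerD// HN.
have incr e : 0 < e -> exists N, forall k l, (N <= k)%N -> (N <= l)%N ->
    (forall h, nrm h < rho ->
      normc ((F k (a + h) - F l (a + h)) - (F k a - F l a)) <= e * nrm h) /\
    (forall v, normc (L k v - L l v) <= e * nrm v).
  (* This bound on [F k - F l] turns the constant [16 * B / rho] of [holo_lipschitz] into [e]. *)
  move=> e0; have e0' : 0 < e * rho / 16 by rewrite divr_gt0// mulr_gt0.
  have [N HN] := unif _ e0'; exists N => k l Nk Nl.
  have A h : nrm h < rho ->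
      normc ((F k (a + h) - F l (a + h)) - (F k a - F l a)) <= e * nrm h.
    move=> hr.
    have -> : e = 16 * (e * rho / 16) / rho by field; rewrite gt_eqF.
    apply: (@holo_lipschitz (fun z => F k z - F l z) a rho _ h rho0 _ _ hr) => z zr.
      have d1 := dF k z (inO z zr); have d2 := dF l z (inO z zr).
      exact: (differentiableB d1 d2).
    exact: HN.
  split=> // v.
  have D := has_diffB (HL k) (HL l).
  exact: (@has_diff_bound (fun z => F k z - F l z) a (L k \- L l) rho e rho0 D A v).
have /choice[M HM] : forall v, exists l, tends (fun k => L k v) l.
  move=> v; apply: complex_cauchy => e e0.
  have v0 : 0 < nrm v + 1 by rewrite ltr_wpDl// nrm_ge0.
  have [N HN] := incr _ (divr_gt0 e0 v0).
  exists N => k l Nk Nl; have [_ /(_ v)] := HN k l Nk Nl.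
  move=> /le_trans; apply; rewrite mulrAC ler_pdivrMr// ler_wpM2l ?(ltW e0)//.
  by rewrite lerDl.
have Mlin : linear M.
  move=> c v w; apply: tends_unique (HM _) _.
  have := tends_linear c (HM v) (HM w).
  by rewrite (_ : (fun k => c * L k v + L k w) = fun k => L k (c *: v + w))//;
    apply/funext => k; rewrite linearP.
pose LM : {linear Cn -> R[i]} := HB.pack M (GRing.isLinear.Build _ _ _ _ M Mlin).
have cvF z : nrm (z - a) < r2 -> tends (F ^~ z) (f z).
  by move=> zr e e0; have [N HN] := Hr2 _ e0; exists N => k Nk; exact: HN.
have rho_r2 : rho < r2.
  have : 2 * rho <= r2 by rewrite rho2 ge_min lexx orbT.
  lra.
have fL e : 0 < e -> exists N, forall k, (N <= k)%N ->
    (forall h, nrm h < rho ->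
      normc ((f (a + h) - F k (a + h)) - (f a - F k a)) <= e * nrm h) /\
    (forall v, normc (M v - L k v) <= e * nrm v).
  move=> e0; have [N HN] := incr e e0; exists N => k Nk; split=> [h hr|v].
    have t1 : tends (F ^~ (a + h)) (f (a + h)).
      by apply: cvF; rewrite addrC addKr; exact: lt_trans rho_r2.
    have t2 : tends (F ^~ a) (f a) by apply: cvF; rewrite subrr nrm0.
    have := tends_linear (- 1) t2 t1 => t3.
    have -> : f (a + h) - F k (a + h) - (f a - F k a) =
      (- 1 * f a + f (a + h)) - (F k (a + h) - F k a) by ring.
    apply: (tends_le t3) => l Nl; have [/(_ h hr) + _] := HN l k Nl Nk.
    by congr (normc _ <= _); ring.
  by apply: (tends_le (HM v)) => l Nl; have [_ ] := HN l k Nl Nk.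
have [K HK] := linear_bound LM.
apply: (@has_diff_differentiable R n f a LM K HK) => e e0.
have e30 : 0 < e / 3 by lra.
have [N /(_ N (leqnn N))[f1 f2]] := fL _ e30.
have [d d0 Hd] := HL N _ e30.
exists (Num.min d rho) => [|h]; first by rewrite lt_min d0.
rewrite lt_min => /andP[/Hd h1 /f1 h2]; have h3 := f2 h.
have -> : f (a + h) - f a - LM h = (f (a + h) - F N (a + h) - (f a - F N a)) +
  (F N (a + h) - F N a - L N h) - (M h - L N h) by rewrite -[LM h]/(M h); ring.
apply: le_trans (normcB _ _) _.
have := normcD (f (a + h) - F N (a + h) - (f a - F N a)) (F N (a + h) - F N a - L N h).
lra.
Qed.

End Weierstrass.

(** * Submean inequality in C^n *)

Section TupleIntegral.
Context {R : realType}.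
Notation mu := (@lebesgue_measure R).
Notation T := (measurableTypeR R).
Local Open Scope ereal_scope.

Lemma ge0_integral_cons m (F : m.+1.-tuple T -> \bar R) :
  measurable_fun [set: m.+1.-tuple T] F -> (forall t, 0 <= F t) ->
  \int[lebesgue_tuple m.+1]_t F t =
  \int[mu]_x \int[lebesgue_tuple m]_t F (cons_pair (x, t)).
Proof.
move=> mF F0.
have mcF : measurable_fun [set: T * m.-tuple T] (F \o @cons_pair R m).
  exact: measurableT_comp mF (@measurable_cons_pair R m).
have F0' p : 0 <= (F \o @cons_pair R m) p by exact: F0.
have <- := fubini_tonelli1 (m1 := mu) (m2 := lebesgue_tuple m) _ mcF F0'.
have := ge0_integral_pushforward (@measurable_cons_pair R m) (mu \x lebesgue_tuple m)%E
  measurableT mF (fun t _ => F0 t).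
by rewrite preimage_setT.
Qed.

Lemma measurable_cat m p :
  measurable_fun [set: m.-tuple T * p.-tuple T] (fun q => [tuple of q.1 ++ q.2]).
Proof.
apply/measurable_fun_tnthP => i; rewrite -(splitK i); case: (fintype.split i) => j /=.
  rewrite (_ : _ \o _ = (@tnth _ T ^~ j) \o fst); last by apply/funext => q /=; rewrite tnth_lshift.
  exact: measurableT_comp (measurable_tnth j) measurable_fst.
rewrite (_ : _ \o _ = (@tnth _ T ^~ j) \o snd); last by apply/funext => q /=; rewrite tnth_rshift.
exact: measurableT_comp (measurable_tnth j) measurable_snd.
Qed.

(** For [m = p = n] this separates the real parts of the coordinates from the imaginary parts, in
    the order used by [point_of_tuple]. *)
Lemma ge0_integral_cat m p (F : (m + p).-tuple T -> \bar R) :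
  measurable_fun [set: (m + p).-tuple T] F -> (forall t, 0 <= F t) ->
  \int[lebesgue_tuple (m + p)]_t F t =
  \int[lebesgue_tuple m]_X \int[lebesgue_tuple p]_Y F [tuple of X ++ Y].
Proof.
elim: m F => [|m IH] F mF F0.
  rewrite /= integral_dirac//=; last first.
    apply: (measurable_fun_fubini_tonelli_F (m2 := lebesgue_tuple p)
      (fun q : 0.-tuple T * p.-tuple T => F [tuple of q.1 ++ q.2])) => //.
    exact: measurableT_comp mF (@measurable_cat 0 p).
  rewrite diracT mul1e; apply: eq_integral => Y _; congr F; exact/val_inj.
rewrite [LHS](ge0_integral_cons (m := m + p))// [RHS]ge0_integral_cons//; last 2 first.
- apply: (measurable_fun_fubini_tonelli_F (m2 := lebesgue_tuple p)
      (fun q : m.+1.-tuple T * p.-tuple T => F [tuple of q.1 ++ q.2])) => //.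
  exact: measurableT_comp mF (@measurable_cat m.+1 p).
- by move=> X; exact: integral_ge0.
apply: eq_integral => x _.
have mFx : measurable_fun [set: (m + p).-tuple T] (fun t => F (cons_pair (x, t))).
  apply: measurableT_comp mF _; apply: measurableT_comp (@measurable_cons_pair R _) _.
  exact: measurable_fun_pair.
rewrite (IH _ mFx (fun t => F0 _)).
apply: eq_integral => X _; apply: eq_integral => Y _; congr F; exact/val_inj.
Qed.

Definition upd m (X : m.-tuple T) (j : 'I_m) (x : T) : m.-tuple T :=
  [tuple if i == j then x else tnth X i | i < m].

Lemma tnth_cons_pair0 m (p : T * m.-tuple T) : tnth (cons_pair p) ord0 = p.1.
Proof. by []. Qed.

Lemma tnth_cons_pairS m (p : T * m.-tuple T) j :
  tnth (cons_pair p) (lift ord0 j) = tnth p.2 j.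
Proof. by rewrite tnthS. Qed.

Lemma upd_cons0 m x y (X : m.-tuple T) : upd (cons_pair (x, X)) ord0 y = cons_pair (y, X).
Proof.
apply/eq_from_tnth => i; rewrite tnth_mktuple.
case: (unliftP ord0 i) => [j|] ->; last by rewrite eqxx.
by rewrite !tnth_cons_pairS.
Qed.

Lemma upd_consS m x y (X : m.-tuple T) j :
  upd (cons_pair (x, X)) (lift ord0 j) y = cons_pair (x, upd X j y).
Proof.
apply/eq_from_tnth => i; rewrite tnth_mktuple.
case: (unliftP ord0 i) => [k|] ->.
  by rewrite !tnth_cons_pairS /= tnth_mktuple (inj_eq lift_inj).
by rewrite (negbTE (neq_lift _ _)).
Qed.

Lemma cons_pairE m (X : m.+1.-tuple T) :
  X = cons_pair (tnth X ord0, [tuple of behead X]).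
Proof.
by case/tupleP: X => x X; exact/val_inj.
Qed.

(** Induction on [m]: the first coordinate pair is moved by the hypothesis, the others by the
    induction hypothesis. Only the [j]-th coordinates are required to be at the centre, because
    other coordinates may already be integration variables when the [j]-th pair is moved. *)
Lemma submean_iter m (kappa : R) (u : m.-tuple T -> m.-tuple T -> \bar R) (X0 Y0 : m.-tuple T) :
  (0 <= kappa)%R ->
  measurable_fun [set: m.-tuple T * m.-tuple T] (fun p => u p.1 p.2) ->
  (forall X Y, 0 <= u X Y) ->
  (forall j X Y, tnth X j = tnth X0 j -> tnth Y j = tnth Y0 j ->
    kappa%:E * u X Y <= \int[mu]_x \int[mu]_y u (upd X j x) (upd Y j y)) ->
  (kappa ^+ m)%:E * u X0 Y0 <= \int[lebesgue_tuple m]_X \int[lebesgue_tuple m]_Y u X Y.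
Proof.
move=> k0; elim: m u X0 Y0 => [|m IH] u X0 Y0 mu_ u0 H.
  rewrite /= integral_dirac//=; last first.
    exact: (measurable_fun_fubini_tonelli_F (m2 := lebesgue_tuple 0) (fun q => u q.1 q.2)).
  rewrite diracT mul1e integral_dirac//=; last first.
    by apply: (measurable_fun_pair2 _ mu_).
  by rewrite ?diracT ?mul1e (tuple0 X0) (tuple0 Y0).
have mcons (d : measure_display) (S : measurableType d) (f : S -> T) (g : S -> m.-tuple T) :
    measurable_fun [set: S] f -> measurable_fun [set: S] g ->
    measurable_fun [set: S] (fun s => cons_pair (f s, g s)).
  move=> mf mg; apply: (measurableT_comp (@measurable_cons_pair R m)).
  exact: measurable_fun_pair.
have mU (d : measure_display) (S : measurableType d) (f f' : S -> m.+1.-tuple T) :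
    measurable_fun [set: S] f -> measurable_fun [set: S] f' ->
    measurable_fun [set: S] (fun s => u (f s) (f' s)).
  by move=> mf mf'; exact: (measurableT_comp mu_ (measurable_fun_pair mf mf')).
rewrite ge0_integral_cons; last 2 first.
- exact: (measurable_fun_fubini_tonelli_F (m2 := lebesgue_tuple m.+1) (fun q => u q.1 q.2)).
- by move=> X; exact: integral_ge0.
set x0 := tnth X0 ord0; set y0 := tnth Y0 ord0.
set X0' : m.-tuple T := [tuple of behead X0]; set Y0' : m.-tuple T := [tuple of behead Y0].
(* Tonelli's theorem moves [y] in front of the remaining real coordinates, so that the first pair
   [(x, y)] is integrated outermost. *)
have E1 x : \int[lebesgue_tuple m]_X \int[lebesgue_tuple m.+1]_Y u (cons_pair (x, X)) Y =
    \int[mu]_y \int[lebesgue_tuple m]_X \int[lebesgue_tuple m]_Y u (cons_pair (x, X)) (cons_pair (y, Y)).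
  under eq_integral => X _.
    rewrite ge0_integral_cons//; last by apply: mU => //; exact: measurable_cst.
    over.
  rewrite (fubini_tonelli (m1 := lebesgue_tuple m) (m2 := mu)
    (fun p : m.-tuple T * T => \int[lebesgue_tuple m]_Y u (cons_pair (x, p.1)) (cons_pair (p.2, Y))))//.
    apply: (measurable_fun_fubini_tonelli_F (m2 := lebesgue_tuple m)
      (fun q : (m.-tuple T * T) * m.-tuple T => u (cons_pair (x, q.1.1)) (cons_pair (q.1.2, q.2)))) => //.
    apply: mU; apply: mcons => //.
    - exact: measurableT_comp measurable_fst measurable_fst.
    - exact: measurableT_comp measurable_snd measurable_fst.
  by move=> p; exact: integral_ge0.
under eq_integral do rewrite E1.
have step x y : (kappa ^+ m)%:E * u (cons_pair (x, X0')) (cons_pair (y, Y0')) <=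
    \int[lebesgue_tuple m]_X \int[lebesgue_tuple m]_Y u (cons_pair (x, X)) (cons_pair (y, Y)).
  apply: (IH (fun X Y => u (cons_pair (x, X)) (cons_pair (y, Y))) X0' Y0') => //.
    by apply: mU; apply: mcons => //; exact: measurable_cst.
  move=> j X Y Xj Yj.
  have := H (lift ord0 j) (cons_pair (x, X)) (cons_pair (y, Y)).
  rewrite !tnth_cons_pairS /= Xj Yj (cons_pairE X0) (cons_pairE Y0) !tnth_cons_pairS.
  move=> /(_ erefl erefl) /le_trans; apply.
  by under eq_integral do under eq_integral do rewrite !upd_consS.
rewrite exprSr EFinM -muleA.
apply: (@le_trans _ _ ((kappa ^+ m)%:E * \int[mu]_x \int[mu]_y u (cons_pair (x, X0')) (cons_pair (y, Y0')))).
  apply: lee_wpmul2l; first by rewrite lee_fin exprn_ge0.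
  have := H ord0 X0 Y0 erefl erefl => /le_trans; apply.
  by rewrite {1}(cons_pairE X0) {1}(cons_pairE Y0);
     under eq_integral do under eq_integral do rewrite !upd_cons0.
have mq : measurable_fun [set: T * T]
    (fun p : T * T => u (cons_pair (p.1, X0')) (cons_pair (p.2, Y0'))).
  by apply: mU; apply: mcons => //; exact: measurable_cst.
rewrite -ge0_integralZl//; last 3 first.
- exact: (measurable_fun_fubini_tonelli_F (m2 := mu) _ mq).
- by move=> x _; exact: integral_ge0.
- by rewrite lee_fin exprn_ge0.
have mq4 : measurable_fun [set: T * T] (fun p : T * T =>
    \int[lebesgue_tuple m]_X \int[lebesgue_tuple m]_Y u (cons_pair (p.1, X)) (cons_pair (p.2, Y))).
  apply: (measurable_fun_fubini_tonelli_F (m2 := lebesgue_tuple m)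
      (fun q : (T * T) * m.-tuple T => \int[lebesgue_tuple m]_Y u (cons_pair (q.1.1, q.2)) (cons_pair (q.1.2, Y)))); last first.
    by move=> q; exact: integral_ge0.
  apply: (measurable_fun_fubini_tonelli_F (m2 := lebesgue_tuple m)
      (fun q : ((T * T) * m.-tuple T) * m.-tuple T => u (cons_pair (q.1.1.1, q.1.2)) (cons_pair (q.1.1.2, q.2)))) => //.
  apply: mU; apply: mcons => //.
  - by apply: (measurableT_comp measurable_fst); apply: (measurableT_comp measurable_fst).
  - exact: measurableT_comp measurable_snd measurable_fst.
  - by apply: (measurableT_comp measurable_snd); apply: (measurableT_comp measurable_fst).
apply: ge0_le_integral => //.
- by move=> x _; rewrite mule_ge0 ?lee_fin ?exprn_ge0//; exact: integral_ge0.
- apply: measurable_funeM; exact: (measurable_fun_fubini_tonelli_F (m2 := mu) _ mq).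
- apply: (measurable_fun_fubini_tonelli_F (m2 := mu) _ mq4) => p.
  by apply: integral_ge0 => ? _; exact: integral_ge0.
move=> x _; rewrite -ge0_integralZl//; last 2 first.
- by apply: mU; apply: mcons => //; exact: measurable_cst.
- by rewrite lee_fin exprn_ge0.
apply: ge0_le_integral => //.
- by move=> y _; rewrite mule_ge0 ?lee_fin ?exprn_ge0.
- by apply: measurable_funeM; apply: mU; apply: mcons => //; exact: measurable_cst.
- exact: (measurable_fun_pair2 x mq4).
Qed.

End TupleIntegral.

Section Submean.
Context {R : realType}.
Notation mu := (@lebesgue_measure R).
Notation T := (measurableTypeR R).

(** The sigma-algebra on tuples is generated by the coordinates; a set open in the coordinatewise
    sense is a countable union of boxes with rational centres and radii [1 / (k + 1)]. *)
Lemma measurable_coord_open m (A : set (m.-tuple T)) :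
  (forall t, A t -> exists2 d : R, 0 < d & forall s : m.-tuple T,
     (forall i, `|tnth s i - tnth t i : R| < d) -> A s) -> measurable A.
Proof.
move=> oA.
pose box (p : m.-tuple rat * nat) : set (m.-tuple T) :=
  [set t | forall i, `|tnth t i - ratr (tnth p.1 i) : R| < p.2.+1%:R^-1].
pose F p := if pselect (box p `<=` A) then box p else set0.
have -> : A = \bigcup_p F p.
  apply/seteqP; split => [t At|t [p _]]; last by rewrite /F; case: pselect => // sub; exact: sub.
  have [d d0 Hd] := oA t At.
  have [k kd] : exists k : nat, k.+1%:R^-1 < d / 2.
    have d20 : 0 < d / 2 by lra.
    by have [k] := ltr_add_invr d20; rewrite add0r; exists k.
  have k0 : 0 < k.+1%:R^-1 :> R by rewrite invr_gt0.
  have /choice[q Hq] : forall i, exists q : rat, `|tnth t i - ratr q : R| < k.+1%:R^-1.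
    move=> i; have /rat_in_itvoo[q] : (tnth t i : R) - k.+1%:R^-1 < (tnth t i : R) + k.+1%:R^-1.
      by rewrite ltrBlDr -addrA ltrDl addr_gt0.
    by rewrite in_itv /= => qI; exists q; rewrite ltr_distlC.
  have bt : box ([tuple q i | i < m], k) t by move=> i /=; rewrite tnth_mktuple.
  exists ([tuple q i | i < m], k) => //; rewrite /F; case: pselect => // nsub; exfalso; apply: nsub.
  move=> s bs; apply: Hd => i.
  have := bs i; have := bt i; rewrite /= => h1 h2.
  have -> : (tnth s i : R) - tnth t i = (tnth s i - ratr (tnth [tuple q i | i < m] i)) -
    (tnth t i - ratr (tnth [tuple q i | i < m] i)) by ring.
  apply: le_lt_trans (ler_normB _ _) _; apply: lt_trans (ltrD h2 h1) _.
  by rewrite (splitr d) ltrD.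
apply: countable_bigcupT_measurable; first exact: countableP.
move=> p; suff mb : measurable (box p).
  by rewrite /F; case: pselect => sub //=; exact: measurable0.
have -> : box p = \bigcap_(i in [set: 'I_m]) [set t | `|tnth t i - ratr (tnth p.1 i) : R| < p.2.+1%:R^-1].
  by apply/seteqP; split=> t bt i; [move=> _; exact: bt|exact: bt].
apply: fin_bigcap_measurable; first exact: finite_finset.
move=> i _.
have -> : [set t : m.-tuple T | `|tnth t i - ratr (tnth p.1 i) : R| < p.2.+1%:R^-1] =
  (@tnth _ T ^~ i) @^-1` `](ratr (tnth p.1 i) - p.2.+1%:R^-1)%R, (ratr (tnth p.1 i) + p.2.+1%:R^-1)%R[.
  by apply/seteqP; split => t /=; rewrite in_itv /= ltr_distl.
rewrite -[X in measurable X]setTI; exact: measurable_tnth.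
Qed.

(** * Measurability and the submean inequality on open subsets of C^n *)

Section Points.
Context {n : nat}.
Local Notation Cn := 'rV[R[i]]_n.
Local Notation pt := (@point_of_tuple R n).
Implicit Types (Omega : set Cn) (f : Cn -> R[i]) (a : Cn).

Lemma point_of_tuple_coord (t : (n + n).-tuple T) j :
  pt t 0 j = tnth t (lshift n j) +i* tnth t (rshift n j).
Proof. by rewrite /point_of_tuple !mxE. Qed.

Lemma nrm_point_lt (s t : (n + n).-tuple T) (d : R) : 0 < d ->
  (forall i, `|tnth s i - tnth t i : R| < d) -> nrm (pt s - pt t) < 2 * d.
Proof.
move=> d0 st; apply/nrm_ltP; first by rewrite mulr_gt0.
move=> j; rewrite !mxE; apply: le_lt_trans (normc_ReIm _) _ => /=.
have h1 := st (lshift n j); have h2 := st (rshift n j).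
by rewrite mulr2n mulrDl mul1r ltrD.
Qed.

Lemma measurable_point_open Omega : open Omega -> measurable (pt @^-1` Omega).
Proof.
move=> oO; apply: measurable_coord_open => t Ot.
have [e e0 He] : exists2 e : R, 0 < e & forall w, nrm (w - pt t) < e -> Omega w.
  by apply/nbhs_rVP; move: oO; rewrite openE; apply.
exists (e / 2) => [|s st]; first by rewrite divr_gt0.
apply: He; have -> : e = 2 * (e / 2) by field.
by apply: nrm_point_lt => //; rewrite divr_gt0.
Qed.

Lemma measurable_point_comp Omega (g : Cn -> R) : open Omega ->
  (forall z, Omega z -> {for z, continuous g}) ->
  measurable_fun (pt @^-1` Omega) (fun t => g (pt t)).
Proof.
move=> oO cg mO; apply: (measurability _ (RGenOInfty.measurableE R)) => //.
move=> /= _ [_ [x ->] <-].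
have -> : pt @^-1` Omega `&` (fun t => g (pt t)) @^-1` `]x, +oo[ =
    pt @^-1` (Omega `&` [set z | x < g z]).
  by apply/seteqP; split => t /=; rewrite in_itv /= andbT.
apply: measurable_point_open.
rewrite openE => z [Oz xz]; apply: filterI; first by move: oO; rewrite openE; apply.
have := cg z Oz => /(_ [set y | x < y]); apply.
by apply: open_nbhs_nbhs; split => //; exact: open_gt.
Qed.

Lemma differentiable_normc_continuous f z : differentiable f z ->
  {for z, continuous (fun w => normc (f w))}.
Proof.
move=> /differentiable_continuous df.
by apply: (@continuous_comp _ _ _ f (@normc R)) => //; exact: continuous_normc.
Qed.

Lemma measurable_cube m (t0 : m.-tuple T) (r : R) :
  measurable [set t : m.-tuple T | forall i, `|tnth t i - tnth t0 i : R| <= r].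
Proof.
rewrite -[X in measurable X]setCK; apply: measurableC; apply: measurable_coord_open => t.
move=> /existsNP[i /negP]; rewrite -ltNge => ri.
exists (`|tnth t i - tnth t0 i : R| - r) => [|s st]; first by rewrite subr_gt0.
apply/existsNP; exists i; apply/negP; rewrite -ltNge.
have := st i; rewrite ltrBrDr => h.
have : `|tnth t i - tnth t0 i : R| <= `|tnth s i - tnth t i : R| + `|tnth s i - tnth t0 i : R|.
  have -> : (tnth t i : R) - tnth t0 i = (tnth s i - tnth t0 i) - (tnth s i - tnth t i) by ring.
  by rewrite [leRHS]addrC; exact: ler_normB.
by move=> /(lt_le_trans h); rewrite ltrD2l.
Qed.

(** [square_submean] in each complex coordinate, iterated with the factor [r ^ 2 / 4]. [U] is [|f|]
    cut off to the closed real cube of half side [r]; a point of the cube stays in it when one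
    coordinate pair moves within [r] of the centre. The condition [r < rho / 2] is there because
    real coordinates below [rho / 2] bound the complex ones by [rho]. *)
Lemma submean f a (rho r : R) Omega : 0 < r < rho / 2 -> open Omega ->
  (forall z, nrm (z - a) < rho -> Omega z) -> holomorphic_on Omega f ->
  (((r ^+ 2 / 4) ^+ n * normc (f a))%:E <=
   \int[lebesgue_tuple (n + n)]_(t in pt @^-1` Omega) (normc (f (pt t)))%:E)%E.
Proof.
move=> /andP[r0 rr] oO aO hf.
pose X0 : n.-tuple T := [tuple complex.Re (a 0 j) | j < n].
pose Y0 : n.-tuple T := [tuple complex.Im (a 0 j) | j < n].
pose t0 : (n + n).-tuple T := [tuple of X0 ++ Y0].
pose C := [set t : (n + n).-tuple T | forall i, `|tnth t i - tnth t0 i : R| <= r].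
have mC : measurable C by exact: measurable_cube.
have mO := measurable_point_open oO.
have pt0 : pt t0 = a.
  apply/rowP => j; rewrite point_of_tuple_coord tnth_lshift tnth_rshift !tnth_mktuple.
  by case: (a 0 j).
have CO t : C t -> nrm (pt t - a) < rho.
  move=> Ct; rewrite -pt0; have -> : rho = 2 * (rho / 2) by field.
  by apply: nrm_point_lt => [|i]; [lra|exact: le_lt_trans (Ct i) rr].
have mf : measurable_fun (pt @^-1` Omega) (fun t => (normc (f (pt t)))%:E).
  apply/measurable_EFinP; apply: (measurable_point_comp (g := fun z => normc (f z))) => // z Oz.
  by apply: differentiable_normc_continuous; exact: hf.
have CsubO : C `<=` pt @^-1` Omega by move=> t /CO; exact: aO.
pose U := (fun t => (normc (f (pt t)))%:E) \_ C.
have mU : measurable_fun [set: (n + n).-tuple T] U.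
  have mfC := measurable_funS mO CsubO mf.
  exact: (measurable_restrictT _ mC).1 mfC.
have U0 t : (0 <= U t)%E.
  by rewrite /U patchE; case: ifP => // _; rewrite lee_fin normc_ge0.
have UC t : C t -> U t = (normc (f (pt t)))%:E by move=> Ct; rewrite /U patchE mem_set.
have UnC t : ~ C t -> U t = 0%E by move=> Ct; rewrite /U patchE memNset.
apply: (@le_trans _ _ (\int[lebesgue_tuple (n + n)]_t U t)%E); last first.
  rewrite -integral_mkcond; apply: ge0_subset_integral => //.
  by move=> t _; rewrite lee_fin normc_ge0.
rewrite ge0_integral_cat//.
have Ct0 : C t0 by move=> i; rewrite subrr normr0 ltW.
have -> : (((r ^+ 2 / 4) ^+ n * normc (f a))%:E = ((r ^+ 2 / 4) ^+ n)%:E * U [tuple of X0 ++ Y0])%E.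
  by rewrite UC// pt0 EFinM.
apply: (@submean_iter R n (r ^+ 2 / 4) (fun X Y => U [tuple of X ++ Y])).
- by rewrite divr_ge0// sqr_ge0.
- exact: measurableT_comp mU (@measurable_cat R n n).
- by move=> X Y; exact: U0.
move=> j X Y Xj Yj.
(* Outside the cube the left-hand side vanishes. *)
have [CXY|nC] := pselect (C [tuple of X ++ Y]); last first.
  by rewrite UnC// mule0; apply: integral_ge0 => x _; exact: integral_ge0.
pose z0 := pt [tuple of X ++ Y].
pose c := a 0 j.
(* The [j]-th coordinate of [z0] is still that of the centre, so [z1] has [j]-th coordinate 0 and
   [w] in [z1 + w *: delta_mx 0 j] is the coordinate itself. *)
pose z1 := z0 - c *: delta_mx 0 j.
have tz x y : pt [tuple of upd X j x ++ upd Y j y] = z1 + (x +i* y) *: delta_mx 0 j.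
  apply/rowP => k; rewrite point_of_tuple_coord tnth_lshift tnth_rshift !tnth_mktuple.
  rewrite /z1 /z0 !mxE tnth_lshift tnth_rshift eqxx /=.
  have [->|kj] := eqVneq k j; last by rewrite !mulr0 subr0 addr0.
  rewrite !mulr1 Xj Yj !tnth_mktuple /c; case: (a 0 j) => p q /=.
  by rewrite subrr add0r.
have C1 x y : `|x - complex.Re c| <= r -> `|y - complex.Im c| <= r ->
    C [tuple of upd X j x ++ upd Y j y].
  move=> hx hy i; have := CXY i; rewrite /t0 -(splitK i).
  case: (fintype.split i) => k /=; rewrite ?tnth_lshift ?tnth_rshift !tnth_mktuple.
    by have [->|] := eqVneq k j.
  by have [->|] := eqVneq k j.
pose g w := f (z1 + w *: delta_mx 0 j).
have gd z : `|complex.Re z| < rho / 2 -> `|complex.Im z| < rho / 2 -> derivable g (c + z) 1.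
  move=> h1 h2; apply: differentiable_line; apply: hf; apply: aO.
  have -> : c + z = (complex.Re (c + z)) +i* (complex.Im (c + z)) by case: (c + z).
  rewrite -tz -pt0; have -> : rho = 2 * (rho / 2) by field.
  apply: nrm_point_lt => [|i]; first by lra.
  have := le_lt_trans (CXY i) rr; rewrite /t0 -(splitK i).
  case: (fintype.split i) => k /=; rewrite ?tnth_lshift ?tnth_rshift !tnth_mktuple.
    have [-> _|//] := eqVneq k j; rewrite -/c raddfD /= addrAC subrr add0r//.
  have [-> _|//] := eqVneq k j; rewrite -/c raddfD /= addrAC subrr add0r//.
have rr' : 0 < r < rho / 2 by rewrite r0.
have mPhi : measurable_fun [set: T * T]
    (fun p : T * T => U [tuple of upd X j p.1 ++ upd Y j p.2]).
  have mupd (Z : n.-tuple T) : measurable_fun [set: T] (upd Z j).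
    apply/measurable_fun_tnthP => i; rewrite /upd.
    have [ij|ij] := eqVneq i j.
      rewrite (_ : _ \o _ = id)//; apply/funext => x /=; rewrite tnth_mktuple ij eqxx//.
    rewrite (_ : _ \o _ = cst (tnth Z i))//; apply/funext => x /=.
    by rewrite tnth_mktuple (negbTE ij).
  have mp := measurable_fun_pair (measurableT_comp (mupd X) (@measurable_fst _ _ T T))
    (measurableT_comp (mupd Y) (@measurable_snd _ _ T T)).
  exact: (measurableT_comp mU (measurableT_comp (@measurable_cat R n n) mp)).
have := @square_submean R g c r (rho / 2) _ rr' gd mPhi (fun p => U0 _).
have gc : U [tuple of X ++ Y] = (normc (g c))%:E.
  by rewrite UC// /g /z1 subrK.
rewrite gc => H.
have {}H : ((r ^+ 2 * normc (g c))%:E <= 4%:E * \int[mu]_x \int[mu]_y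
    U [tuple of upd X j x ++ upd Y j y])%E.
  apply: H => x y hx hy /=; rewrite UC.
    by rewrite tz /g; congr (normc (f (_ + _ *: _)))%:E; case: (c).
  by apply: C1; rewrite addrC addKr.
have -> : ((r ^+ 2 / 4)%:E * (normc (g c))%:E = (4^-1)%:E * (r ^+ 2 * normc (g c))%:E)%E.
  by rewrite -!EFinM; congr EFin; ring.
apply: le_trans (lee_wpmul2l _ H) _; first by rewrite lee_fin.
by rewrite muleA -EFinM mulVf// mul1e.
Qed.

Lemma volume_box m (B : R) :
  (lebesgue_tuple m [set t : m.-tuple T | forall i, (`|tnth t i| <= B)%R] < +oo)%E.
Proof.
elim: m => [|m IH].
  by rewrite /= diracE; case: (_ \in _); rewrite ltry.
rewrite /= /lebesgue_cons /pushforward.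
have -> : @cons_pair R m @^-1` [set t | forall i, (`|tnth t i| <= B)%R] =
    `[(- B)%R, B] `*` [set t : m.-tuple T | forall i, (`|tnth t i| <= B)%R].
  apply/seteqP; split => [[x t] /= H|[x t] /= [xB H] i].
    split; first by have := H ord0; rewrite tnth_cons_pair0 /= in_itv /= ler_norml.
    by move=> i; have := H (lift ord0 i); rewrite tnth_cons_pairS.
  case: (unliftP ord0 i) => [j|] ->; first by rewrite tnth_cons_pairS.
  by rewrite tnth_cons_pair0 /=; move: xB; rewrite in_itv /= ler_norml.
rewrite product_measure1E//; last first.
  have := @measurable_cube m [tuple (0 : R) | i < m] B.
  congr (measurable _); apply/seteqP; split => t H i; have := H i; by rewrite tnth_mktuple subr0.
rewrite lte_mul_pinfty//.
  have := @lebesgue_measure_itv R `[(- B)%R, B].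
  case: ifP => _ E; first by have : mu `[- B, B]%classic \is a fin_num by rewrite E.
  by have : mu `[- B, B]%classic \is a fin_num by rewrite E.
Qed.

End Points.
End Submean.

(** * The Bergman space *)

Lemma cvg_bigsum (R : realType) (T : Type) (F : set_system T) (FF : Filter F)
    (I : finType) (f : I -> T -> R) (l : I -> R) :
  (forall i, f i @ F --> l i) -> (fun t => \sum_i f i t) @ F --> \sum_i l i.
Proof.
move=> fl; elim: (index_enum I) => [|i s IH].
  under eq_fun do rewrite big_nil.
  by rewrite big_nil; exact: cvg_cst.
under eq_fun do rewrite big_cons.
by rewrite big_cons; exact: (cvgD (fl i) IH).
Qed.

Section Bergman.
Context {R : realType} {n : nat}.
Local Notation Cn := 'rV[R[i]]_n.
Local Notation pt := (@point_of_tuple R n).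
Variable Omega : set Cn.
Hypothesis openO : open Omega.
Hypothesis nonemptyO : Omega !=set0.
Hypothesis volO : (volume Omega < +oo)%E.
Implicit Types (f k : Cn -> R[i]) (g h : Cn -> R) (a z : Cn).
Local Notation L := (lebesgue_tuple (n + n)).

Definition intg g := L.-integrable (pt @^-1` Omega) (fun t => (g (pt t))%:E).
Definition mI g : R := fine (mean_int Omega g).
Definition contO g := forall z, Omega z -> {for z, continuous g}.

Let mO : measurable (pt @^-1` Omega) := measurable_point_open openO.

Lemma ball_in a : Omega a -> exists2 rho : R, 0 < rho & forall z, nrm (z - a) < rho -> Omega z.
Proof. by move=> Oa; apply/nbhs_rVP; move: openO; rewrite openE; apply. Qed.

Lemma holomorphic_cst c : holomorphic_on Omega (fun=> c).
Proof. by move=> z _; exact: (@differentiable_cst R[i] Cn R[i] c z). Qed.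

(** The submean inequality for the constant function 1. *)
Lemma volume_gt0 : (0 < volume Omega)%E.
Proof.
have [a Oa] := nonemptyO; have [rho rho0 Hr] := ball_in Oa.
have r1 : 0 < rho / 4 < rho / 2 by lra.
have := submean r1 openO Hr (@holomorphic_cst 1).
have -> : normc (1 : R[i]) = 1 by rewrite (normc_nat 1).
rewrite integral_cst// mul1e mulr1; apply: lt_le_trans.
by rewrite lte_fin exprn_gt0// divr_gt0// exprn_gt0//; lra.
Qed.

Let V := fine (volume Omega).

Let VE : volume Omega = V%:E.
Proof. by rewrite fineK// ge0_fin_numE// ltW// volume_gt0. Qed.

Let V0 : 0 < V.
Proof. by rewrite -lte_fin -VE volume_gt0. Qed.

Lemma mean_intE g : intg g -> mean_int Omega g = (mI g)%:E.
Proof.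
by move=> ig; rewrite /mI fineK// /mean_int fin_numM//; exact: integrable_fin_num ig.
Qed.

Lemma eq_mean_int g h : (forall z, Omega z -> g z = h z) -> mean_int Omega g = mean_int Omega h.
Proof.
move=> gh; rewrite /mean_int; congr (_ * _)%E; apply: eq_integral => t; rewrite inE => Ot.
by rewrite gh.
Qed.

Lemma eq_mI g h : (forall z, Omega z -> g z = h z) -> mI g = mI h.
Proof. by move=> gh; rewrite /mI (eq_mean_int gh). Qed.

Lemma eq_intg g h : (forall z, Omega z -> g z = h z) -> intg g -> intg h.
Proof.
move=> gh; apply: eq_integrable => // t; rewrite inE => Ot.
by rewrite gh.
Qed.

Lemma intg_lin c g h : intg g -> intg h -> intg (fun z => c * g z + h z).
Proof.
move=> ig ih.
have ic : L.-integrable (pt @^-1` Omega) (fun t => c%:E * (g (pt t))%:E)%E by exact: integrableZl.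
by have := integrableD mO ic ih; apply: eq_integrable.
Qed.

Lemma mI_lin c g h : intg g -> intg h -> mI (fun z => c * g z + h z) = c * mI g + mI h.
Proof.
move=> ig ih; apply: EFin_inj.
have ic : L.-integrable (pt @^-1` Omega) (fun t => c%:E * (g (pt t))%:E)%E by exact: integrableZl.
rewrite -mean_intE; last exact: intg_lin.
rewrite EFinD EFinM -!mean_intE// /mean_int.
rewrite (eq_integral (fun t => c%:E * (g (pt t))%:E + (h (pt t))%:E)%E)//.
rewrite (integralD mO ic ih) integralZl//.
have fg := integrable_fin_num mO ig; have fh := integrable_fin_num mO ih.
by rewrite -(fineK fg) -(fineK fh) -!(EFinM, EFinD); congr EFin; ring.
Qed.

Lemma intgD g h : intg g -> intg h -> intg (fun z => g z + h z).
Proof. by move=> ig ih; apply: eq_intg (intg_lin 1 ig ih) => z _; rewrite mul1r. Qed.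

Lemma mID g h : intg g -> intg h -> mI (fun z => g z + h z) = mI g + mI h.
Proof.
by move=> ig ih; rewrite -[mI g]mul1r -mI_lin//; apply: eq_mI => z _; rewrite mul1r.
Qed.

Lemma intg0 : intg (fun=> 0).
Proof. exact: integrable0. Qed.

Lemma mI0 : mI (fun=> 0) = 0.
Proof. by have := mI_lin (-1) intg0 intg0; rewrite mulr0 addr0; lra. Qed.

Lemma intgZ c g : intg g -> intg (fun z => c * g z).
Proof. by move=> ig; apply: eq_intg (intg_lin c ig intg0) => z _; rewrite addr0. Qed.

Lemma mIZ c g : intg g -> mI (fun z => c * g z) = c * mI g.
Proof.
move=> ig; rewrite -[RHS]addr0 -mI0 -mI_lin//; last exact: intg0.
by apply: eq_mI => z _; rewrite addr0.
Qed.

Lemma mIB g h : intg g -> intg h -> mI (fun z => g z - h z) = mI g - mI h.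
Proof.
move=> ig ih; have -> : mI g - mI h = - 1 * mI h + mI g by ring.
by rewrite -mI_lin//; apply: eq_mI => z _; ring.
Qed.

Lemma mean_int_ge0 g : (forall z, Omega z -> 0 <= g z) -> (0 <= mean_int Omega g)%E.
Proof.
move=> g0; rewrite /mean_int mule_ge0//; first by rewrite lee_fin invr_ge0 ltW.
by apply: integral_ge0 => t Ot; rewrite lee_fin g0.
Qed.

Lemma mI_ge0 g : (forall z, Omega z -> 0 <= g z) -> 0 <= mI g.
Proof. by move=> g0; apply: fine_ge0; exact: mean_int_ge0. Qed.

Lemma mI_le g h : intg g -> intg h -> (forall z, Omega z -> g z <= h z) -> mI g <= mI h.
Proof.
move=> ig ih gh; rewrite -subr_ge0 -mIB//; apply: mI_ge0 => z Oz.
by rewrite subr_ge0 gh.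
Qed.

Lemma contO_measurable g : contO g ->
  measurable_fun (pt @^-1` Omega) (fun t => (g (pt t))%:E).
Proof. by move=> cg; apply/measurable_EFinP; exact: measurable_point_comp. Qed.

Lemma intg_dom g h : contO g -> (forall z, Omega z -> `|g z| <= h z) -> intg h -> intg g.
Proof.
move=> cg gh; apply: le_integrable => //; first exact: contO_measurable.
move=> t Ot /=; rewrite lee_fin; apply: le_trans (gh _ Ot) _; exact: ler_norm.
Qed.

Lemma mean_int_lty g : contO g -> (forall z, Omega z -> 0 <= g z) ->
  (mean_int Omega g < +oo)%E -> intg g.
Proof.
move=> cg g0 gy; apply/integrableP; split; first exact: contO_measurable.
rewrite (eq_integral (fun t => (g (pt t))%:E)); last first.
  by move=> t; rewrite inE => Ot /=; rewrite ger0_norm// g0.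
move: gy; rewrite /mean_int -/V; have Vi : 0 < V^-1 by rewrite invr_gt0.
have : (0 <= \int[L]_(t in pt @^-1` Omega) (g (pt t))%:E)%E.
  by apply: integral_ge0 => t Ot; rewrite lee_fin g0.
case: (\int[L]_(t in _) _)%E => [r _ _|_|//]; first by rewrite ltry.
by rewrite mulry gtr0_sg// mul1e ltxx.
Qed.

Lemma intg_cst c : intg (fun=> c).
Proof.
apply/integrableP; split; first exact: measurable_cst.
rewrite integral_cst//= -/(volume Omega) VE -EFinM; exact: ltry.
Qed.

Lemma mI_cst c : mI (fun=> c) = c.
Proof.
apply: EFin_inj; rewrite -mean_intE; last exact: intg_cst.
rewrite /mean_int integral_cst//= -/(volume Omega) VE -!EFinM -/V; congr EFin.
by rewrite /= mulrCA mulVf ?mulr1// gt_eqF.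
Qed.

Lemma intg_sum (I : finType) (G : I -> Cn -> R) : (forall i, intg (G i)) ->
  intg (fun z => \sum_i G i z) /\ mI (fun z => \sum_i G i z) = \sum_i mI (G i).
Proof.
move=> iG; elim: (index_enum I) => [|i s [IH1 IH2]].
  split; first by apply: eq_intg intg0 => z _; rewrite big_nil.
  by rewrite [RHS]big_nil -[RHS]mI0; apply: eq_mI => z _; rewrite big_nil.
have E z : \sum_(j <- i :: s) G j z = G i z + \sum_(j <- s) G j z by rewrite big_cons.
split; first by apply: eq_intg (intgD (iG i) IH1) => z _; rewrite E.
by rewrite big_cons -IH2 -mID//; apply: eq_mI => z _; rewrite E.
Qed.

Lemma fatou_mI (u : nat -> Cn -> R) (w : Cn -> R) (c : R) :
  (forall j, contO (u j)) -> (forall j z, Omega z -> 0 <= u j z) -> contO w ->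
  (forall z, Omega z -> u ^~ z @ \oo --> w z) ->
  (forall j, intg (u j)) -> (forall e, 0 < e -> exists N, forall j, (N <= j)%N -> mI (u j) <= c + e) ->
  intg w /\ mI w <= c.
Proof.
move=> cu u0 cw uw iu uc.
have w0 z : Omega z -> 0 <= w z.
  move=> Oz; rewrite -(cvg_lim (@Rhausdorff R) (uw z Oz)); apply: limr_ge.
    by apply/cvg_ex; exists (w z); exact: uw.
  by apply: nearW => j; exact: u0.
have B e : 0 < e -> (mean_int Omega w <= (c + e)%:E)%E.
  move=> e0; have [N HN] := uc e e0.
  (* Dropping [N] terms does not change the limit and makes the bound [c + e] valid for every
     term. *)
  have F := @fatou _ _ _ L _ mO (fun j t => (u (j + N)%N (pt t))%:E)
    (fun j => contO_measurable (cu (j + N)%N)) (fun j t Ot => u0 (j + N)%N _ Ot).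
  rewrite /mean_int.
  rewrite (eq_integral (fun t => limn_einf (fun j => (u (j + N)%N (pt t))%:E))); last first.
    move=> t; rewrite inE => Ot; rewrite is_cvg_limn_einfE.
      apply/esym/cvg_lim => //; apply: cvg_EFin; first exact: nearW.
      by have := uw _ Ot; rewrite -(cvg_shiftn N).
    apply/cvg_ex; exists (w (pt t))%:E; apply: cvg_EFin; first exact: nearW.
    by have := uw _ Ot; rewrite -(cvg_shiftn N).
  have Vi : 0 <= V^-1 by rewrite invr_ge0 ltW.
  apply: le_trans (lee_wpmul2l _ F) _; first by rewrite lee_fin.
  have -> : ((c + e)%:E = (V^-1)%:E * (V * (c + e))%:E)%E.
    by rewrite -EFinM mulKf// gt_eqF.
  apply: lee_wpmul2l; first by rewrite lee_fin.
  rewrite limn_einf_lim; apply: lime_le; first exact: is_cvg_einfs.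
  apply: nearW => j; apply: (@le_trans _ _ (\int[L]_(t in pt @^-1` Omega) (u (j + N)%N (pt t))%:E)%E).
    by apply: ereal_inf_lbound; exists j => //=.
  have := HN _ (leq_addl j N); rewrite -lee_fin -mean_intE// /mean_int -/V.
  have fu := integrable_fin_num mO (iu (j + N)%N).
  by rewrite -(fineK fu) -EFinM !lee_fin => H; rewrite -ler_pdivrMl.
have iw : intg w.
  by apply: mean_int_lty => //; apply: le_lt_trans (B 1 ltr01) _; rewrite ltry.
split=> //; apply/ler_addgt0Pr => e e0.
by rewrite -lee_fin -mean_intE//; exact: B.
Qed.

Definition sqn f z : R := normc (f z) ^+ 2.
Definition N2 f : R := mI (sqn f).

Lemma sqn_ge0 f z : 0 <= sqn f z.
Proof. exact: sqr_ge0. Qed.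

Lemma N2_ge0 f : 0 <= N2 f.
Proof. by apply: mI_ge0 => z _; exact: sqn_ge0. Qed.

Lemma contO_normc f : holomorphic_on Omega f -> contO (fun z => normc (f z)).
Proof. by move=> hf z Oz; apply: differentiable_normc_continuous; exact: hf. Qed.

Lemma contO_mul g h : contO g -> contO h -> contO (fun z => g z * h z).
Proof. by move=> cg ch z Oz; have := continuousM (cg z Oz) (ch z Oz). Qed.

Lemma contO_sqn f : holomorphic_on Omega f -> contO (sqn f).
Proof. by move=> hf; exact: (contO_mul (contO_normc hf) (contO_normc hf)). Qed.

Lemma A2P f : A2 Omega f <-> holomorphic_on Omega f /\ intg (sqn f).
Proof.
split=> -[hf i2]; split=> //.
  by apply: mean_int_lty => // [|z _]; [exact: contO_sqn|exact: sqn_ge0].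
by rewrite mean_intE// ltry.
Qed.

Lemma holomorphic_lin c f k : holomorphic_on Omega f -> holomorphic_on Omega k ->
  holomorphic_on Omega (fun z => c * f z + k z).
Proof.
move=> hf hk z Oz.
exact: (differentiableD (differentiableZ c (hf z Oz)) (hk z Oz)).
Qed.

Lemma holomorphic_mul f k : holomorphic_on Omega f -> holomorphic_on Omega k ->
  holomorphic_on Omega (fun z => f z * k z).
Proof. by move=> hf hk z Oz; exact: (differentiableM (hf z Oz) (hk z Oz)). Qed.

Lemma sqnD_le (x y : R[i]) : normc (x + y) ^+ 2 <= 2 * normc x ^+ 2 + 2 * normc y ^+ 2.
Proof.
apply: (@le_trans _ _ ((normc x + normc y) ^+ 2)).
  by rewrite ler_sqr ?nnegrE ?addr_ge0 ?normc_ge0 ?normcD.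
by have := sqr_ge0 (normc x - normc y); nra.
Qed.

Lemma A2_lin c f k : A2 Omega f -> A2 Omega k -> A2 Omega (fun z => c * f z + k z).
Proof.
move=> /A2P[hf fi] /A2P[hk ki]; apply/A2P; have h := holomorphic_lin c hf hk; split=> //.
apply: (intg_dom (contO_sqn h) _ (intg_lin (2 * normc c ^+ 2) fi (intgZ 2 ki))) => z _.
rewrite ger0_norm ?sqn_ge0//; apply: le_trans (sqnD_le _ _) _.
by rewrite ComplexField.Normc.normcM exprMn mulrA /sqn.
Qed.

Lemma A2_cst c : A2 Omega (fun=> c).
Proof. by apply/A2P; split; [exact: holomorphic_cst|exact: intg_cst]. Qed.

Lemma A2Z c f : A2 Omega f -> A2 Omega (fun z => c * f z).
Proof.
move=> fA; have := A2_lin c fA (A2_cst 0).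
by under eq_fun do rewrite addr0.
Qed.

Lemma A2B f k : A2 Omega f -> A2 Omega k -> A2 Omega (fun z => f z - k z).
Proof.
move=> fA kA; have := A2_lin (- 1) kA fA.
by under eq_fun do rewrite mulN1r addrC.
Qed.

(** The integrand of the real inner product: [mI (cip f k)] is the real part of the inner product of
    [f] and [k]. *)
Definition cip f k z : R := complex.Re (f z * conjc (k z)).

Lemma contO_cip f k : holomorphic_on Omega f -> holomorphic_on Omega k -> contO (cip f k).
Proof.
move=> hf hk z Oz.
apply: (@continuous_comp _ _ _ (fun z => f z * conjc (k z)) (@complex.Re R)).
  apply: continuous_mulc; first exact: differentiable_continuous (hf z Oz).
  apply: (@continuous_comp _ _ _ k (@conjc R)); first exact: differentiable_continuous (hk z Oz).
  exact: continuous_conjc.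
exact: continuous_Re.
Qed.

Lemma intg_cip f k : A2 Omega f -> A2 Omega k -> intg (cip f k).
Proof.
move=> /A2P[hf fi] /A2P[hk ki].
apply: (intg_dom (contO_cip hf hk) _ (intgD fi ki)) => z _.
apply: le_trans (Re_normc _) _; rewrite ComplexField.Normc.normcM normcC /sqn.
by have := sqr_ge0 (normc (f z) - normc (k z)); have := normc_ge0 (f z);
  have := normc_ge0 (k z); nra.
Qed.

Lemma sqn_lin (t : R) f k z :
  sqn (fun z => t%:C * k z + f z) z = t ^+ 2 * sqn k z + (2 * t * cip k f z + sqn f z).
Proof.
by rewrite /sqn /cip !normc_sq; case: (f z) => x y; case: (k z) => p q /=; ring.
Qed.

Lemma N2_lin (t : R) f k : A2 Omega f -> A2 Omega k ->
  N2 (fun z => t%:C * k z + f z) = t ^+ 2 * N2 k + (2 * t * mI (cip k f) + N2 f).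
Proof.
move=> fA kA; have [_ fi] := (A2P f).1 fA; have [_ ki] := (A2P k).1 kA.
have ci := intg_cip kA fA.
rewrite -mI_lin// -mI_lin//; last exact: intg_lin.
by apply: eq_mI => z _; exact: sqn_lin.
Qed.

Lemma parallelogram f k : A2 Omega f -> A2 Omega k ->
  N2 (fun z => f z - k z) = 2 * N2 f + 2 * N2 k - 4 * N2 (fun z => (f z + k z) / 2).
Proof.
move=> fA kA.
have -> : N2 (fun z => f z - k z) = N2 (fun z => (- 1 : R)%:C * k z + f z).
  by apply: eq_mI => z _; rewrite /sqn rmorphN1 mulN1r addrC.
have -> : N2 (fun z => (f z + k z) / 2) = 4^-1 * N2 (fun z => (1 : R)%:C * k z + f z).
  rewrite -mIZ; last by have /A2P[] := A2_lin 1%:C kA fA.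
  apply: eq_mI => z _; rewrite /sqn ComplexField.Normc.normcM exprMn mulrC mul1r addrC.
  congr (_ * _); rewrite ComplexField.Normc.normcV (normc_nat 2).
  by field.
by rewrite !N2_lin//; lra.
Qed.

(** The submean inequality for [f * f], on balls of radius [rho / 2] about the points [z]. The
    constant [K] is the same for all [z] near [a], which turns convergence in norm into locally
    uniform convergence. *)
Lemma eval_bound a : Omega a -> exists2 rho : R, 0 < rho & exists2 K : R, 0 <= K &
  forall z, nrm (z - a) < rho -> Omega z /\
    forall f, A2 Omega f -> sqn f z <= K * N2 f.
Proof.
move=> Oa; have [rho rho0 Hr] := ball_in Oa.
pose r := rho / 8; pose kap := (r ^+ 2 / 4) ^+ n.
have k0 : 0 < kap by rewrite exprn_gt0// divr_gt0// exprn_gt0// divr_gt0.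
exists (rho / 2); first by rewrite divr_gt0.
exists (V / kap) => [|z zr]; first by rewrite divr_ge0 ?ltW.
split; first by apply: Hr; lra.
move=> f /A2P[hf fi].
have r1 : 0 < r < (rho / 2) / 2 by rewrite /r; lra.
have zO w : nrm (w - z) < rho / 2 -> Omega w.
  move=> wz; apply: Hr; have -> : w - a = (w - z) + (z - a) by rewrite addrA subrK.
  by apply: le_lt_trans (nrmD _ _) _; lra.
have := submean r1 openO zO (holomorphic_mul hf hf).
under eq_integral do rewrite ComplexField.Normc.normcM.
rewrite ComplexField.Normc.normcM -/kap => H.
have Ef := mean_intE fi.
have fu := integrable_fin_num mO fi.
have {}H : ((kap * sqn f z)%:E <= \int[L]_(t in pt @^-1` Omega) (sqn f (pt t))%:E)%E by exact: H.
move: Ef H; rewrite /mean_int -/V -(fineK fu) -EFinM lee_fin -/(N2 f) => -[] <- H.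
by rewrite mulrAC ler_pdivlMr// mulVKf ?gt_eqF// mulrC.
Qed.

(** * Limits of almost minimal elements of decreasing convex sets *)

Section NestedLimit.
Variables (N : nat).
Implicit Types (F : 'I_N -> Cn -> R[i]).

Definition G2 F : R := \sum_l N2 (F l).

Lemma G2_ge0 F : 0 <= G2 F.
Proof. by apply: sumr_ge0 => l _; exact: N2_ge0. Qed.

(** The infima [m j] of [G2] on [S j] increase to [ms], and the midpoint of two late almost minimal
    elements lies in a set whose infimum is close to [ms]. [eval_bound] and [weierstrass] give a
    holomorphic limit, and Fatou's lemma gives [G2 f <= ms], hence the last clause. The sets are not
    assumed closed, so [f] is not claimed to lie in them: the pointwise convergence lets each
    application pass its own constraints to the limit. *)
Lemma nested_limit (S : nat -> set ('I_N -> Cn -> R[i])) (B : R) :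
  (forall j F, S j F -> forall l, A2 Omega (F l)) ->
  (forall j F F', S j F -> S j F' -> S j (fun l z => (F l z + F' l z) / 2)) ->
  (forall j, S j.+1 `<=` S j) -> (forall j, exists2 F, S j F & G2 F <= B) ->
  exists (F : nat -> 'I_N -> Cn -> R[i]) (f : 'I_N -> Cn -> R[i]),
    [/\ forall j, S j (F j), forall l, A2 Omega (f l),
    forall l z, Omega z -> tends (fun j => F j l z) (f l z) &
    forall F', (forall j, S j F') -> G2 f <= G2 F'].
Proof.
move=> SA Smid Sdec Sne.
have Sle i j : (i <= j)%N -> S j `<=` S i.
  by move=> /subnK <-; elim: (j - i)%N => // k IH; exact: subset_trans (Sdec _) IH.
pose m j := inf [set G2 F | F in S j].
have minf j : has_inf [set G2 F | F in S j].
  split; first by have [F SF _] := Sne j; exists (G2 F), F.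
  by exists 0 => _ [F _ <-]; exact: G2_ge0.
have mle j F : S j F -> m j <= G2 F.
  by move=> SF; apply: ge_inf; [have [] := minf j|exists F].
have mB j : m j <= B by have [F SF FB] := Sne j; exact: le_trans (mle _ _ SF) FB.
have mmon i j : (i <= j)%N -> m i <= m j.
  move=> ij; apply: lb_le_inf; first by have [] := minf j.
  by move=> _ [F SF <-]; apply: mle; exact: Sle SF.
pose ms := sup (range m).
have msup : has_sup (range m).
  by split; [exists (m 0%N), 0%N|exists B => _ [j _ <-]].
have m_ms j : m j <= ms by apply: ub_le_sup; [have [] := msup|exists j].
have /choice[F HF] : forall j, exists F, S j F /\ G2 F < m j + j.+1%:R^-1.
  move=> j; have j0 : 0 < j.+1%:R^-1 :> R by rewrite invr_gt0.
  have [_ [F SF <-] H] := inf_adherent j0 (minf j).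
  by exists F.
have small e : 0 < e -> exists i, ms - e < m i /\ i.+1%:R^-1 < e.
  move=> e0; have [_ [i _ <-] Hi] := sup_adherent e0 msup.
  have [j] := ltr_add_invr e0; rewrite add0r => je.
  exists (maxn i j); split; first by apply: lt_le_trans Hi (mmon _ _ (leq_maxl _ _)).
  apply: le_lt_trans je; rewrite lef_pV2 ?posrE// ler_nat ltnS; exact: leq_maxr.
have FA j l : A2 Omega (F j l) by have [SF _] := HF j; exact: SA SF l.
have cau e : 0 < e -> exists i, forall (j k : nat), (i <= j)%N -> (i <= k)%N ->
    G2 (fun l z => F j l z - F k l z) <= e.
  (* [G2 (F j)] and [G2 (F k)] are below [ms + e / 8] and the midpoint has [G2] above [ms - e / 8],
     so the parallelogram identity gives at most [4 (ms + e / 8) - 4 (ms - e / 8) = e]. *)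
  move=> e0; have e80 : 0 < e / 8 by lra.
  have [i [i1 i2]] := small _ e80; exists i => j k ij ik.
  have [SFj Fj] := HF j; have [SFk Fk] := HF k.
  have -> : G2 (fun l z => F j l z - F k l z) = 2 * G2 (F j) + 2 * G2 (F k) -
      4 * G2 (fun l z => (F j l z + F k l z) / 2).
    rewrite /G2 !mulr_sumr -big_split /= -sumrB; apply: eq_bigr => l _.
    by rewrite parallelogram.
  have := mle i _ (Smid i _ _ (Sle _ _ ij _ SFj) (Sle _ _ ik _ SFk)).
  have inv_le p : (i <= p)%N -> p.+1%:R^-1 <= i.+1%:R^-1 :> R.
    by move=> ip; rewrite lef_pV2 ?posrE// ler_nat ltnS.
  have := m_ms j; have := m_ms k.
  move: (inv_le j ij) (inv_le k ik) Fj Fk i2.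
  set dj := j.+1%:R^-1; set dk := k.+1%:R^-1; set di := i.+1%:R^-1.
  lra.
have N2_le F' l : N2 (F' l) <= G2 F'.
  by rewrite /G2 (bigD1 l)//= lerDl; apply: sumr_ge0 => p _; exact: N2_ge0.
have unif l a : Omega a -> exists2 rho : R, 0 < rho & forall e : R, 0 < e -> exists i,
    forall (j k : nat), (i <= j)%N -> (i <= k)%N -> forall z, nrm (z - a) < rho ->
    normc (F j l z - F k l z) <= e.
  move=> Oa; have [rho rho0 [K K0 HK]] := eval_bound Oa; exists rho => // e e0.
  have K10 : 0 < K + 1 by rewrite ltr_wpDl.
  (* With [e ^ 2 / (K + 1)] in norm, the evaluation bound gives at most [e ^ 2] for the squared
     modulus; [K] may be 0. *)
  have [i Hi] := cau _ (divr_gt0 (exprn_gt0 2 e0) K10).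
  exists i => j k ij ik z zr; have [_ /(_ _ (A2B (FA j l) (FA k l)))] := HK z zr.
  rewrite /sqn => H; rewrite -ler_sqr ?nnegrE ?normc_ge0 ?(ltW e0)//; apply: le_trans H _.
  have := le_trans (N2_le (fun l z => F j l z - F k l z) l) (Hi j k ij ik).
  rewrite ler_pdivlMr// => H; apply: le_trans H; rewrite mulrC.
  by apply: ler_wpM2l; [exact: N2_ge0|rewrite lerDl].
have /choice[f Hf] : forall lz : 'I_N * Cn, exists w, Omega lz.2 -> tends (fun j => F j lz.1 lz.2) w.
  move=> [l z]; have [Oz|nO] := pselect (Omega z); last by exists 0.
  have [|w Hw] := @complex_cauchy R (fun j => F j l z); last by exists w.
  move=> e e0; have [rho rho0 Hr] := unif l z Oz; have [i Hi] := Hr e e0.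
  by exists i => j k ij ik; apply: Hi => //; rewrite subrr nrm0.
pose f' l z := f (l, z).
have tf l z : Omega z -> tends (fun j => F j l z) (f' l z) by exact: (Hf (l, z)).
have hf l : holomorphic_on Omega (f' l).
  apply: (@weierstrass R n Omega (fun j => F j l)) => //.
    by move=> j z Oz; have /A2P[hF _] := FA j l; exact: hF.
  move=> a Oa; have [rho rho0 Hr] := unif l a Oa.
  have [rho1 rho10 Hr1] := ball_in Oa.
  exists (Num.min rho rho1) => [|e e0]; first by rewrite lt_min rho0.
  have [i Hi] := Hr e e0; exists i => k ik z.
  rewrite lt_min => /andP[zr zr1]; rewrite -normcN opprB.
  apply: (tends_le (tf l z (Hr1 _ zr1)) (N := i)) => j ij; exact: Hi.
have cvgF l z : Omega z -> (fun j => normc (F j l z)) @ \oo --> normc (f' l z).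
  move=> Oz; apply/cvgrPdist_le => e e0; have [i Hi] := tf l z Oz e e0.
  exists i => // j /= ij; have := Hi j ij => H.
  rewrite ler_norml; apply/andP; split.
    have := normcD (F j l z - f' l z) (f' l z); rewrite subrK; lra.
  have := normcB (F j l z) (F j l z - f' l z); rewrite opprB addrC subrK; lra.
pose u j z := \sum_l sqn (F j l) z.
pose w z := \sum_l sqn (f' l) z.
have iF j l : intg (sqn (F j l)) by have /A2P[] := FA j l.
have csum (P : 'I_N -> Cn -> R[i]) : (forall l, holomorphic_on Omega (P l)) ->
    contO (fun z => \sum_l sqn (P l) z).
  move=> hP z Oz.
  apply: (@cvg_bigsum R Cn (nbhs z) _ 'I_N (fun l => sqn (P l)) (fun l => sqn (P l) z)) => l.
  exact: (contO_sqn (hP l)).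
have iu j := (intg_sum (iF j)).1; have mu_ j := (intg_sum (iF j)).2.
have [iw wms] : intg w /\ mI w <= ms.
  apply: (@fatou_mI u w ms) => //.
  - by move=> j; apply: csum => l; have /A2P[] := FA j l.
  - by move=> j z _; apply: sumr_ge0 => l _; exact: sqn_ge0.
  - exact: csum.
  - move=> z Oz; apply: cvg_bigsum => l; rewrite /sqn; exact: (cvgM (cvgF l z Oz) (cvgF l z Oz)).
  move=> e e0; have [i [i1 i2]] := small _ e0; exists i => j ij.
  rewrite /u mu_; have [_ Fj] := HF j.
  have inv_le : j.+1%:R^-1 <= i.+1%:R^-1 :> R by rewrite lef_pV2 ?posrE// ler_nat ltnS.
  have := m_ms j; move: inv_le Fj i2; rewrite /G2.
  set dj := j.+1%:R^-1; set di := i.+1%:R^-1; lra.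
have fA l : A2 Omega (f' l).
  apply/A2P; split=> //; apply: (intg_dom (contO_sqn (hf l)) _ iw) => z _.
  rewrite ger0_norm ?sqn_ge0// /w (bigD1 l)//= lerDl.
  by apply: sumr_ge0 => p _; exact: sqn_ge0.
exists F, f'; split => //; first by move=> j; have [] := HF j.
move=> F' SF'; have if' l : intg (sqn (f' l)) by have /A2P[] := fA l.
rewrite /G2 -(intg_sum if').2; apply: le_trans wms _.
apply: ge_sup; first by exists (m 0%N), 0%N.
by move=> _ [j _ <-]; exact: mle.
Qed.

End NestedLimit.

Lemma quadratic_ge0 (b c : R) : 0 <= c -> (forall t : R, 0 <= t ^+ 2 * c + 2 * t * b) -> b = 0.
Proof.
move=> c0 H; have c1 : 0 < c + 1 by rewrite ltr_wpDl.
(* Almost the minimizer [- b / c] of the quadratic, but meaningful also for [c = 0]. *)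
have := H (- b / (c + 1)).
have -> : (- b / (c + 1)) ^+ 2 * c + 2 * (- b / (c + 1)) * b = - (b ^+ 2 * ((c + 2) / (c + 1) ^+ 2)).
  by field; rewrite gt_eqF.
rewrite oppr_ge0 pmulr_lle0; last by rewrite divr_gt0 ?exprn_gt0//; lra.
by move=> b0; apply/eqP; rewrite -sqrf_eq0 eq_le b0 sqr_ge0.
Qed.

(** The first variation in the direction [k] gives the real part of the inner product, and the one
    in the direction [- i k] gives the imaginary part. *)
Lemma minimal_orthogonal f k : A2 Omega f -> A2 Omega k ->
  (forall c : R[i], N2 f <= N2 (fun z => c * k z + f z)) ->
  mI (cip k f) = 0 /\ mI (fun z => complex.Im (k z * conjc (f z))) = 0.
Proof.
move=> fA kA fmin.
have main (h : Cn -> R[i]) : A2 Omega h -> (forall t : R, N2 f <= N2 (fun z => t%:C * h z + f z)) ->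
    mI (cip h f) = 0.
  move=> hA hmin; have ci := intg_cip hA fA.
  apply: (quadratic_ge0 (N2_ge0 h)) => t; have := hmin t.
  by rewrite N2_lin//; lra.
split; first by apply: main.
have -> : mI (fun z => complex.Im (k z * conjc (f z))) = mI (cip (fun z => - 'i%C * k z) f).
  by apply: eq_mI => z _; rewrite /cip; case: (f z) => x y; case: (k z) => p q /=; ring.
apply: main => [|t]; first exact: A2Z.
by have := fmin (t%:C * - 'i%C); under eq_fun do rewrite -mulrA.
Qed.

Lemma complex_mean_intE f k : complex_mean_int Omega (fun z => f z * Num.conj (k z)) =
  mI (cip f k) +i* mI (fun z => complex.Im (f z * conjc (k z))).
Proof. by []. Qed.

Lemma intg_cipi f k : A2 Omega f -> A2 Omega k ->
  intg (fun z => complex.Im (f z * conjc (k z))).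
Proof.
move=> fA kA; apply: eq_intg (intg_cip (A2Z (- 'i%C) fA) kA) => z _.
by rewrite /cip; case: (f z) => x y; case: (k z) => p q /=; ring.
Qed.

(** The function [f0] of least norm with [f0 a = 1] is orthogonal to every function vanishing at
    [a]. Writing [g = g a * f0 + h] with [h a = 0], the inner product of [g] with [f0] is
    [g a * N2 f0], so [f0 / N2 f0] reproduces at [a]. Here [nested_limit] is used for a constant
    sequence of sets and one component. *)
Lemma kernel_exists a : Omega a -> exists k, reproducing_at Omega a k.
Proof.
move=> Oa.
pose S (j : nat) := [set F : 'I_1 -> Cn -> R[i] | A2 Omega (F ord0) /\ F ord0 a = 1].
have [|j F F' [FA Fa] [FA' Fa']|j|j|F [f [SF fA tf fmin]]] := @nested_limit 1 S 1.
- by move=> j F [FA Fa] l; rewrite ord1.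
- split; last by rewrite Fa Fa' -mulr2n mulfV// pnatr_eq0.
  have := A2_lin 2^-1 FA (A2Z 2^-1 FA').
  by under eq_fun do rewrite -mulrDr mulrC.
- by [].
- exists (fun _ _ => 1); first by split => //; exact: A2_cst.
  rewrite /G2 big_ord1 /N2 (@eq_mI _ (fun=> 1)) ?mI_cst// => z _.
  by rewrite /sqn (normc_nat 1) expr1n.
pose f0 := f ord0.
have f0A : A2 Omega f0 := fA ord0.
have f0a : f0 a = 1.
  apply: tends_unique (tf ord0 a Oa) _ => e e0; exists 0%N => j _.
  by have [_ ->] := SF j; rewrite subrr ComplexField.Normc.normc0 ltW.
have f0min (h : Cn -> R[i]) : A2 Omega h -> h a = 1 -> N2 f0 <= N2 h.
  move=> hA ha; have := fmin (fun=> h) (fun=> conj hA ha).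
  by rewrite /G2 !big_ord1.
have Nf0 : 0 < N2 f0.
  rewrite lt_neqAle N2_ge0 andbT eq_sym; apply/negP => /eqP Nf.
  have [rho rho0 [K K0 HK]] := eval_bound Oa.
  have [|_ /(_ f0 f0A)] := HK a; first by rewrite subrr nrm0.
  by rewrite Nf mulr0 /sqn f0a (normc_nat 1) expr1n leNgt ltr01.
exists (fun z => ((N2 f0)^-1)%:C * f0 z); split; first exact: A2Z.
move=> g gA.
pose h z := - g a * f0 z + g z.
have hA : A2 Omega h by exact: A2_lin.
have ha : h a = 0 by rewrite /h f0a mulr1 addNr.
have [hR hI] : mI (cip h f0) = 0 /\ mI (fun z => complex.Im (h z * conjc (f0 z))) = 0.
  apply: minimal_orthogonal => // c; apply: f0min; first exact: A2_lin.
  by rewrite ha mulr0 add0r.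
rewrite complex_mean_intE.
have fi : intg (sqn f0) by have /A2P[] := f0A.
have -> : mI (cip g (fun z => ((N2 f0)^-1)%:C * f0 z)) = complex.Re (g a).
  rewrite (@eq_mI _ (fun z => (N2 f0)^-1 * (complex.Re (g a) * sqn f0 z + cip h f0 z))).
    rewrite mIZ; last by apply: intg_lin => //; exact: intg_cip.
    rewrite mI_lin//; last exact: intg_cip.
    by rewrite hR addr0 -/(N2 f0) mulrCA mulVf ?mulr1// gt_eqF.
  move=> z _; rewrite /cip /sqn /h normc_sq.
  by case: (f0 z) => x y; case: (g z) => p q; case: (g a) => s t /=; ring.
have -> : mI (fun z => complex.Im (g z * conjc (((N2 f0)^-1)%:C * f0 z))) = complex.Im (g a).
  rewrite (@eq_mI _ (fun z => (N2 f0)^-1 * (complex.Im (g a) * sqn f0 z +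
      complex.Im (h z * conjc (f0 z))))).
    rewrite mIZ; last by apply: intg_lin => //; exact: intg_cipi.
    rewrite mI_lin//; last exact: intg_cipi.
    by rewrite hI addr0 -/(N2 f0) mulrCA mulVf ?mulr1// gt_eqF.
  move=> z _; rewrite /sqn /h normc_sq.
  by case: (f0 z) => x y; case: (g z) => p q; case: (g a) => s t /=; ring.
by case: (g a).
Qed.

(** * Normalized Bergman kernels as weights *)

Section Kernel.
Variable a : Cn.
Hypothesis Oa : Omega a.
Let k := bergman_kernel Omega a.

Let kP : reproducing_at Omega a k.
Proof. by have [k' k'P] := kernel_exists Oa; exact: (xgetPex (fun=> 0) (ex_intro _ k' k'P)). Qed.

Let kA : A2 Omega k. Proof. by have [] := kP. Qed.

Let kaa : k a = (N2 k)%:C.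
Proof.
have [_ /(_ k kA)] := kP; rewrite complex_mean_intE => ->.
apply/eqP; rewrite eq_complex /=; apply/andP; split; apply/eqP.
  apply: eq_mI => z _; rewrite /cip /sqn normc_sq.
  by case: (k z) => x y /=; ring.
rewrite -[RHS]mI0; apply: eq_mI => z _; case: (k z) => x y /=; ring.
Qed.

(** Reproducing the constant 1 shows that the real part of [k] has mean 1, and it is at most
    [(|k|^2 + 1) / 2]. The resulting positivity of [N2 k] justifies the normalization. *)
Let Nk1 : 1 <= N2 k.
Proof.
have [_ /(_ _ (A2_cst 1))] := kP; rewrite complex_mean_intE => -[E _].
have /A2P[_ ki] := kA.
have : mI (cip (fun=> 1) k) <= mI (fun z => 2^-1 * sqn k z + 2^-1).
  apply: mI_le.
  - exact: intg_cip (A2_cst 1) kA.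
  - by apply: intg_lin => //; exact: intg_cst.
  - move=> z _; rewrite /cip /sqn normc_sq; case: (k z) => x y /=.
    have := sqr_ge0 (x - 1); have := sqr_ge0 y; lra.
rewrite mI_lin//; last exact: intg_cst.
rewrite mI_cst -E -/(N2 k); lra.
Qed.

Definition nkern (b z : Cn) : R := normc (normalized_kernel Omega b z) ^+ 2.

(** [k a] is the nonnegative real number [N2 k], so the squared modulus of its square root is [N2 k]
    again. *)
Let nkernE z : nkern a z = (N2 k)^-1 * sqn k z.
Proof.
rewrite /nkern /normalized_kernel -/k ComplexField.Normc.normcM exprMn mulrC; congr (_ * _).
rewrite -normcX exprVn sqrtCK kaa ComplexField.Normc.normcV normc_real ger0_norm//.
exact: N2_ge0.
Qed.

Lemma intg_nkern : intg (nkern a).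
Proof.
have /A2P[_ ki] := kA; apply: eq_intg (intgZ (N2 k)^-1 ki) => z _; exact/esym/nkernE.
Qed.

Lemma mI_nkern : mI (nkern a) = 1.
Proof.
have /A2P[_ ki] := kA.
rewrite (@eq_mI _ (fun z => (N2 k)^-1 * sqn k z)); last by move=> z _; exact: nkernE.
by rewrite mIZ// mulVf// gt_eqF// (lt_le_trans ltr01).
Qed.

Lemma contO_nkern : contO (nkern a).
Proof.
have /A2P[hk _] := kA.
have -> : nkern a = fun z => (N2 k)^-1 * sqn k z by apply/funext => z; exact: nkernE.
apply: contO_mul (contO_sqn hk) => z _; exact: cst_continuous.
Qed.

(** The hypothesis says that [F = f k] is in the Bergman space, and reproducing it at [a] gives
    [f a * N2 k]. After multiplication by the conjugate of [f a], the pointwise inequality of means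
    bounds [|f a|^2 N2 k] by [|f a|^2 N2 k / 2 + N2 F / 2], where [N2 F] is [N2 k] times the
    weighted norm; half of the left side is absorbed. *)
Lemma sqn_le_nkern f : holomorphic_on Omega f -> intg (fun z => sqn f z * nkern a z) ->
  sqn f a <= mI (fun z => sqn f z * nkern a z).
Proof.
move=> hf fi; have /A2P[hk ki] := kA.
have Nk0 : 0 < N2 k by rewrite (lt_le_trans ltr01).
pose F z := f z * k z.
have FE z : sqn F z = N2 k * (sqn f z * nkern a z).
  rewrite nkernE mulrCA mulVKf ?gt_eqF//.
  by rewrite /sqn ComplexField.Normc.normcM exprMn mulrC.
have FA : A2 Omega F.
  apply/A2P; split; first exact: holomorphic_mul.
  by apply: eq_intg (intgZ (N2 k) fi) => z _; rewrite FE.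
have [_ /(_ F FA)] := kP; rewrite complex_mean_intE {1}/F kaa => E.
have iF : intg (sqn F) by have /A2P[] := FA.
have h1 : sqn f a * N2 k = mI (fun z => complex.Re (f a) * cip F k z + complex.Im (f a) *
    complex.Im (F z * conjc (k z))).
  rewrite mI_lin; last 2 first.
  - exact: intg_cip.
  - by apply: intgZ; exact: intg_cipi.
  rewrite mIZ; last exact: intg_cipi.
  move: E; rewrite /sqn normc_sq; case: (f a) => p q /= -[E1 E2].
  by rewrite -E1 -E2; ring.
have h2 : mI (fun z => complex.Re (f a) * cip F k z + complex.Im (f a) *
    complex.Im (F z * conjc (k z))) <= mI (fun z => (sqn f a / 2) * sqn k z + 2^-1 * sqn F z).
  apply: mI_le.
  - apply: intg_lin; [exact: intg_cip|by apply: intgZ; exact: intg_cipi].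
  - by apply: intg_lin => //; exact: intgZ.
  move=> z _; rewrite /cip /sqn !normc_sq /F.
  case: (f a) => p q; case: (f z) => x y; case: (k z) => s t /=.
  have := mulr_ge0 (sqr_ge0 (p - x)) (sqr_ge0 s); have := mulr_ge0 (sqr_ge0 (p - x)) (sqr_ge0 t).
  have := mulr_ge0 (sqr_ge0 (q - y)) (sqr_ge0 s); have := mulr_ge0 (sqr_ge0 (q - y)) (sqr_ge0 t).
  lra.
have EE : mI (fun z => sqn f a / 2 * sqn k z + 2^-1 * sqn F z) = sqn f a / 2 * N2 k + 2^-1 * mI (sqn F).
  by rewrite mI_lin ?mIZ//; exact: intgZ.
move: h2; rewrite EE -h1.
have -> : mI (sqn F) = N2 k * mI (fun z => sqn f z * nkern a z).
  by rewrite -mIZ//; apply: eq_mI => z _; exact: FE.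
move=> h; rewrite -(ler_pM2l Nk0); lra.
Qed.

End Kernel.

End Bergman.

(** * A finite minimax lemma *)

Section Minimax.
Context {R : realType}.

(** The squared positive part lies below its tangent at [a] plus [b ^ 2]; this is the second-order
    upper bound that a descent step needs. *)
Lemma sqr_posD (a b : R) : Num.max (a + b) 0 ^+ 2 <= (Num.max a 0 + b) ^+ 2.
Proof.
have [ab|ab] := leP (a + b) 0; first by rewrite expr0n sqr_ge0.
have [a0|a0] := leP a 0; last by [].
by rewrite add0r ler_sqr ?nnegrE; lra.
Qed.

(** Suppose that every point of [K] has an entry above [c + e], and let [phi] be the sum of the
    squared excesses over [c' = c + e / 2], with infimum [d > 0] on [K]. At an almost minimal [x]
    the weights are taken proportional to the excesses, that is to the gradient of [phi], with a
    small uniform part that makes them positive. The [y] which the hypothesis gives for these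
    weights is a descent direction: a short step from [x] towards [y] brings [phi] below [d]. An
    almost minimal [x] suffices, so [K] need not be closed. *)
Lemma minimax_finite (M : nat) (K : set ('I_M.+1 -> R)) (c e : R) : 0 <= c -> 0 < e ->
  (forall x y t, K x -> K y -> 0 <= t <= 1 -> K (fun m => (1 - t) * x m + t * y m)) ->
  (forall x m, K x -> 0 <= x m) ->
  (forall theta : 'I_M.+1 -> R, (forall m, 0 < theta m) -> \sum_m theta m = 1 ->
     exists2 x, K x & \sum_m theta m * x m <= c) ->
  exists2 x, K x & forall m, x m <= c + e.
Proof.
move=> c0 e0 Kconv K0 Kth.
apply/not_exists2P => noK.
have M0 : 0 < M.+1%:R :> R by [].
pose c' := c + e / 2.
have c'0 : 0 < c' by rewrite /c'; lra.
pose v (x : 'I_M.+1 -> R) m := Num.max (x m - c') 0.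
have v0 x m : 0 <= v x m by rewrite /v le_max lexx orbT.
pose phi x := \sum_m v x m ^+ 2.
have v_phi x m : v x m ^+ 2 <= phi x.
  by rewrite /phi (bigD1 m)//= lerDl; apply: sumr_ge0 => *; exact: sqr_ge0.
have phi_big x : K x -> (e / 2) ^+ 2 < phi x.
  move=> Kx; rewrite ltNge; apply/negP => small.
  case: (noK x) => // H; apply: H => m.
  have : v x m <= e / 2.
    by rewrite -ler_sqr ?nnegrE//; [exact: le_trans (v_phi x m) small|lra].
  by rewrite /v ge_max => /andP[+ _]; rewrite /c'; lra.
have [x0 Kx0 _] : exists2 x, K x & \sum_m M.+1%:R^-1 * x m <= c.
  apply: Kth; first by move=> _; rewrite invr_gt0.
  by rewrite sumr_const card_ord -[LHS]mulr_natr mulVf// gt_eqF.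
pose d := inf [set phi x | x in K].
have dinf : has_inf [set phi x | x in K].
  split; first by exists (phi x0), x0.
  by exists 0 => _ [x _ <-]; apply: sumr_ge0 => *; exact: sqr_ge0.
have d_le x : K x -> d <= phi x by move=> Kx; apply: ge_inf; [have [] := dinf|exists x].
have d0 : 0 < d.
  apply: (@lt_le_trans _ _ ((e / 2) ^+ 2)); first by rewrite exprn_gt0// divr_gt0.
  apply: lb_le_inf; first by have [] := dinf.
  by move=> _ [x Kx <-]; rewrite ltW// phi_big.
(* The uniform part of the weights costs [ep * c' = e / 4], which the gap [e / 2] between [c] and
   [c'] absorbs. *)
pose ep := e / (4 * c').
have ep0 : 0 < ep by rewrite divr_gt0// mulr_gt0.
have epc : ep * c' = e / 4 by rewrite /ep; field; rewrite gt_eqF.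
have ep1 : ep <= 1 / 2.
  by rewrite -(ler_pM2r c'0) epc /c'; lra.
(* Every weight is at least [ep / M.+1], so nonnegative entries with weighted sum at most [c] are at
   most [Yb]. *)
pose Yb := c / (ep / M.+1%:R).
have epM : 0 < ep / M.+1%:R by rewrite divr_gt0.
have Yb0 : 0 <= Yb by rewrite divr_ge0// ltW.
(* If [phi x < d + 1], each excess is at most [1 + phi x < d + 2]. *)
pose Xb := c' + d + 2.
pose B := \sum_(m < M.+1) (Yb ^+ 2 + Xb ^+ 2).
have B0 : 0 <= B by apply: sumr_ge0 => m _; rewrite addr_ge0 ?sqr_ge0.
(* [B] bounds the squared distance of [x] and [y]. For this step the quadratic error [t ^ 2 * B] is
   at most [t * d] and the first-order gain is at least [2 * t * d]; with [phi x < d + t * d] the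
   total falls below [d]. *)
pose t := d / (B + d).
have Bd : 0 < B + d by rewrite ltr_wpDl.
have t0 : 0 < t by rewrite divr_gt0.
have t1 : t <= 1 by rewrite ler_pdivrMr// mul1r lerDr.
have tB : t * B <= d.
  by rewrite /t mulrAC ler_pdivrMr// ler_wpM2l// ?lerDl ltW.
pose eta := Num.min 1 (t * d).
have eta0 : 0 < eta by rewrite lt_min ltr01 mulr_gt0.
have [_ [x Kx <-] xd] := inf_adherent eta0 dinf.
have xd1 : phi x < d + 1 by apply: lt_le_trans xd _; rewrite lerD2l ge_min lexx.
have xdt : phi x < d + t * d by apply: lt_le_trans xd _; rewrite lerD2l ge_min lexx orbT.
pose s := \sum_m v x m.
have s0 : 0 < s.
  rewrite lt_neqAle sumr_ge0// andbT eq_sym; apply/negP => /eqP s0.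
  have vz m : v x m = 0.
    apply/eqP; rewrite eq_le v0 andbT -s0 /s (bigD1 m)//= lerDl.
    by apply: sumr_ge0.
  have := phi_big x Kx; rewrite /phi big1 => [|m _]; last by rewrite vz expr0n.
  by apply/negP; rewrite -leNgt sqr_ge0.
pose th m := (1 - ep) * (v x m / s) + ep / M.+1%:R.
have th0 m : 0 < th m.
  by rewrite ltr_wpDl// mulr_ge0 ?divr_ge0 ?(ltW s0)//; lra.
have th1 : \sum_m th m = 1.
  rewrite big_split /= -mulr_sumr -mulr_suml -/s divff ?gt_eqF// sumr_const card_ord.
  by rewrite -[(ep / _) *+ _]mulr_natr divfK ?gt_eqF//; ring.
have [y Ky yc] := Kth th th0 th1.
have y0 m : 0 <= y m by exact: K0.
have yb m : y m <= Yb.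
  rewrite ler_pdivlMr//; apply: le_trans yc; rewrite (bigD1 m)//= ler_wpDr//.
    by apply: sumr_ge0 => p _; rewrite mulr_ge0// ltW.
  rewrite mulrC ler_wpM2r// lerDr mulr_ge0 ?divr_ge0 ?(ltW s0)//; lra.
have vy : \sum_m v x m * y m <= s * c'.
  have h1 : (1 - ep) * (\sum_m v x m * y m) <= s * c.
    apply: (@le_trans _ _ (s * \sum_m th m * y m)); last by rewrite ler_wpM2l// ltW.
    rewrite !mulr_sumr; apply: ler_sum => m _.
    have -> : s * (th m * y m) = (1 - ep) * (v x m * y m) + s * (ep / M.+1%:R * y m).
      by rewrite /th; field; rewrite !gt_eqF.
    by rewrite lerDl mulr_ge0 ?(ltW s0)// mulr_ge0 ?(ltW epM).
  have epp : 0 < 1 - ep by lra.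
  rewrite -(ler_pM2l epp); apply: le_trans h1 _.
  have -> : (1 - ep) * (s * c') = s * (c' - ep * c') by ring.
  by rewrite ler_wpM2l ?(ltW s0)// epc /c'; lra.
have vx m : v x m * (x m - c') = v x m ^+ 2.
  by rewrite /v; case: leP => _; rewrite ?mul0r ?expr0n// expr2.
pose z m := (1 - t) * x m + t * y m.
have Kz : K z by apply: Kconv => //; rewrite (ltW t0).
have phiz : phi z <= phi x + 2 * t * (\sum_m v x m * (y m - x m)) + t ^+ 2 * B.
  rewrite /phi /B !mulr_sumr -!big_split /=; apply: ler_sum => m _.
  have := sqr_posD (x m - c') (t * (y m - x m)).
  have -> : x m - c' + t * (y m - x m) = z m - c' by rewrite /z; ring.
  rewrite -/(v z m) -/(v x m) => /le_trans; apply.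
  have xb : x m <= Xb.
    have h1 := v_phi x m.
    have h2 : v x m <= 1 + v x m ^+ 2 by have := sqr_ge0 (v x m - 1); nra.
    have : x m - c' <= v x m by rewrite /v le_max lexx.
    by rewrite /Xb; lra.
  have h3 : (y m - x m) ^+ 2 <= Yb ^+ 2 + Xb ^+ 2.
    have hx : x m ^+ 2 <= Xb ^+ 2 by rewrite ler_sqr ?nnegrE// ?K0// /Xb; lra.
    have hy : y m ^+ 2 <= Yb ^+ 2 by rewrite ler_sqr ?nnegrE.
    have := mulr_ge0 (K0 _ m Kx) (y0 m); nra.
  have := ler_wpM2l (sqr_ge0 t) h3; nra.
have sumE : \sum_m v x m * (y m - x m) = \sum_m v x m * y m - s * c' - phi x.
  rewrite /s /phi mulr_suml -!sumrB; apply: eq_bigr => m _.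
  by rewrite -vx; ring.
have : phi z < d.
  apply: le_lt_trans phiz _; rewrite sumE.
  have h1 : \sum_m v x m * y m - s * c' - phi x <= - d by have := d_le x Kx; lra.
  have h2 := ler_wpM2l (mulr_ge0 (ler0n R 2) (ltW t0)) h1.
  have h3 : t ^+ 2 * B <= t * d by rewrite expr2 -mulrA ler_wpM2l// ltW.
  lra.
by apply/negP; rewrite -leNgt; exact: d_le.
Qed.

End Minimax.

(** * The two properties on bounded domains *)

Section Bounded.
Context {R : realType} {n : nat}.
Local Notation Cn := 'rV[R[i]]_n.
Implicit Types (D Omega : set Cn) (z : Cn).

Lemma to_realK z : to_complex (to_real z) = z.
Proof. by apply/rowP => j; rewrite mxE row_mxEl row_mxEr !mxE; case: (z 0 j). Qed.

Lemma to_complexK (x : 'rV[R]_(n + n)) : to_real (to_complex x) = x.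
Proof. by rewrite -[RHS]hsubmxK /to_real; congr row_mx; apply/rowP => j; rewrite !mxE. Qed.

Lemma row_coord_le m (x : 'rV[R]_m) i : `|x 0 i| <= `|x|.
Proof. by rewrite [leRHS]mx_normrE; exact: (le_bigmax _ (fun p : 'I_1 * 'I_m => `|x p.1 p.2|) (0, i)). Qed.

Lemma to_real_coord_le z i : `|to_real z 0 i| <= nrm z.
Proof.
rewrite /to_real; case: (split_ordP i) => j ->; rewrite ?row_mxEl ?row_mxEr mxE.
  exact: le_trans (Re_normc _) (nrm_coord _ _).
exact: le_trans (Im_normc _) (nrm_coord _ _).
Qed.

Lemma volume_lty Omega (B : R) : open Omega ->
  (forall z i, Omega z -> `|to_real z 0 i| <= B) -> (volume Omega < +oo)%E.
Proof.
move=> oO OB; apply: le_lt_trans (volume_box (n + n) B).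
apply: le_measure; rewrite ?inE.
- exact: measurable_point_open.
- have := @measurable_cube R (n + n) [tuple 0 | i < n + n] B.
  by under eq_set do under eq_forall do rewrite tnth_mktuple subr0.
- move=> t Ot i; have := OB _ i Ot.
  by rewrite /point_of_tuple to_complexK mxE.
Qed.

Lemma close_domain_volume_lty D Omega : bounded_set D -> open Omega ->
  close_domain 0 1 D Omega -> (volume Omega < +oo)%E.
Proof.
move=> /pinfty_ex_gt0[M M0 DM] oO [Phi [_ PhiD close]].
apply: (@volume_lty _ (complex.Re M + 1) oO) => w i; rewrite -PhiD => -[z Dz <-].
have zM : nrm z <= complex.Re M.
  have := DM z Dz; rewrite /= nrmE => H.
  by move: H; rewrite lecE => /andP[].
pose x := to_real z.
have xz : to_complex x = z by exact: to_realK.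
have : `|realify Phi x - x| < 1.
  rewrite -lte_fin; apply: le_lt_trans close; apply: ereal_sup_ubound.
  (* The empty list of partial derivatives: order 0 of the norm already bounds the displacement of
     points. *)
  by exists [::], x; split => //=; rewrite xz; exact: subset_closure.
have := row_coord_le (realify Phi x - x) i.
have -> : (realify Phi x - x) 0 i = to_real (Phi z) 0 i - x 0 i.
  by rewrite mxE [X in _ + X]mxE /realify /= xz.
move=> h1 h2.
have h3 := to_real_coord_le z i.
have := ler_normD (to_real (Phi z) 0 i - x 0 i) (x 0 i); rewrite subrK.
rewrite -/x in h3; lra.
Qed.

End Bounded.

Section Corona.
Context {R : realType} {n : nat}.
Local Notation Cn := 'rV[R[i]]_n.
Variable Omega : set Cn.
Hypothesis openO : open Omega.
Hypothesis nonemptyO : Omega !=set0.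
Hypothesis volO : (volume Omega < +oo)%E.
Implicit Types (f k : Cn -> R[i]) (a z : Cn).

(** Enumeration of the points with rational coordinates; codes that do not decode, or whose point is
    outside [Omega], are sent to [a0]. *)
Lemma dense_sequence : exists u : nat -> Cn, (forall m, Omega (u m)) /\
  forall z e, Omega z -> 0 < e -> exists m, nrm (u m - z) < e.
Proof.
have [a0 Oa0] := nonemptyO.
pose p (q : {ffun 'I_n -> rat * rat}) : Cn :=
  \row_j ((ratr (q j).1 : R) +i* (ratr (q j).2 : R)).
pose u m := if (pickle_inv m : option {ffun 'I_n -> rat * rat}) is Some q then
  (if `[< Omega (p q) >] then p q else a0) else a0.
exists u; split=> [m|z e Oz e0].
  by rewrite /u; case: pickle_inv => // q; case: asboolP.
have [rho rho0 Hr] := ball_in openO Oz.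
pose d := Num.min e rho.
have d0 : 0 < d by rewrite lt_min e0.
have near_rat (x : R) : exists q : rat, `|ratr q - x| < d / 2.
  have [|q] := @rat_in_itvoo R (x - d / 2) (x + d / 2); first by lra.
  by rewrite in_itv /= => /andP[h1 h2]; exists q; rewrite ltr_norml; lra.
have /choice[q Hq] : forall j, exists q : rat * rat,
    `|ratr q.1 - complex.Re (z 0 j)| < d / 2 /\ `|ratr q.2 - complex.Im (z 0 j)| < d / 2.
  move=> j; have [q1 H1] := near_rat (complex.Re (z 0 j)).
  by have [q2 H2] := near_rat (complex.Im (z 0 j)); exists (q1, q2).
have pz : nrm (p (finfun q) - z) < d.
  apply/nrm_ltP => // j; rewrite !mxE ffunE; apply: le_lt_trans (normc_ReIm _) _.
  have [] := Hq j; case: (z 0 j) => x y /=; lra.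
exists (pickle (finfun q)); rewrite /u pickleK_inv.
case: asboolP => [_|[]]; first by rewrite (lt_le_trans pz)// ge_min lexx.
by apply: Hr; rewrite (lt_le_trans pz)// ge_min lexx orbT.
Qed.

Lemma contO_le_dense (u : nat -> Cn) (w : Cn -> R) (B : R) : contO Omega w ->
  (forall z e, Omega z -> 0 < e -> exists m, nrm (u m - z) < e) ->
  (forall m, w (u m) <= B) -> forall z, Omega z -> w z <= B.
Proof.
move=> cw udense uB z Oz; rewrite leNgt; apply/negP => Bw.
have : \forall z' \near z, B < w z' by exact: cvgr_gt (cw z Oz) _ Bw.
move=> /nbhs_rVP[e e0 He]; have [m /He] := udense z e Oz e0.
by apply/negP; rewrite -leNgt.
Qed.

Lemma bounded_A2 f (B : R) : holomorphic_on Omega f ->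
  (forall z, Omega z -> sqn f z <= B) -> A2 Omega f.
Proof.
move=> hf fB; apply/(A2P openO nonemptyO volO); split=> //.
have cf : contO Omega (sqn f) := contO_sqn hf.
have iB := intg_cst openO volO B.
apply: (intg_dom openO cf _ iB) => z Oz.
by rewrite ger0_norm ?sqn_ge0// fB.
Qed.

(** * Weighted norms as convex combinations *)

Section Weights.
Variables (M : nat) (a : 'I_M -> Cn).
Hypothesis Oa : forall m, Omega (a m).

(** The constant weight belonging to [theta ord0] and the kernel weights form one family indexed
    like [theta], so that the squared weighted norm is a convex combination of [M.+1] squared
    norms. *)
Definition wgt (m : 'I_M.+1) (z : Cn) : R :=
  if unlift ord0 m is Some p then nkern Omega (a p) z else 1.

Lemma wgt_ge0 m z : 0 <= wgt m z.
Proof. by rewrite /wgt; case: unliftP => *; [exact: sqr_ge0|exact: ler01]. Qed.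

Lemma contO_wgt m : contO Omega (wgt m).
Proof.
rewrite /wgt; case: unliftP => [p _|_] z Oz; first exact: (contO_nkern openO nonemptyO volO (Oa p)).
exact: cst_continuous.
Qed.

Lemma intg_wgt m : intg Omega (wgt m).
Proof.
rewrite /wgt; case: unliftP => [p _|_]; first exact: intg_nkern.
exact: intg_cst.
Qed.

Lemma mI_wgt m : mI Omega (wgt m) = 1.
Proof.
rewrite /wgt; case: unliftP => [p _|_]; first exact: mI_nkern.
exact: mI_cst.
Qed.

Lemma weighted_norm2E (theta : 'I_M.+1 -> R) f : weighted_norm2 Omega a theta f =
  mean_int Omega (fun z => \sum_m theta m * (sqn f z * wgt m z)).
Proof.
apply: eq_mean_int => z _; rewrite big_ord_recl /wgt unlift_none mulr1 mulrDr mulrC.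
congr (_ + _); rewrite mulr_sumr; apply: eq_bigr => m _.
by rewrite liftK mulrCA.
Qed.

Lemma contO_sqn_wgt f m : holomorphic_on Omega f -> contO Omega (fun z => sqn f z * wgt m z).
Proof. by move=> hf; exact: (contO_mul (contO_sqn hf) (@contO_wgt m)). Qed.

Lemma weighted_norm2_mI (theta : 'I_M.+1 -> R) f :
  (forall m, intg Omega (fun z => sqn f z * wgt m z)) ->
  weighted_norm2 Omega a theta f = (\sum_m theta m * mI Omega (fun z => sqn f z * wgt m z))%:E.
Proof.
move=> fi; have ti m := intgZ openO (theta m) (fi m).
have [si sE] := intg_sum openO ti.
rewrite weighted_norm2E (mean_intE openO si) sE; congr EFin.
by apply: eq_bigr => m _; rewrite (mIZ openO).
Qed.

Lemma bounded_weight f (B : R) m : holomorphic_on Omega f -> (forall z, Omega z -> sqn f z <= B) ->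
  intg Omega (fun z => sqn f z * wgt m z) /\ mI Omega (fun z => sqn f z * wgt m z) <= B.
Proof.
move=> hf fB; have iB := intgZ openO B (intg_wgt m).
have le z : Omega z -> sqn f z * wgt m z <= B * wgt m z.
  by move=> Oz; rewrite ler_wpM2r ?wgt_ge0// fB.
have i1 : intg Omega (fun z => sqn f z * wgt m z).
  apply: (intg_dom openO (contO_sqn_wgt hf) _ iB) => z Oz.
  by rewrite ger0_norm ?le// mulr_ge0 ?sqn_ge0 ?wgt_ge0.
split=> //; apply: le_trans (mI_le openO nonemptyO volO i1 iB le) _.
by rewrite (mIZ openO) ?mI_wgt ?mulr1//; exact: intg_wgt.
Qed.

(** Each term is at most [(theta m)^-1] times the whole integrand; this is where positivity of the
    weights enters. *)
Lemma weight_intg (theta : 'I_M.+1 -> R) f m : holomorphic_on Omega f ->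
  (forall m, 0 < theta m) -> (weighted_norm2 Omega a theta f < +oo)%E ->
  intg Omega (fun z => sqn f z * wgt m z).
Proof.
move=> hf th0; rewrite weighted_norm2E => fy.
have t0 p z : 0 <= theta p * (sqn f z * wgt p z).
  by rewrite mulr_ge0 ?(ltW (th0 p))// mulr_ge0 ?sqn_ge0 ?wgt_ge0.
have s0 z : Omega z -> 0 <= \sum_m theta m * (sqn f z * wgt m z).
  by move=> _; apply: sumr_ge0 => p _.
have cs : contO Omega (fun z => \sum_m theta m * (sqn f z * wgt m z)).
  move=> z Oz; apply: (@cvg_bigsum R Cn (nbhs z) _ _
    (fun m z => theta m * (sqn f z * wgt m z)) (fun m => theta m * (sqn f z * wgt m z))) => p.
  have ct : contO Omega (fun=> theta p) by move=> y _; exact: cst_continuous.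
  exact: (contO_mul ct (@contO_sqn_wgt f p hf)).
have si := mean_int_lty openO nonemptyO volO cs s0 fy.
apply: (intg_dom openO (contO_sqn_wgt hf) _ (intgZ openO (theta m)^-1 si)) => z Oz.
rewrite ger0_norm; last by rewrite mulr_ge0 ?sqn_ge0 ?wgt_ge0.
rewrite ler_pdivlMl// (bigD1 m)//= lerDl; exact: sumr_ge0.
Qed.

End Weights.

Lemma corona_convex_poisson : corona_property Omega -> convex_poisson_property Omega.
Proof.
move=> cor N c phi data; have [N0 _ _ _] := data.
have [C [f [C0 fH fC]]] := cor N c phi data.
have fB l z : Omega z -> sqn (f l) z <= C ^+ 2.
  move=> /fC[h _]; apply: le_trans h.
  exact: (le_bigmax 0 (fun l => normc (f l z) ^+ 2) l).
have N1 : 1 <= N%:R :> R by rewrite ler1n.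
(* Each of the [N] components contributes at most [C ^ 2], and [N * C ^ 2 <= (N * C) ^ 2]. *)
exists (N%:R * C) => [|M a theta _ Oa th01 th1]; first by rewrite mulr_gt0// (lt_le_trans ltr01).
exists f; split=> [l||z /fC[]//].
  by have [hf _] := fH l; exact: bounded_A2 hf (fB l).
have le l : (weighted_norm2 Omega a theta (f l) <= (C ^+ 2)%:E)%E.
  have [hf _] := fH l; have H m := bounded_weight Oa m hf (fB l).
  rewrite weighted_norm2_mI => [|m]; last by have [] := H m.
  rewrite lee_fin -[leRHS]mul1r -th1 mulr_suml; apply: ler_sum => m _.
  by have [_ ?] := H m; rewrite ler_wpM2l//; have /andP[] := th01 m.
apply: (@le_trans _ _ (\sum_(l < N) (C ^+ 2)%:E)%E); first by apply: lee_sum => l _.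
rewrite sumEFin lee_fin sumr_const card_ord -[leLHS]mulr_natl exprMn ler_wpM2r ?sqr_ge0//.
by rewrite expr2 ler_peMl.
Qed.

(** * Bounded solutions from the Convex Poisson Property *)

Section Solutions.
Variables (N : nat) (phi : 'I_N -> Cn -> R[i]) (C : R).

Definition solution (f : 'I_N -> Cn -> R[i]) := (forall l, A2 Omega (f l)) /\
  forall z, Omega z -> \sum_(l < N) phi l z * f l z = 1.

Lemma solution_convex (t : R) (f f' : 'I_N -> Cn -> R[i]) : solution f -> solution f' ->
  solution (fun l z => (1 - t)%:C * f l z + t%:C * f' l z).
Proof.
move=> [fA f1] [fA' f1']; split=> [l|z Oz].
  exact: (A2_lin openO nonemptyO volO _ (fA l) (A2Z openO nonemptyO volO _ (fA' l))).
under eq_bigr do rewrite mulrDr 2![phi _ _ * (_ * _)]mulrCA.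
rewrite big_split /= -!mulr_sumr f1// f1'// !mulr1 -rmorphD /=.
by rewrite subrK.
Qed.

(** The right side exceeds the left side by [t (1 - t) |f z - f' z|^2]. *)
Lemma sqn_convex (t : R) f f' z : 0 <= t <= 1 ->
  sqn (fun z => (1 - t)%:C * f z + t%:C * f' z) z <= (1 - t) * sqn f z + t * sqn f' z.
Proof.
move=> /andP[t0 t1]; rewrite /sqn !normc_sq; case: (f z) => x y; case: (f' z) => p q /=.
have t10 : 0 <= t * (1 - t) by rewrite mulr_ge0// subr_ge0.
have := mulr_ge0 t10 (sqr_ge0 (x - p)); have := mulr_ge0 t10 (sqr_ge0 (y - q)); lra.
Qed.

Hypothesis C0 : 0 < C.
Hypothesis CP : forall (M : nat) (a : 'I_M -> Cn) (theta : 'I_M.+1 -> R),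
  (0 < M)%N -> (forall m, Omega (a m)) ->
  (forall m, 0 <= theta m <= 1) -> \sum_m theta m = 1 ->
  exists f : 'I_N -> Cn -> R[i],
    [/\ forall l, A2 Omega (f l),
        (\sum_(l < N) weighted_norm2 Omega a theta (f l) <= (C ^+ 2)%:E)%E &
        forall z, Omega z -> \sum_(l < N) phi l z * f l z = 1].

(** Domination in [K] is what makes it convex: at a convex combination of solutions the squared
    norms are at most, and in general not equal to, the combination of the squared norms. *)
Lemma finite_points (M : nat) (a : 'I_M -> Cn) : (0 < M)%N -> (forall m, Omega (a m)) ->
  exists f : 'I_N -> Cn -> R[i], [/\ solution f, G2 Omega f <= (C + 1) ^+ 2 &
    forall l m, normc (f l (a m)) <= C + 1].
Proof.
move=> M0 Oa.
pose I (f : 'I_N -> Cn -> R[i]) l m := intg Omega (fun z => sqn (f l) z * wgt a m z).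
pose Q (f : 'I_N -> Cn -> R[i]) l m := mI Omega (fun z => sqn (f l) z * wgt a m z).
(* Integrability is part of [K] because [mI] turns an infinite mean into 0 by the convention of
   [fine], and the inequalities would then say nothing. *)
pose K := [set x : 'I_M.+1 -> R | exists f : 'I_N -> Cn -> R[i],
  [/\ solution f, forall l m, I f l m & forall m, \sum_l Q f l m <= x m]].
have Q0 (f : 'I_N -> Cn -> R[i]) l m : 0 <= Q f l m.
  by apply: mI_ge0 => // z _; rewrite mulr_ge0 ?sqn_ge0 ?wgt_ge0.
have [|x m [f [_ _ fx]]|theta th0 th1|x [f [fS fI fx]] xC] :=
    @minimax_finite R M K (C ^+ 2) 1 (sqr_ge0 C) ltr01.
- move=> x y t [f [fS fI fx]] [f' [fS' fI' fy]] t01; have /andP[t0 t1] := t01.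
  have t1' : 0 <= 1 - t by rewrite subr_ge0.
  pose F l z := (1 - t)%:C * f l z + t%:C * f' l z.
  have FS : solution F by exact: solution_convex.
  have Fle l m z : sqn (F l) z * wgt a m z <=
      (1 - t) * (sqn (f l) z * wgt a m z) + t * (sqn (f' l) z * wgt a m z).
    have h : sqn (F l) z <= (1 - t) * sqn (f l) z + t * sqn (f' l) z by exact: sqn_convex.
    by have := ler_wpM2r (wgt_ge0 a m z) h; lra.
  have ic l m : intg Omega (fun z =>
      (1 - t) * (sqn (f l) z * wgt a m z) + t * (sqn (f' l) z * wgt a m z)).
    by apply: intg_lin => //; [exact: fI|exact: intgZ (fI' l m)].
  have FI l m : I F l m.
    have [FA _] := FS; have [hF _] := FA l.
    apply: (intg_dom openO (contO_sqn_wgt Oa hF) _ (ic l m)) => z _.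
    by rewrite ger0_norm ?Fle// mulr_ge0 ?sqn_ge0 ?wgt_ge0.
  exists F; split=> // m.
  apply: (@le_trans _ _ (\sum_l ((1 - t) * Q f l m + t * Q f' l m))).
    apply: ler_sum => l _; rewrite -(mIZ openO _ (fI' l m)) -mI_lin//; last 2 first.
    + exact: fI.
    + exact: intgZ (fI' l m).
    exact: (mI_le openO nonemptyO volO (FI l m) (ic l m) (fun z _ => Fle l m z)).
  by rewrite big_split /= -!mulr_sumr lerD// ler_wpM2l.
- by apply: le_trans (fx m); apply: sumr_ge0 => l _.
- have th01 m : 0 <= theta m <= 1.
    rewrite (ltW (th0 m)) -th1 (bigD1 m)//= lerDl.
    by apply: sumr_ge0 => p _; exact: ltW.
  have [f [fA fC f1]] := CP M0 Oa th01 th1.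
  have w0 l : (0 <= weighted_norm2 Omega a theta (f l))%E.
    rewrite weighted_norm2E; apply: mean_int_ge0 => // z _; apply: sumr_ge0 => m _.
    by rewrite mulr_ge0 ?(ltW (th0 m))// mulr_ge0 ?sqn_ge0 ?wgt_ge0.
  have fI l m : I f l m.
    have [hf _] := fA l; apply: (weight_intg Oa m hf th0).
    apply: le_lt_trans (ltry (C ^+ 2)); apply: le_trans fC.
    by rewrite (bigD1 l)//= leeDl// sume_ge0.
  exists (fun m => \sum_l Q f l m); first by exists f.
  move: fC; under eq_bigr => l _ do rewrite (weighted_norm2_mI theta (fI l)).
  rewrite sumEFin lee_fin exchange_big /=; apply: le_trans; rewrite le_eqVlt; apply/orP; left.
  by apply/eqP; apply: eq_bigr => m _; rewrite mulr_sumr.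
have CC : C ^+ 2 + 1 <= (C + 1) ^+ 2 by have := C0; lra.
have fm m : \sum_l Q f l m <= (C + 1) ^+ 2.
  by apply: le_trans (fx m) _; apply: le_trans (xC m) _.
exists f; split=> // [|l m].
  (* Index 0 carries the weight 1 and yields the unweighted norm; the other indices yield the values
     at the points [a m]. *)
  apply: le_trans (fm ord0); apply: ler_sum => l _; rewrite le_eqVlt; apply/orP; left.
  by apply/eqP; apply: eq_mI => z _; rewrite /wgt unlift_none mulr1.
have [fA _] := fS; have [hf _] := fA l.
have wE : wgt a (lift ord0 m) = nkern Omega (a m) by apply/funext => z; rewrite /wgt liftK.
have fi := fI l (lift ord0 m); rewrite /I wE in fi.
have h := sqn_le_nkern openO nonemptyO volO (Oa m) hf fi.
rewrite -ler_sqr ?nnegrE ?normc_ge0 ?addr_ge0 ?(ltW C0)//; apply: le_trans h _.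
apply: le_trans (fm (lift ord0 m)).
rewrite (bigD1 l)//= [Q f l _]/Q wE lerDl; exact: sumr_ge0.
Qed.

Lemma tends_sum (F : nat -> 'I_N -> R[i]) (l : 'I_N -> R[i]) (c : 'I_N -> R[i]) :
  (forall i, tends (fun j => F j i) (l i)) ->
  tends (fun j => \sum_i c i * F j i) (\sum_i c i * l i).
Proof.
move=> Fl; elim: (index_enum _) => [|i s IH].
  by move=> e e0; exists 0%N => j _; rewrite !big_nil subrr ComplexField.Normc.normc0 ltW.
by under eq_fun do rewrite big_cons; rewrite big_cons; exact: tends_linear.
Qed.

(** The identity and the bounds at the points of [u] are pointwise statements and survive the limit
    given by [nested_limit]; continuity of the moduli extends the bounds from the dense sequence to
    [Omega]. *)
Lemma bounded_solution : exists f : 'I_N -> Cn -> R[i], solution f /\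
  forall l z, Omega z -> normc (f l z) <= C + 1.
Proof.
have [u [Ou udense]] := dense_sequence.
pose S j := [set F : 'I_N -> Cn -> R[i] | solution F /\
  forall m l, (m <= j)%N -> normc (F l (u m)) <= C + 1].
have [| | | |F [f [SF fA tf _]]] := @nested_limit _ _ _ openO nonemptyO volO N S ((C + 1) ^+ 2).
- by move=> j F [[FA _] _].
- move=> j F F' [FS FB] [FS' FB'].
  have E l z : (F l z + F' l z) / 2 = (1 - 2^-1 : R)%:C * F l z + (2^-1 : R)%:C * F' l z.
    have -> : (1 - 2^-1 : R) = 2^-1 by lra.
    by rewrite -mulrDr mulrC fmorphV rmorph_nat.
  have E' : (fun l z => (F l z + F' l z) / 2) =
      fun l z => (1 - 2^-1 : R)%:C * F l z + (2^-1 : R)%:C * F' l z.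
    by apply/funext => l; apply/funext => z; exact: E.
  split; first by rewrite E'; exact: solution_convex.
  move=> m l mj; rewrite ComplexField.Normc.normcM ComplexField.Normc.normcV (normc_nat 2).
  rewrite ler_pdivrMr//; apply: le_trans (normcD _ _) _.
  by have := FB m l mj; have := FB' m l mj; lra.
- by move=> j F [FS FB]; split=> // m l mj; apply: FB; exact: leqW.
(* The constraints of [S j] concern the [j.+1] points [u 0, ..., u j]. *)
- move=> j; have [F [FS FG FB]] := @finite_points j.+1 (fun m => u m) (ltn0Sn j) (fun m => Ou m).
  by exists F => //; split=> // m l mj; exact: (FB l (Ordinal (mj : (m < j.+1)%N))).
exists f; split; first split=> // z Oz.
  apply: tends_unique (tends_sum (phi ^~ z) (fun l => tf l z Oz)) _ => e e0.
  by exists 0%N => j _; have [[_ F1] _] := SF j; rewrite F1// subrr ComplexField.Normc.normc0 ltW.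
move=> l; have [hf _] := fA l.
apply: (contO_le_dense (contO_normc hf) udense) => m.
have := @tends_le _ _ _ 0 (C + 1) m (tf l (u m) (Ou m)); rewrite subr0; apply=> j mj.
by rewrite subr0; have [_] := SF j; exact.
Qed.

End Solutions.

Lemma convex_poisson_corona : convex_poisson_property Omega -> corona_property Omega.
Proof.
move=> cpp N c phi data; have [C C0 CP] := cpp N c phi data.
have [f [[fA f1] fB]] := bounded_solution C0 CP.
have C10 : 0 < C + 1 by rewrite addr_gt0.
exists (C + 1), f; split=> // [l|z Oz].
  by have [hf _] := fA l; split=> //; exists (C + 1) => z; exact: fB.
split; last exact: f1.
apply: bigmax_le => [|l _]; first exact: sqr_ge0.
by rewrite ler_sqr ?nnegrE ?normc_ge0 ?(ltW C10)// fB.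
Qed.

End Corona.

Theorem corollary35 (R : realType) (n : nat) (n_gt0 : (0 < n)%N)
    (D : set 'rV[R[i]]_n)
    (D_domain : domain D) (D_bounded : bounded_set D)
    (D_spsc : smooth_strictly_pseudoconvex D)
    (D_kernel : 0 < inf [set r : R | exists z w : 'rV[R[i]]_n,
       [/\ D z, D w & r = ComplexField.Normc.normc (bergman_kernel D w z)]]) :
  exists (j : nat) (eps : R), 0 < eps /\
    forall Omega : set 'rV[R[i]]_n,
      domain Omega -> close_domain j eps D Omega ->
      (corona_property Omega <-> convex_poisson_property Omega).
Proof.
exists 0%N, 1; split=> // Omega [openO _ nonemptyO] close.
have volO := close_domain_volume_lty D_bounded openO close.
by split; [exact: corona_convex_poisson|exact: convex_poisson_corona].
Qed.
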